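(* Let $n \ge 1$ and let $E \subseteq \mathbb{S}^n$ be a Borel set. Then $$\lim_{t \to \infty} t^n \int_E \int_{\mathbb{S}^n \setminus E} \frac{1}{\tilde d(x,y)^{n-t}} \, \mathrm{d}\mathcal{H}^n(y)\, \mathrm{d}\mathcal{H}^n(x) = c_{n,1}\, \mathcal{H}^n\big((-E) \cap (\mathbb{S}^n\setminus E)\big),$$ where $c_{n,1} = \mathcal{H}^{n-1}(\mathbb{S}^{n-1})\, \pi^n\, (n-1)!$.
   Context: $\mathbb{S}^n \subseteq \mathbb{R}^{n+1}$ is the Euclidean unit sphere, $\mathcal{H}^k$ is the $k$-dimensional Hausdorff measure, $d(x,y) \in [0,\pi]$ is the geodesic distance on $\mathbb{S}^n$, $\tilde d(x,y) = d(x,y)/\pi \in [0,1]$ is the normalized geodesic distance, and $-E = \{-x : x \in E\}$. *)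

(* Defs.v *)
From HB Require Import structures.
From mathcomp Require Import all_boot all_order all_algebra.
From mathcomp Require Import all_classical all_reals all_analysis.

Set Implicit Arguments.
Unset Strict Implicit.
Unset Printing Implicit Defensive.

Import Order.TTheory GRing.Theory Num.Theory.
Import numFieldNormedType.Exports.

Local Open Scope classical_set_scope.
Local Open Scope ring_scope.

(* R^m carries its Borel sigma-algebra. The library's norm on 'rV is the sup
   norm, but it induces the same open sets as the Euclidean one. *)
HB.instance Definition _ (R : realType) (m : nat) :=
  Measurable.copy 'rV[R]_m (g_sigma_algebraType (@open 'rV[R]_m)).

Section Euclidean.
Context {R : realType} {m : nat}.
Implicit Types (x y : 'rV[R]_m) (A : set 'rV[R]_m).

Definition dotp x y : R := \sum_i x ord0 i * y ord0 i.

Definition eucl_dist x y : R := Num.sqrt (dotp (x - y) (x - y)).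

Definition eucl_diam A : \bar R :=
  ereal_sup [set (eucl_dist p.1 p.2)%:E | p in A `*` A].

End Euclidean.

Section Hausdorff.
Context {R : realType}.

Definition Gamma (s : R) : R :=
  \int[@lebesgue_measure R]_(x in `]0, +oo[) (x `^ (s - 1) * expR (- x)).

(* The volume of the Euclidean unit ball of R^k. *)
Definition ball_volume (k : nat) : R :=
  pi `^ (k%:R / 2) / Gamma (k%:R / 2 + 1).

Context {m : nat}.
Implicit Types (A : set 'rV[R]_m) (k : nat).

Local Open Scope ereal_scope.

(* The empty set weighs 0 and a point weighs 0 ^+ 0 = 1 when k = 0, so that
   the 0-dimensional measure counts points. *)
Definition hausdorff_weight k A : \bar R :=
  if A == set0 then 0
  else (ball_volume k)%:E * (eucl_diam A * (2^-1)%:E) ^+ k.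

Definition hausdorff_content k (delta : R) A : \bar R :=
  ereal_inf [set \sum_(0 <= i <oo) hausdorff_weight k (C i) |
    C in [set C : nat -> set 'rV[R]_m |
      A `<=` \bigcup_i C i /\ forall i, eucl_diam (C i) <= delta%:E]].

(* The limit as delta tends to 0 is a supremum, by monotonicity in delta. The
   normalization by ball_volume makes the k-dimensional measure on R^k agree
   with Lebesgue measure. *)
Definition hausdorff k A : \bar R :=
  ereal_sup [set hausdorff_content k delta A | delta in [set d : R | (0 < d)%R]].

End Hausdorff.

Section Sphere.
Context {R : realType} {n : nat}.

Definition sphere : set 'rV[R]_n.+1 := [set x | dotp x x = 1].

Implicit Types x y : 'rV[R]_n.+1.

(* On the unit sphere, the geodesic distance is the angle between x and y. *)
Definition geodist x y : R := acos (dotp x y).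

Definition ngeodist x y : R := geodist x y / pi.

End Sphere.
Arguments sphere R n : clear implicits.

(* Main.v *)
(** As t grows, the kernel d~(x,y)^(t-n) concentrates on antipodal pairs, where d~ = 1. By the
    layer cake formula its integral over y is governed by the area of the cap of angle r around
    -x, which is omega_n r^n (1 + o(1)) uniformly in x, because a cap is the graph of a map with
    Lipschitz constant 1/cos r over the disc of radius sin r. Euler's beta integral then gives
    t^n int d~(x,y)^(t-n) dy -> n! pi^n omega_n, and n omega_n is the area of S^(n-1).

    After reflecting y, the remaining point is that the energy between a Borel set A and its
    complement vanishes. It does when A is open, since A is exhausted by sets at positive
    distance from its complement, where the kernel decays exponentially; and the sets with this
    property form a sigma-algebra. Hence, with F = -(S \ E), the energy of E x F is asymptotically
    that of (E /\ F) x S.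

    The normalization of the Hausdorff measure enters through H^n = Lebesgue measure on R^n: one
    inequality is the isodiametric inequality, a consequence of the Prekopa-Leindler inequality
    applied to A and -A; for the other, both measures are translation invariant, hence
    proportional by Tonelli, and the factor is at most 1 because a cube contains a ball, which,
    used as a covering set of itself, weighs exactly its volume. *)
From HB Require Import structures.
Require Import Defs.
From mathcomp Require Import all_boot all_order all_algebra.
From mathcomp Require Import all_classical all_reals all_analysis.
From mathcomp Require Import measurable_realfun ring lra.

Set Implicit Arguments.
Unset Strict Implicit.
Unset Printing Implicit Defensive.

Import Order.TTheory GRing.Theory Num.Theory.
Import numFieldNormedType.Exports.

Local Open Scope classical_set_scope.
Local Open Scope ring_scope.

(** * Euclidean norm and measurability of row vectors *)

(** Only the leading order of the cap area matters: an error of order r^(n+1) gains a factor 1/t in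
    the beta integral, so sharp cap bounds are needed for small r only. Uniformity in x costs
    nothing, because reflections move every point of the sphere to the pole.

    Areas on the sphere are accessible only through the Hausdorff measure, so they are all obtained
    by Lipschitz comparison with flat sets or by measuring a set of pairs in two orders. The area of
    the sphere is found in this way without polar coordinates, and the Gamma factor of [ball_volume]
    comes from integrating exp(-u) over |x|^2 <= u in both orders.

    A Borel set may have a boundary of positive area, so no estimate by distance to the boundary can
    work for it directly. What carries the argument from open sets to Borel sets is a bound of the
    energy of X x S by a constant times the area of X, the constant being the same for all X: it
    lets a set be replaced by an inner approximation in area. *)

Section Dotp.
Context {R : realType} {m : nat}.
Implicit Types x y z : 'rV[R]_m.

Lemma dotpC x y : dotp x y = dotp y x.
Proof. by apply: eq_bigr => i _; rewrite mulrC. Qed.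

Lemma dotpDl x y z : dotp (x + y) z = dotp x z + dotp y z.
Proof. by rewrite -big_split; apply: eq_bigr => i _; rewrite mxE mulrDl. Qed.

Lemma dotpZl (a : R) x y : dotp (a *: x) y = a * dotp x y.
Proof. by rewrite /dotp big_distrr; apply: eq_bigr => i _; rewrite mxE -mulrA. Qed.

Lemma dotpNl x y : dotp (- x) y = - dotp x y.
Proof. by rewrite -scaleN1r dotpZl mulN1r. Qed.

Lemma dotpBl x y z : dotp (x - y) z = dotp x z - dotp y z.
Proof. by rewrite dotpDl dotpNl. Qed.

Lemma dotpDr x y z : dotp z (x + y) = dotp z x + dotp z y.
Proof. by rewrite dotpC dotpDl !(dotpC _ z). Qed.

Lemma dotpZr (a : R) x y : dotp x (a *: y) = a * dotp x y.
Proof. by rewrite dotpC dotpZl dotpC. Qed.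

Lemma dotpNr x y : dotp x (- y) = - dotp x y.
Proof. by rewrite dotpC dotpNl dotpC. Qed.

Lemma dotpBr x y z : dotp z (x - y) = dotp z x - dotp z y.
Proof. by rewrite dotpDr dotpNr. Qed.

Lemma dotp0l x : dotp 0 x = 0.
Proof. by apply: big1 => i _; rewrite mxE mul0r. Qed.

Lemma dotp_ge0 x : 0 <= dotp x x.
Proof. by apply: sumr_ge0 => i _; rewrite -expr2 sqr_ge0. Qed.

Lemma dotp_eq0 x : (dotp x x == 0) = (x == 0).
Proof.
apply/idP/eqP => [|->]; last by rewrite dotp0l.
rewrite psumr_eq0 => [/allP x0|i _]; last by rewrite -expr2 sqr_ge0.
apply/rowP => i; rewrite mxE; apply/eqP.
by have := x0 i (mem_index_enum _); rewrite mulf_eq0 orbb.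
Qed.

Lemma sqr_coord_le_dotp x i : x 0 i ^+ 2 <= dotp x x.
Proof.
rewrite /dotp (bigD1 i)//= -expr2 lerDl.
by apply: sumr_ge0 => j _; rewrite -expr2 sqr_ge0.
Qed.

Lemma dotp_CauchySchwarz x y : dotp x y ^+ 2 <= dotp x x * dotp y y.
Proof.
have [->|y0] := eqVneq y 0.
  by rewrite (dotpC _ 0) dotp0l dotp0l expr0n mulr0.
have yy0 : 0 < dotp y y by rewrite lt_neqAle eq_sym dotp_eq0 y0 dotp_ge0.
have := dotp_ge0 (dotp y y *: x - dotp x y *: y).
rewrite !(dotpBl, dotpBr, dotpZl, dotpZr) (dotpC y x).
set a := dotp x y; set b := dotp x x; set c := dotp y y in yy0 *.
rewrite (_ : _ - _ = c * (b * c - a ^+ 2)); last by ring.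
by rewrite pmulr_rge0// subr_ge0.
Qed.

Definition enorm x : R := Num.sqrt (dotp x x).

Lemma eucl_distE x y : eucl_dist x y = enorm (x - y).
Proof. by []. Qed.

Lemma enorm_ge0 x : 0 <= enorm x.
Proof. exact: sqrtr_ge0. Qed.

Lemma sqr_enorm x : enorm x ^+ 2 = dotp x x.
Proof. by rewrite sqr_sqrtr// dotp_ge0. Qed.

Lemma enorm_le x (r : R) : 0 <= r -> (enorm x <= r) = (dotp x x <= r ^+ 2).
Proof. by move=> r0; rewrite -sqr_enorm ler_sqr// nnegrE enorm_ge0. Qed.

Lemma enorm0 : enorm 0 = 0.
Proof. by rewrite /enorm dotp0l sqrtr0. Qed.

Lemma enorm_eq0 x : (enorm x == 0) = (x == 0).
Proof. by rewrite -dotp_eq0 -sqr_enorm sqrf_eq0. Qed.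

Lemma enormN x : enorm (- x) = enorm x.
Proof. by rewrite /enorm dotpNl dotpNr opprK. Qed.

Lemma enormZ (a : R) x : enorm (a *: x) = `|a| * enorm x.
Proof.
by rewrite /enorm dotpZl dotpZr mulrA -expr2 sqrtrM ?sqr_ge0// sqrtr_sqr.
Qed.

Lemma coord_le_enorm x i : `|x 0 i| <= enorm x.
Proof.
by rewrite -ler_sqr ?nnegrE// ?enorm_ge0// real_normK ?num_real// sqr_enorm
  sqr_coord_le_dotp.
Qed.

Lemma dotp_le_enorm x y : dotp x y <= enorm x * enorm y.
Proof.
apply: le_trans (ler_norm _) _.
rewrite -ler_sqr ?nnegrE// ?mulr_ge0 ?enorm_ge0//.
by rewrite real_normK ?num_real// exprMn !sqr_enorm dotp_CauchySchwarz.
Qed.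

Lemma enormD x y : enorm (x + y) <= enorm x + enorm y.
Proof.
rewrite enorm_le ?addr_ge0 ?enorm_ge0// dotpDl !dotpDr (dotpC y x).
rewrite sqrrD !sqr_enorm.
have := dotp_le_enorm x y; lra.
Qed.

Lemma enorm_distC x y : enorm (x - y) = enorm (y - x).
Proof. by rewrite -enormN opprB. Qed.

Lemma enorm_triangle x y z : enorm (x - z) <= enorm (x - y) + enorm (y - z).
Proof. by rewrite (le_trans _ (enormD _ _))// subrKA. Qed.

Lemma dotp_le_coord x (s : R) : (forall i, `|x 0 i| <= s) ->
  dotp x x <= m%:R * s ^+ 2.
Proof.
move=> xs; rewrite /dotp (le_trans (ler_sum _ (_ : forall i, _ -> _ <= s ^+ 2)))//.
  move=> i _; rewrite -expr2 -real_normK ?num_real//.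
  by rewrite ler_sqr ?nnegrE// (le_trans (normr_ge0 _) (xs i)).
by rewrite sumr_const card_ord mulr_natl.
Qed.

Lemma enorm_le_coord x (s : R) : 0 <= s -> (forall i, `|x 0 i| <= s) ->
  enorm x <= Num.sqrt m%:R * s.
Proof.
move=> s0 xs; rewrite enorm_le ?mulr_ge0 ?sqrtr_ge0//.
by rewrite exprMn sqr_sqrtr// dotp_le_coord.
Qed.

End Dotp.

Section Topology.
Context {R : realType} {m : nat}.

Lemma continuous_dotp (T : topologicalType) (f g : T -> 'rV[R]_m) :
  continuous f -> continuous g -> continuous (fun t => dotp (f t) (g t)).
Proof.
move=> cf cg; rewrite /dotp.
apply: (continuous_big (op := +%R)) => [|i _ t]; first exact: add_continuous.
apply: cvgM.
  exact: (continuous_comp (cf t) (@coord_continuous _ _ _ ord0 i _)).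
exact: (continuous_comp (cg t) (@coord_continuous _ _ _ ord0 i _)).
Qed.

Lemma continuous_enorm : continuous (@enorm R m).
Proof.
move=> x; apply: (continuous_comp (f := fun x => dotp x x)).
  by apply: continuous_dotp => ?; exact: cvg_id.
exact: sqrt_continuous.
Qed.

Lemma continuous_subr (c : 'rV[R]_m) : continuous (fun x : 'rV[R]_m => x - c).
Proof.
move=> x; exact: (@cvgB R _ _ (nbhs x) _ id (cst c) x c (@cvg_id _ _) (cvg_cst _)).
Qed.

Lemma closed_eball (c : 'rV[R]_m) (r : R) : closed [set x | enorm (x - c) <= r].
Proof.
apply: (@closed_comp _ _ (fun x => enorm (x - c)) [set x | x <= r]).
  move=> x _; apply: (continuous_comp (f := fun x => x - c)).
    exact: continuous_subr.
  exact: continuous_enorm.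
exact: closed_le.
Qed.

Lemma open_measurable_row (U : set 'rV[R]_m) : open U -> measurable U.
Proof. by move=> oU; apply: sub_sigma_algebra. Qed.

Lemma closed_measurable_row (U : set 'rV[R]_m) : closed U -> measurable U.
Proof.
move=> cU; rewrite -(setCK U); apply: measurableC; apply: open_measurable_row.
exact: closed_openC.
Qed.

Lemma continuous_measurable_row (f : 'rV[R]_m -> R) : continuous f ->
  measurable_fun setT f.
Proof.
move=> /continuousP cf.
apply: (measurability _ (measurable_realfun.RGenOpens.measurableE R)) => _ [_ [a [b ->] <-]].
by rewrite setTI; apply: open_measurable_row; apply: cf; exact: interval_open.
Qed.

Lemma measurable_coord i : measurable_fun setT (fun x : 'rV[R]_m => x 0 i).
Proof. by apply: continuous_measurable_row => x; exact: coord_continuous. Qed.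

Let rat_box (q : 'rV[rat]_m * nat) : set 'rV[R]_m :=
  [set x | forall i, `|x 0 i - ratr (q.1 0 i)| < q.2.+1%:R^-1].

(** Rational boxes form a countable base of the topology; this reduces measurability of a
    vector-valued map to that of its coordinates. *)
Lemma open_bigcup_box (U : set 'rV[R]_m) : open U ->
  U = \bigcup_(q in [set q | rat_box q `<=` U]) rat_box q.
Proof.
move=> oU; apply/seteqP; split => [x Ux|x [q /= qU]]; last exact: qU.
have /nbhs_ballP[e /= e0 xeU] : nbhs x U by exact: open_nbhs_nbhs.
have [k ke] : exists k, k.+1%:R^-1 < e / 2 :> R.
  have [k _ /(_ k (leqnn k)) kP] := near_infty_natSinv_lt (PosNum (divr_gt0 e0 (ltr0Sn R 1))).
  by exists k.
have k0 : 0 < k.+1%:R^-1 :> R by rewrite invr_gt0.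
have qP i : exists q : rat, x 0 i - k.+1%:R^-1 < ratr q < x 0 i + k.+1%:R^-1.
  have /rat_in_itvoo[q] : x 0 i - k.+1%:R^-1 < x 0 i + k.+1%:R^-1.
    by rewrite (lt_trans (y := x 0 i))// ?ltrDl// gtrBl.
  by rewrite in_itv/=; exists q.
have [q qE] := choice qP.
exists (\row_i q i, k) => /=; last first.
  by move=> i /=; rewrite mxE ltr_distlC; exact: qE.
move=> y xy; apply: xeU; split => // i j; rewrite ord1.
have := xy j; rewrite /= mxE /ball/= /ball_ ltr_distl => /andP[].
have /andP[] := qE j; move: (k.+1%:R^-1) (ratr _) k0 ke => d r *.
rewrite ltr_distlC; apply/andP; split; lra.
Qed.

Lemma measurable_rowP d (T : measurableType d) (D : set T) (f : T -> 'rV[R]_m) :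
  measurable D ->
  (forall i, measurable_fun D (fun t => f t 0 i)) -> measurable_fun D f.
Proof.
move=> mD mf; apply: (measurability (@open 'rV[R]_m)) => // _ [U oU <-].
rewrite (open_bigcup_box oU) preimage_bigcup setI_bigcupr.
rewrite bigcup_mkcond; apply: countable_bigcupT_measurable => [|q].
  exact: countableP.
case: ifPn => // _.
(* The last factor [D] matters for [m = 0], where the intersection over the coordinates is
   everything. *)
rewrite (_ : _ `&` _ = \bigcap_(i in [set: 'I_m])
  (D `&` [set t | `|f t 0 i - ratr (q.1 0 i)| < q.2.+1%:R^-1]) `&` D); last first.
  apply/seteqP; split => t /=; first by move=> [Dt ft]; split=> [i _|//]; split => //; exact: ft.
  by move=> [ft Dt]; split => // i; have [] := ft i Logic.I.
apply: measurableI => //; apply: fin_bigcap_measurable => // i _.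
have mg : measurable_fun D (fun t => `|f t 0 i - ratr (q.1 0 i)|).
  by apply: measurableT_comp => //; apply: measurable_funB => //; exact: mf.
have := mg mD _ (measurable_itv `]-oo, q.2.+1%:R^-1[).
by congr (measurable (_ `&` _)); apply/seteqP; split => t /=; rewrite in_itv.
Qed.

End Topology.

Section MeasurableRow.
Context {R : realType} {m : nat} d (T : measurableType d) (D : set T).
Implicit Types f g : T -> 'rV[R]_m.

Lemma measurable_fun_coord f i :
  measurable_fun D f -> measurable_fun D (fun t => f t 0 i).
Proof. exact: measurableT_comp (measurable_coord i). Qed.

Lemma measurable_fun_rowD f g (mD : measurable D) :
  measurable_fun D f -> measurable_fun D g -> measurable_fun D (fun t => f t + g t).
Proof.
move=> mf mg; apply: measurable_rowP => // i; under eq_fun do rewrite mxE.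
by apply: measurable_funD; exact: measurable_fun_coord.
Qed.

Lemma measurable_fun_rowZ (a : T -> R) f (mD : measurable D) :
  measurable_fun D a -> measurable_fun D f -> measurable_fun D (fun t => a t *: f t).
Proof.
move=> ma mf; apply: measurable_rowP => // i; under eq_fun do rewrite mxE.
by apply: measurable_funM => //; exact: measurable_fun_coord.
Qed.

Lemma measurable_fun_rowN f (mD : measurable D) :
  measurable_fun D f -> measurable_fun D (fun t => - f t).
Proof.
move=> mf; under eq_fun do rewrite -scaleN1r.
by apply: measurable_fun_rowZ => //; exact: measurable_cst.
Qed.

Lemma measurable_fun_rowB f g (mD : measurable D) :
  measurable_fun D f -> measurable_fun D g -> measurable_fun D (fun t => f t - g t).
Proof. by move=> mf mg; apply: measurable_fun_rowD => //; exact: measurable_fun_rowN. Qed.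

Lemma measurable_fun_dotp f g :
  measurable_fun D f -> measurable_fun D g -> measurable_fun D (fun t => dotp (f t) (g t)).
Proof.
move=> mf mg; rewrite /dotp.
apply: measurable_sum => i.
by apply: measurable_funM; exact: measurable_fun_coord.
Qed.

Lemma measurable_fun_enorm f :
  measurable_fun D f -> measurable_fun D (fun t => enorm (f t)).
Proof. exact: measurableT_comp (continuous_measurable_row continuous_enorm). Qed.

End MeasurableRow.

Section Vcons.
Context {R : realType} {n : nat}.

Definition vcons (a : R) (v : 'rV[R]_n) : 'rV[R]_n.+1 :=
  \row_j oapp (v 0) a (unlift ord0 j).

Definition vtail (x : 'rV[R]_n.+1) : 'rV[R]_n := \row_j x 0 (lift ord0 j).

Lemma vcons0 a v : vcons a v 0 0 = a.
Proof. by rewrite mxE unlift_none. Qed.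

Lemma vcons_lift a v j : vcons a v 0 (lift ord0 j) = v 0 j.
Proof. by rewrite mxE liftK. Qed.

Lemma vtail_vcons a v : vtail (vcons a v) = v.
Proof. by apply/rowP => j; rewrite mxE vcons_lift. Qed.

Lemma vcons_vtail (x : 'rV[R]_n.+1) : vcons (x 0 0) (vtail x) = x.
Proof.
by apply/rowP => j; rewrite mxE; case: unliftP => [i ->|->] /=; rewrite ?mxE.
Qed.

Lemma vconsD a b v w : vcons a v + vcons b w = vcons (a + b) (v + w).
Proof. by apply/rowP => j; rewrite !mxE; case: unlift => //= i; rewrite mxE. Qed.

Lemma vconsZ (k : R) a v : k *: vcons a v = vcons (k * a) (k *: v).
Proof. by apply/rowP => j; rewrite !mxE; case: unlift => //= i; rewrite mxE. Qed.

Lemma vconsN a v : - vcons a v = vcons (- a) (- v).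
Proof. by rewrite -scaleN1r vconsZ mulN1r scaleN1r. Qed.

Lemma vconsB a b v w : vcons a v - vcons b w = vcons (a - b) (v - w).
Proof. by rewrite vconsN vconsD. Qed.

Lemma dotp_vcons a b v w : dotp (vcons a v) (vcons b w) = a * b + dotp v w.
Proof.
rewrite /dotp big_ord_recl !vcons0; congr (_ + _).
by apply: eq_bigr => i _; rewrite !vcons_lift.
Qed.

Lemma dotp_vtail (x y : 'rV[R]_n.+1) :
  dotp x y = x 0 0 * y 0 0 + dotp (vtail x) (vtail y).
Proof. by rewrite -[x in LHS]vcons_vtail -[y in LHS]vcons_vtail dotp_vcons. Qed.

Lemma measurable_fun_vcons d (T : measurableType d) (D : set T) a v :
  measurable D -> measurable_fun D a -> measurable_fun D v ->
  measurable_fun D (fun t => vcons (a t) (v t)).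
Proof.
move=> mD ma mv; apply: measurable_rowP => // j.
under eq_fun do rewrite mxE.
by case: unlift => //= i; exact: measurable_fun_coord.
Qed.

Lemma measurable_vtail : measurable_fun setT vtail.
Proof.
apply: measurable_rowP => // j; under eq_fun do rewrite mxE.
exact: measurable_coord.
Qed.

End Vcons.

(** * Hausdorff measure as a Borel measure *)

Section HausdorffWeight.
Context {R : realType}.
Local Open Scope ereal_scope.

(** Only the sign is available at this point. Positivity, for which [Gamma] must be finite and
    nonzero at its argument, comes out of [leb_unit_ball]. *)
Lemma ball_volume_ge0 k : (0 <= ball_volume k :> R)%R.
Proof.
apply: divr_ge0; first exact: powR_ge0.
by apply: Rintegral_ge0 => x _; rewrite mulr_ge0 ?powR_ge0// expR_ge0.
Qed.

Lemma lee_expe (x y : \bar R) k : 0 <= x -> x <= y -> x ^+ k <= y ^+ k.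
Proof.
move=> x0 xy; elim: k => // k ih; rewrite !expeS lee_pmul//; exact: expe_ge0.
Qed.

Lemma mule_expe (x y : \bar R) k : (x * y) ^+ k = x ^+ k * y ^+ k.
Proof. by elim: k => [|k ih]; rewrite ?expe0 ?mule1// !expeS ih muleACA. Qed.

Context {m : nat}.
Implicit Types A B : set 'rV[R]_m.

Lemma eucl_diam_leP A (d : R) :
  eucl_diam A <= d%:E <-> forall x y, A x -> A y -> (enorm (x - y) <= d)%R.
Proof.
split => [Ad x y Ax Ay|Ad].
  rewrite -lee_fin (le_trans _ Ad)//; apply: ereal_sup_ubound.
  by exists (x, y).
by apply: ge_ereal_sup => _ [[x y] [/= Ax Ay] <-]; rewrite lee_fin Ad.
Qed.

Lemma le_eucl_diam A B : A `<=` B -> eucl_diam A <= eucl_diam B.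
Proof.
move=> AB; apply: ereal_sup_le => _ [[x y] [/= Ax Ay] <-].
by exists (x, y) => //; split; exact: AB.
Qed.

Lemma eucl_diam_ge0 A : A !=set0 -> 0 <= eucl_diam A.
Proof.
move=> [x Ax]; apply: ereal_sup_ubound; exists (x, x) => //=.
by rewrite eucl_distE subrr enorm0.
Qed.

(** With this value the empty set passes every diameter bound, so covers may be padded with it. *)
Lemma eucl_diam0 : eucl_diam (set0 : set 'rV[R]_m) = -oo.
Proof. by apply/ereal_sup_ninfty => _ [[x y] [[]]]. Qed.

Lemma hausdorff_weight0 k : hausdorff_weight k (set0 : set 'rV[R]_m) = 0.
Proof. by rewrite /hausdorff_weight eqxx. Qed.

Lemma hausdorff_weight_ge0 k A : 0 <= hausdorff_weight k A.
Proof.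
rewrite /hausdorff_weight; case: ifPn => // /set0P A0.
rewrite mule_ge0 ?lee_fin ?ball_volume_ge0//.
by rewrite expe_ge0// mule_ge0// ?eucl_diam_ge0// lee_fin.
Qed.

Lemma le_hausdorff_weight k A B :
  A `<=` B -> hausdorff_weight k A <= hausdorff_weight k B.
Proof.
move=> AB; rewrite {1}/hausdorff_weight; case: ifPn => [|/set0P A0].
  by rewrite hausdorff_weight_ge0.
have /set0P B0 : B !=set0 by case: A0 => x /AB; exists x.
rewrite /hausdorff_weight (negbTE B0).
rewrite lee_wpmul2l ?lee_fin ?ball_volume_ge0// lee_expe//.
  by rewrite mule_ge0// ?eucl_diam_ge0// lee_fin.
by rewrite lee_wpmul2r ?lee_fin// le_eucl_diam.
Qed.

End HausdorffWeight.

Section HausdorffOuter.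
Context {R : realType} {m : nat} (k : nat).
Local Open Scope ereal_scope.
Implicit Types A B : set 'rV[R]_m.

(* The library's [mu_ext] needs a semiring of sets for its covers; here every set is allowed. *)
Let T := g_sigma_algebraType [set: set 'rV[R]_m].
(** An infinite weight on sets of diameter above [delta] turns the infimum over fine covers into one
    over all covers, so that the general theory of outer measures applies. *)
Let weight delta (A : set T) : \bar R :=
  if eucl_diam (A : set 'rV[R]_m) <= delta%:E then hausdorff_weight k (A : set 'rV[R]_m)
  else +oo.

Let weight_ge0 delta A : 0 <= weight delta A.
Proof. by rewrite /weight; case: ifP => // _; exact: hausdorff_weight_ge0. Qed.

Let weight0 delta : weight delta set0 = 0.
Proof. by rewrite /weight eucl_diam0 leNye hausdorff_weight0. Qed.

Let hausdorff_contentE delta A : hausdorff_content k delta A = mu_ext (weight delta) A.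
Proof.
apply/eqP; rewrite eq_le; apply/andP; split.
  apply: le_ereal_inf_tmp => _ [C [_ AC] <-].
  have [Cd|] := pselect (forall i, eucl_diam (C i) <= delta%:E).
    apply: ereal_inf_lbound; exists C; first by split.
    by apply: eq_eseriesr => i _; rewrite /weight Cd.
  move=> /existsNP[i /negP Ci].
  rewrite (@eseries_pinfty _ _ _ i) ?leey// => [j _|].
    by rewrite -ltNye (lt_le_trans _ (weight_ge0 _ _)).
  by rewrite /weight (negbTE Ci).
apply: le_ereal_inf_tmp => _ [C [AC Cd] <-].
apply: ereal_inf_lbound; exists C.
  by split => // i; exact: sub_sigma_algebra.
by apply: eq_eseriesr => i _; rewrite /weight Cd.
Qed.

Lemma hausdorff_content_ge0 delta A : 0 <= hausdorff_content k delta A.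
Proof. by rewrite hausdorff_contentE; exact: mu_ext_ge0. Qed.

Lemma hausdorff_content0 delta : hausdorff_content k delta (set0 : set 'rV[R]_m) = 0.
Proof. by rewrite hausdorff_contentE; exact: (mu_ext0 (weight0 delta)). Qed.

Lemma le_hausdorff_content delta A B : A `<=` B ->
  hausdorff_content k delta A <= hausdorff_content k delta B.
Proof. by move=> AB; rewrite !hausdorff_contentE; exact: le_mu_ext. Qed.

Lemma hausdorff_content_sigma_subadditive delta :
  sigma_subadditive (hausdorff_content k delta : set 'rV[R]_m -> _).
Proof.
move=> F; rewrite hausdorff_contentE.
under eq_eseriesr do rewrite hausdorff_contentE.
exact: mu_ext_sigma_subadditive.
Qed.

Lemma hausdorff_content_le delta1 delta2 A : (delta1 <= delta2)%R ->
  hausdorff_content k delta2 A <= hausdorff_content k delta1 A.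
Proof.
move=> d12; apply: ereal_inf_le_tmp => _ [C [AC Cd] <-].
by exists C => //; split => // i; rewrite (le_trans (Cd i))// lee_fin.
Qed.

Lemma hausdorff_content_weight delta A : eucl_diam A <= delta%:E ->
  hausdorff_content k delta A <= hausdorff_weight k A.
Proof.
move=> Ad; apply: ereal_inf_lbound; exists (fun i : nat => if i is 0%N return set 'rV[R]_m then A else set0).
  split; first by move=> x Ax; exists 0%N.
  by case=> // i; rewrite eucl_diam0 leNye.
rewrite nneseries_recl//; last by move=> *; exact: hausdorff_weight_ge0.
rewrite eseries0 ?adde0// => -[|i] // _ _; exact: hausdorff_weight0.
Qed.

Lemma le_content_hausdorff delta A : (0 < delta)%R ->
  hausdorff_content k delta A <= hausdorff k A.
Proof. by move=> d0; apply: ereal_sup_ubound; exists delta. Qed.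

Lemma hausdorff_leP A x :
  (forall delta, (0 < delta)%R -> hausdorff_content k delta A <= x) ->
  hausdorff k A <= x.
Proof. by move=> Ax; apply: ge_ereal_sup => _ [delta d0 <-]; exact: Ax. Qed.

Lemma hausdorff_ge0 A : 0 <= hausdorff k A.
Proof. by rewrite (le_trans (hausdorff_content_ge0 1 A))// le_content_hausdorff. Qed.

Lemma hausdorff0 : hausdorff k (set0 : set 'rV[R]_m) = 0.
Proof.
apply/eqP; rewrite eq_le hausdorff_ge0 andbT.
by apply: hausdorff_leP => d d0; rewrite hausdorff_content0.
Qed.

Lemma le_hausdorff : {homo (hausdorff k : set 'rV[R]_m -> _) : A B / A `<=` B >-> A <= B}.
Proof.
move=> A B AB; apply: hausdorff_leP => d d0.
by rewrite (le_trans (le_hausdorff_content d AB))// le_content_hausdorff.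
Qed.

Lemma hausdorff_sigma_subadditive :
  sigma_subadditive (hausdorff k : set 'rV[R]_m -> _).
Proof.
move=> F; apply: hausdorff_leP => d d0.
rewrite (le_trans (hausdorff_content_sigma_subadditive d F))//.
apply: lee_nneseries => i *; first exact: hausdorff_content_ge0.
exact: le_content_hausdorff.
Qed.

HB.instance Definition _ := isOuterMeasure.Build R 'rV[R]_m (hausdorff k)
  hausdorff0 hausdorff_ge0 le_hausdorff hausdorff_sigma_subadditive.

(** A set of diameter at most [d] cannot meet both [A] and [B], so a cover of the union splits into
    covers of the two sets at no extra weight. *)
Lemma hausdorff_content_separated A B (d : R) :
  (forall x y, A x -> B y -> d < enorm (x - y))%R ->
  hausdorff_content k d A + hausdorff_content k d B <= hausdorff_content k d (A `|` B).
Proof.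
move=> AB; apply: le_ereal_inf_tmp => _ [C [ABC Cd] <-].
apply: (@le_trans _ _ (\sum_(0 <= i <oo) (hausdorff_weight k (C i `&` A) +
    hausdorff_weight k (C i `&` B)))); last first.
  apply: lee_nneseries => i *; first by rewrite adde_ge0// hausdorff_weight_ge0.
  have [[x [Cx Ax]]|/set0P/negP/negPn/eqP ->] := pselect (C i `&` A !=set0); last first.
    by rewrite hausdorff_weight0 add0e le_hausdorff_weight.
  have [[y [Cy By]]|/set0P/negP/negPn/eqP ->] := pselect (C i `&` B !=set0); last first.
    by rewrite hausdorff_weight0 adde0 le_hausdorff_weight.
  have /eucl_diam_leP/(_ x y Cx Cy) := Cd i.
  by rewrite leNgt AB.
rewrite nneseriesD; [|by move=> *; exact: hausdorff_weight_ge0..].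
apply: leeD; apply: ereal_inf_lbound.
  exists (fun i => C i `&` A) => //; split.
    by move=> x Ax; have [i _ Cx] := ABC x (or_introl Ax); exists i.
  by move=> i; rewrite (le_trans _ (Cd i))// le_eucl_diam.
exists (fun i => C i `&` B) => //; split.
  by move=> x Ax; have [i _ Cx] := ABC x (or_intror Ax); exists i.
by move=> i; rewrite (le_trans _ (Cd i))// le_eucl_diam.
Qed.

Lemma hausdorff_separated A B (d : R) : (0 < d)%R ->
  (forall x y, A x -> B y -> d <= enorm (x - y))%R ->
  hausdorff k A + hausdorff k B <= hausdorff k (A `|` B).
Proof.
move=> d0 AB.
have small e : (0 < e < d)%R ->
    hausdorff_content k e A + hausdorff_content k e B <= hausdorff k (A `|` B).
  move=> /andP[e0 ed]; rewrite (le_trans _ (le_content_hausdorff _ e0))//.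
  by apply: hausdorff_content_separated => x y Ax By; rewrite (lt_le_trans ed)// AB.
have [ABy|] := eqVneq (hausdorff k (A `|` B)) +oo; first by rewrite ABy leey.
rewrite -ltey => ABy.
have fA : hausdorff k A \is a fin_num.
  by rewrite ge0_fin_numE ?hausdorff_ge0// (le_lt_trans _ ABy)// le_hausdorff.
rewrite -leeBrDl//; apply: hausdorff_leP => b b0; rewrite leeBrDl//.
have fB : hausdorff_content k b B \is a fin_num.
  rewrite ge0_fin_numE ?hausdorff_content_ge0// (le_lt_trans _ ABy)//.
  by rewrite (le_trans (le_content_hausdorff _ b0))// le_hausdorff.
rewrite -leeBrDr//; apply: hausdorff_leP => a a0; rewrite leeBrDr//.
(* Contents at scale [d] add only for points at distance strictly above [d], hence the bound
   [d / 2]. Contents grow as the scale shrinks, so one scale below [a] and [b] serves both. *)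
pose e := (Num.min (Num.min a b) (d / 2))%R.
have e0 : (0 < e)%R by rewrite !lt_min a0 b0 divr_gt0.
have ea : (e <= a)%R by rewrite !ge_min lexx.
have eb : (e <= b)%R by rewrite !ge_min lexx orbT.
have ed : (e < d)%R by rewrite gt_min [X in _ || X]gtr_pMr// invf_lt1// ltr1n orbT.
by rewrite (le_trans _ (small e _)) ?e0// leeD// hausdorff_content_le.
Qed.

End HausdorffOuter.

Section HausdorffLipschitz.
Context {R : realType} {m p : nat} (k : nat).
Local Open Scope ereal_scope.

(** Covering sets are first cut down to [A], where alone [f] is Lipschitz. Taking images then
    multiplies diameters by at most [L] and weights by at most [L ^+ k], and scale [d] for the image
    corresponds to scale [d / L]. *)
Lemma hausdorff_lipschitz (f : 'rV[R]_m -> 'rV[R]_p) (A : set 'rV[R]_m) (L : R) :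
  (0 < L)%R ->
  (forall x y, A x -> A y -> enorm (f x - f y) <= L * enorm (x - y))%R ->
  hausdorff k (f @` A) <= (L ^+ k)%:E * hausdorff k A.
Proof.
move=> L0 fL; have Lk0 : (0 < L ^+ k)%R by rewrite exprn_gt0.
have diamL (C : set 'rV[R]_m) :
    eucl_diam (f @` (C `&` A)) <= L%:E * eucl_diam (C `&` A).
  apply: ge_ereal_sup => _ [[_ _] [/= [x [Cx Ax] <-] [y [Cy Ay] <-]] <-].
  rewrite eucl_distE (@le_trans _ _ (L * enorm (x - y))%:E) ?lee_fin ?fL//.
  rewrite EFinM lee_wpmul2l ?lee_fin ?(ltW L0)//; apply: ereal_sup_ubound.
  by exists (x, y).
have weightL (C : set 'rV[R]_m) :
    hausdorff_weight k (f @` (C `&` A)) <= (L ^+ k)%:E * hausdorff_weight k C.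
  rewrite {1}/hausdorff_weight; case: ifPn => [_|/set0P[_ [x CAx _]]].
    by rewrite mule_ge0 ?hausdorff_weight_ge0// lee_fin ltW.
  rewrite (@le_trans _ _ ((L ^+ k)%:E * hausdorff_weight k (C `&` A)))//; last first.
    by rewrite lee_wpmul2l ?lee_fin ?(ltW Lk0)// le_hausdorff_weight.
  have CA0 : C `&` A !=set0 by exists x.
  rewrite /hausdorff_weight ifF; last by apply/negbTE/set0P.
  rewrite muleCA lee_wpmul2l ?lee_fin ?ball_volume_ge0// EFin_expe -mule_expe lee_expe//.
    rewrite mule_ge0 ?lee_fin// eucl_diam_ge0//.
    by exists (f x), x.
  by rewrite muleA lee_wpmul2r// lee_fin.
apply: hausdorff_leP => d d0.
rewrite (@le_trans _ _ ((L ^+ k)%:E * hausdorff_content k (d / L) A))//; last first.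
  by rewrite lee_wpmul2l ?lee_fin ?(ltW Lk0)// le_content_hausdorff// divr_gt0.
rewrite -lee_pdivrMl//; apply: le_ereal_inf_tmp => _ [C [AC Cd] <-].
rewrite lee_pdivrMl// -nneseriesZl; last by move=> *; exact: hausdorff_weight_ge0.
apply: le_trans (lee_nneseries _ (fun i _ => weightL (C i))); last first.
  by move=> *; exact: hausdorff_weight_ge0.
apply: ereal_inf_lbound; exists (fun i => f @` (C i `&` A)) => //; split.
  by move=> _ [x Ax <-]; have [i _ Cx] := AC x Ax; exists i => //; exists x.
move=> i; apply/eucl_diam_leP => _ _ [x [Cx Ax] <-] [y [Cy Ay] <-].
rewrite (le_trans (fL _ _ Ax Ay))// -ler_pdivlMl// mulrC.
by have /eucl_diam_leP := Cd i; exact.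
Qed.

End HausdorffLipschitz.

Section HausdorffIsometry.
Context {R : realType} {m : nat} (k : nat).
Local Open Scope ereal_scope.

Lemma hausdorff_isometry (f g : 'rV[R]_m -> 'rV[R]_m) (A : set 'rV[R]_m) :
  cancel f g ->
  (forall x y, enorm (f x - f y) = enorm (x - y)) ->
  hausdorff k (f @` A) = hausdorff k A.
Proof.
move=> fK fi; apply/eqP; rewrite eq_le; apply/andP; split.
  rewrite -[leRHS]mul1e -(expr1n R k) hausdorff_lipschitz// => x y _ _.
  by rewrite fi mul1r.
rewrite -[leRHS]mul1e -(expr1n R k) (le_trans _ (hausdorff_lipschitz (f := g) _ _ _))//.
  by rewrite image_comp (eq_imagel (f' := id)) ?image_id// => x _; exact: fK.
by move=> _ _ [x _ <-] [y _ <-]; rewrite !fK fi mul1r.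
Qed.

End HausdorffIsometry.

Section Caratheodory.
Context {R : realType} {m : nat} (k : nat).
Local Open Scope ereal_scope.
Local Notation H := (hausdorff k : set 'rV[R]_m -> \bar R).

(* The layers [r i.+1 < f x <= r i] of even (resp. odd) index are pairwise at positive
   distance, so their measures sum to at most [H X]; hence the tail is negligible. *)
Lemma caratheodory_lipschitz_le0 (f : 'rV[R]_m -> R) :
  (forall x y, f x - f y <= enorm (x - y))%R -> H.-caratheodory [set x | (f x <= 0)%R].
Proof.
move=> fL; apply: le_caratheodory_measurable => X.
rewrite -[X in X <= _]/(H (X `&` _) + H (X `&` ~` _)) -[leRHS]/(H X).
have [->|] := eqVneq (H X) +oo; first by rewrite leey.
rewrite -ltey => HXy.
pose r i : R := (i.+1%:R^-1)%R.
have r_gt0 i : (0 < r i)%R by rewrite invr_gt0.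
have r_dec i j : (i < j)%N -> (r j < r i)%R by move=> ij; rewrite ltf_pV2 ?posrE// ltr_nat.
have r_le i j : (i <= j)%N -> (r j <= r i)%R by move=> ij; rewrite lef_pV2 ?posrE// ler_nat.
pose A i := X `&` [set x | (r i < f x)%R].
pose D i := X `&` [set x | (r i.+1 < f x <= r i)%R].
have HA i : H (X `&` [set x | (f x <= 0)%R]) + H (A i) <= H X.
  rewrite (le_trans (hausdorff_separated k (r_gt0 i) _))//; last first.
    by apply: le_hausdorff; rewrite subUset; split=> x [].
  move=> x y [_ /= fx] [_ /= fy]; rewrite enorm_distC (le_trans _ (fL _ _))//.
  by rewrite lerBrDr (le_trans _ (ltW fy))// gerDl.
have Hparity e N : \sum_(i < N) H (D (i.*2 + e)%N) <= H (\big[setU/set0]_(i < N) D (i.*2 + e)%N).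
  elim: N => [|N ih]; first by rewrite !big_ord0 hausdorff0.
  rewrite !big_ord_recr/= (le_trans (leeD2r _ ih))//.
  have [->|N0] := posnP N; first by rewrite !big_ord0 hausdorff0 add0e set0U.
  (* On the earlier layers of this parity [f] exceeds [r ((N.*2 + e).-1)], on the new one it is at
     most [r (N.*2 + e)]; the skipped layer is the gap. *)
  have d0 : (0 < r ((N.*2 + e).-1) - r (N.*2 + e)%N)%R.
    by rewrite subr_gt0 r_dec// prednK// addn_gt0 double_gt0 N0.
  apply: (hausdorff_separated k d0) => x y.
  rewrite -(bigcup_mkord N (fun i => D (i.*2 + e)%N)) => -[i /= iN [Xx /= /andP[fx _]]] [Xy /= /andP[_ fy]].
  apply: le_trans (fL _ _); apply: lerB => //.
  apply: le_trans (ltW fx); apply: r_le.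
  rewrite -ltnS prednK ?addn_gt0 ?double_gt0 ?N0//.
  by rewrite -addSn -(addSn i.*2.+1) leq_add2r -doubleS leq_double.
have HDX N : \sum_(i < N) H (D i) <= H X + H X.
  have : \sum_(i < N.*2) H (D i) = \sum_(i < N) H (D (i.*2 + 0)%N) + \sum_(i < N) H (D (i.*2 + 1)%N).
    elim: N => [|N ih]; first by rewrite !big_ord0 adde0.
    by rewrite doubleS !big_ord_recr/= ih addn0 addn1 -!addeA; congr (_ + _); rewrite addeCA.
  move=> HDE; apply: (@le_trans _ _ (\sum_(i < N.*2) H (D i))).
    rewrite -!(big_mkord xpredT (fun i => H (D i))).
    rewrite (@big_cat_nat _ _ _ N 0 N.*2)//= -?addnn ?leq_addr// leeDl// sume_ge0// => *.
    exact: hausdorff_ge0.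
  rewrite HDE leeD// (le_trans (Hparity _ _))// le_hausdorff// -(bigcup_mkord N (fun i => D (i.*2 + _)%N)) ;
    by apply: bigcup_sub => i _ x [].
have HDy : \sum_(i <oo) H (D i) < +oo.
  apply: (@le_lt_trans _ _ (H X + H X)); last by rewrite lte_add_pinfty.
  apply: lime_le; first by apply: is_cvg_nneseries => *; exact: hausdorff_ge0.
  by apply: nearW => N; rewrite big_mkord.
have HX0 N : H (X `&` ~` [set x | (f x <= 0)%R]) <= H (A N) + \sum_(N <= i <oo) H (D i).
  apply: (@le_trans _ _ (H (A N `|` \bigcup_(i in ~` `I_N) D i))).
    apply: le_hausdorff => x [Xx /= /negP]; rewrite -ltNge => fx0.
    have [rfx|rfx] := ltP (r N) (f x); first by left.
    right.
    have [j jfx] : exists j, (r j < f x)%R.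
      have [j _ /(_ j (leqnn j)) jP] := near_infty_natSinv_lt (PosNum fx0).
      by exists j.
    have := ex_intro (fun j => r j < f x)%R j jfx => {j jfx} /ex_minnP[[|j] jfx jmin].
      by have := lt_le_trans jfx rfx; rewrite ltNge r_le.
    have fxj : (f x <= r j)%R.
      by rewrite leNgt; apply/negP => /jmin; rewrite ltnn.
    exists j; last by split => //=; rewrite jfx.
    move=> /= jN; have := lt_le_trans jfx rfx.
    by rewrite ltNge r_le.
  rewrite (le_trans (outer_measureU2 _ _ _))// leeD2l//.
  exact: (outer_measure_sigma_subadditive_tail (hausdorff k)).
have fin0 : H (X `&` [set x | (f x <= 0)%R]) \is a fin_num.
  rewrite ge0_fin_numE ?hausdorff_ge0// (le_lt_trans _ HXy)//.
  by apply: le_hausdorff => x [].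
apply/lee_addgt0Pr => e e0.
have := nneseries_tail_cvg HDy (fun i _ => hausdorff_ge0 k (D i)).
move=> /fine_cvgP[tailfin /cvgrPdist_lt/(_ e e0)] taile.
near \oo => N.
have tfin : \sum_(N <= i <oo) H (D i) \is a fin_num by near: N.
have te : (`|0 - fine (\sum_(N <= i <oo) H (D i))| < e)%R by near: N.
apply: le_trans (leeD2l _ (HX0 N)) _; rewrite addeA leeD// -(fineK tfin) lee_fin.
by rewrite (le_trans (ler_norm _))// -normrN -sub0r ltW.
Unshelve. all: by end_near. Qed.

Let U := caratheodory_type (hausdorff k : set 'rV[R]_m -> \bar R).

Let measurable_cara_coord i : measurable_fun [set: U] (fun x : U => (x : 'rV[R]_m) ord0 i).
Proof.
apply: (measurability _ (measurable_realfun.RGenOInfty.measurableE R)) => _ [_ [a ->] <-].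
rewrite setTI -[X in measurable X]setCK; apply: measurableC.
rewrite [X in measurable X](_ : _ = [set x : U | ((x : 'rV[R]_m) ord0 i - a <= 0)%R]); last first.
  by apply/seteqP; split => x /=; rewrite in_itv/= andbT subr_le0 leNgt => /negP.
apply: (@caratheodory_lipschitz_le0 (fun x => x ord0 i - a)%R) => x y.
rewrite opprB addrA subrK.
by rewrite (le_trans (ler_norm _))// (le_trans _ (coord_le_enorm _ i))// !mxE.
Qed.

(** The identity is measurable from the Caratheodory sigma-algebra to the Borel one, since its
    coordinates are: a half-space is a sublevel set of the 1-Lipschitz function [x ord0 i - a]. *)
Lemma measurable_caratheodory (A : set 'rV[R]_m) : measurable A -> H.-caratheodory A.
Proof.
move=> mA.
have mid := @measurable_rowP R m _ U setT idfun measurableT measurable_cara_coord.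
by have := mid measurableT _ mA; rewrite setTI.
Qed.

Lemma hausdorff_semi_sigma_additive : semi_sigma_additive H.
Proof.
move=> F mF tF _.
apply: (@caratheodory_measure_sigma_additive _ _ (hausdorff k : {outer_measure set 'rV[R]_m -> \bar R})) => //.
  by move=> i; exact: measurable_caratheodory.
apply: caratheodory_measurable_bigcup => i; exact: measurable_caratheodory.
Qed.

HB.instance Definition _ := isMeasure.Build _ 'rV[R]_m R (hausdorff k)
  (hausdorff0 k) (hausdorff_ge0 k) hausdorff_semi_sigma_additive.

End Caratheodory.

(** * Lebesgue measure on row vectors *)

Section Lebesgue1D.
Context {R : realType}.
Local Open Scope ereal_scope.
Local Notation mu := (@lebesgue_measure R).
Implicit Types (A : set (measurableTypeR R)) (s c : R).

Let affine s c : measurableTypeR R -> measurableTypeR R := fun x => (s * x + c)%R.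

Let measurable_affine s c : measurable_fun setT (affine s c).
Proof. by apply: measurable_funD => //; apply: measurable_funM. Qed.

Lemma measurable_affine_preimage s c A :
  measurable A -> measurable [set x : measurableTypeR R | A (s * x + c)%R].
Proof. by move=> mA; have := measurable_affine s c measurableT mA; rewrite setTI. Qed.

(** For [s > 0], [s] times the image measure has the right value on half-open intervals, and
    uniqueness applies; reflection invariance gives [s < 0]. *)
Lemma lebesgue_measure_affine s c A : s != 0%R -> measurable A ->
  mu [set x | A (s * x + c)%R] = `|s|^-1%:E * mu A.
Proof.
wlog s0 : s A / (0 < s)%R => [wl s_neq0 mA|_ mA].
  have [|s_lt0] := ltP 0%R s; first by move=> s0; exact: wl.
  have {}s_lt0 : (0 < - s)%R by rewrite oppr_gt0 lt_neqAle s_neq0.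
  rewrite -[in RHS]normrN -(wl (- s)%R) ?oppr_eq0//.
  rewrite -[RHS]lebesgue_measureN.
    congr (mu _); apply/seteqP; split => x /=; by rewrite mulrNN.
  exact: measurable_affine_preimage.
rewrite gtr0_norm//.
have key : mu A = s%:E * mu [set x | A (s * x + c)%R].
  pose s' : {nonneg R} := NngNum (ltW s0).
  pose nu := mscale s' (measure_function_pushforward__canonical__measure_function_Measure mu (measurable_affine s c)).
  rewrite (@lebesgue_measure_unique _ nu)//= => _ [[a b] _ <-].
  rewrite /nu/= /mscale/= /pushforward.
  rewrite (_ : _ @^-1` _ = `]((a - c) / s)%R, ((b - c) / s)%R]%classic); last first.
    by apply/seteqP; split => x /=; rewrite !in_itv/= /affine ltr_pdivrMr//
      ler_pdivlMr// ltrBlDr lerBrDr (mulrC x).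
  rewrite !lebesgue_measure_itv/= !lte_fin ltr_pM2r ?invr_gt0// ltrD2r.
  case: ifPn => ab; last by rewrite mule0.
  rewrite -!EFinB -EFinM -mulrBl opprB addrA subrK mulrC divfK//.
  by rewrite gt_eqF.
by rewrite key muleA -EFinM mulVf ?gt_eqF// mul1e.
Qed.

Lemma ge0_integral_affine s c (f : R -> \bar R) : s != 0%R ->
  measurable_fun setT f -> (forall x, 0 <= f x) ->
  \int[mu]_x f (s * x + c)%R = `|s|^-1%:E * \int[mu]_x f x.
Proof.
move=> s0 mf f0.
rewrite -(@ge0_integral_pushforward _ _ _ _ _ _ (measurable_affine s c) mu setT f)//=.
have is0 : (0 <= `|s|^-1)%R by rewrite invr_ge0.
rewrite -(@ge0_integral_mscale _ _ _ mu setT measurableT (NngNum is0) f)//.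
apply: eq_measure_integral => A mA _.
exact: (lebesgue_measure_affine c s0 mA).
Qed.

End Lebesgue1D.

Section LebesgueStep.
Context {R : realType} {n : nat}.
Local Open Scope ereal_scope.
Variable mu : {sigma_finite_measure set 'rV[R]_n -> \bar R}.

Let vc (p : measurableTypeR R * 'rV[R]_n) : 'rV[R]_n.+1 := vcons p.1 p.2.

Let measurable_vc : measurable_fun setT vc.
Proof. by apply: measurable_fun_vcons. Qed.

Let cv (x : 'rV[R]_n.+1) : measurableTypeR R * 'rV[R]_n := (x 0%R 0%R, vtail x).

Let measurable_cv : measurable_fun setT cv.
Proof.
by apply: measurable_fun_pair; [exact: measurable_coord|exact: measurable_vtail].
Qed.

(** Rows are not pairs, so the product measure is transported along [vcons]. Tonelli then splits off
    one coordinate at a time, and volume computations become inductions on the dimension. *)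
Definition lebS (A : set 'rV[R]_n.+1) : \bar R :=
  (lebesgue_measure \x mu) (vc @^-1` A).

Let measurable_vc_preimage A : measurable A -> measurable (vc @^-1` A).
Proof. by move=> mA; rewrite -[X in measurable X]setTI; exact: measurable_vc. Qed.

Let lebS0 : lebS set0 = 0.
Proof. by rewrite /lebS preimage_set0 measure0. Qed.

Let lebS_ge0 A : 0 <= lebS A.
Proof. exact: measure_ge0. Qed.

Let lebS_semi_sigma_additive : semi_sigma_additive lebS.
Proof.
move=> F mF tF mUF; rewrite /lebS preimage_bigcup.
apply: measure_semi_sigma_additive.
- by move=> i; exact: measurable_vc_preimage.
- apply/trivIsetP => /= i j _ _ ij; rewrite -preimage_setI.
  by move/trivIsetP : tF => /(_ _ _ _ _ ij) ->//; rewrite preimage_set0.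
- by rewrite -preimage_bigcup; exact: measurable_vc_preimage.
Qed.

HB.instance Definition _ := isMeasure.Build _ 'rV[R]_n.+1 R lebS
  lebS0 lebS_ge0 lebS_semi_sigma_additive.

Let lebS_sigma_finite : sigma_finite setT lebS.
Proof.
have /sigma_finiteP[F [TF ndF Foo]] := sigma_finiteT (@lebesgue_measure R).
have /sigma_finiteP[G [TG ndG Goo]] := sigma_finiteT mu.
exists (fun i => cv @^-1` (F i `*` G i)).
  rewrite -preimage_bigcup (_ : \bigcup_n _ = setT) ?preimage_setT//.
  apply/seteqP; split => // -[a v] _.
  have [i _ Fi] : (\bigcup_i F i) a by rewrite -TF.
  have [j _ Gj] : (\bigcup_i G i) v by rewrite -TG.
  exists (maxn i j) => //; split => /=.
    by apply: (subsetPset _ _ (ndF _ _ (leq_maxl i j))).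
  by apply: (subsetPset _ _ (ndG _ _ (leq_maxr i j))).
move=> i; have [mF Fi] := Foo i; have [mG Gi] := Goo i; split.
  by rewrite -[X in measurable X]setTI; apply: measurable_cv => //; exact: measurableX.
rewrite /lebS (_ : vc @^-1` _ = F i `*` G i).
  by rewrite product_measure1E// lte_mul_pinfty// ge0_fin_numE.
by apply/seteqP; split => -[a v] /=; rewrite /cv /vc/= vcons0 vtail_vcons.
Qed.

HB.instance Definition _ := Measure_isSigmaFinite.Build _ _ _ lebS lebS_sigma_finite.

Lemma lebSE A : lebS A = \int[lebesgue_measure]_a mu [set v | A (vcons a v)].
Proof.
apply: eq_integral => a _ /=; congr (mu _).
by apply/seteqP; split => v; rewrite /xsection/= inE.
Qed.

Lemma measurable_lebS_section A : measurable A ->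
  measurable_fun (setT : set (measurableTypeR R)) (fun a => mu [set v | A (vcons a v)]).
Proof.
move=> mA; have := measurable_fun_xsection mu (measurable_vc_preimage mA).
congr measurable_fun; apply/funext => a /=; congr (mu _).
by apply/seteqP; split => v; rewrite /xsection/= inE.
Qed.

Lemma ge0_integral_lebS (f : 'rV[R]_n.+1 -> \bar R) :
  measurable_fun setT f -> (forall x, 0 <= f x) ->
  \int[lebS]_x f x = \int[lebesgue_measure]_a \int[mu]_v f (vcons a v).
Proof.
move=> mf f0.
have := @ge0_integral_pushforward _ _ _ _ _ _ measurable_vc (lebesgue_measure \x mu) setT f.
move=> /(_ measurableT mf (fun x _ => f0 x)).
rewrite /pushforward -/lebS preimage_setT => ->.
rewrite fubini_tonelli1//; last by move=> x; exact: f0.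
exact: measurableT_comp.
Qed.

Lemma measurable_integral_lebS (f : 'rV[R]_n.+1 -> \bar R) :
  measurable_fun setT f -> (forall x, 0 <= f x) ->
  measurable_fun (setT : set (measurableTypeR R)) (fun a => \int[mu]_v f (vcons a v)).
Proof.
move=> mf f0; apply: (@measurable_fun_fubini_tonelli_F _ _ _ _ _ mu (f \o vc)) => //.
  exact: measurableT_comp.
by move=> x; exact: f0.
Qed.

End LebesgueStep.

Section LebesgueRow.
Context {R : realType}.
Local Open Scope ereal_scope.

Fixpoint leb n : {sigma_finite_measure set 'rV[R]_n -> \bar R} :=
  if n is n'.+1 return {sigma_finite_measure set 'rV[R]_n -> \bar R}
  then lebS (leb n') else \d_ (0%R : 'rV[R]_0).

(** Each coordinate contributes one factor, by Tonelli. The case [s = 1] is translation invariance,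
    and [s = -1] reflection invariance. *)
Lemma lebesgue_row_affine n (s : R) (c : 'rV[R]_n) A : s != 0%R -> measurable A ->
  leb n [set x | A (s *: x + c)%R] = (`|s| ^- n)%:E * leb n A.
Proof.
move=> s0; elim: n c A => [|n ih] c A mA.
  rewrite expr0 invr1 mul1e; congr (leb 0 _).
  by apply/seteqP; split => x /=; rewrite (_ : _ + _ = x)%R//; apply/rowP => -[].
have measurable_section a : measurable [set v : 'rV[R]_n | A (vcons a v)].
  rewrite -[X in measurable X]setTI; by apply: (measurable_fun_vcons (v := idfun)) => //; exact: measurable_id.
rewrite /= !lebSE.
under eq_integral => a _.
  rewrite (_ : [set v | _] =
    [set v | [set w | A (vcons (s * a + c 0 0)%R w)] (s *: v + vtail c)%R]); last first.
    by apply/seteqP; split => v /=;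
      rewrite vconsZ -[in X in A (_ + X)%R](vcons_vtail c) vconsD.
  rewrite ih//.
  over.
rewrite ge0_integralZl//=; last first.
  apply: (@measurableT_comp _ _ _ _ _ _ (fun a => leb n [set w | A (vcons a w)]) _ (fun a => s * a + c 0 0)%R).
    exact: measurable_lebS_section.
  by apply: measurable_funD => //; apply: measurable_funM.
rewrite (@ge0_integral_affine _ s (c 0 0)%R (fun a => leb n [set w | A (vcons a w)]))//; last first.
  exact: measurable_lebS_section.
by rewrite muleA -EFinM -invfM -exprSr.
Qed.

End LebesgueRow.

(** * Layer cake and the one-dimensional Prekopa-Leindler inequality *)

Section TonelliSets.
Context {R : realType} {d1 d2} {T1 : measurableType d1} {T2 : measurableType d2}.
Variables (m1 : {sigma_finite_measure set T1 -> \bar R}).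
Variables (m2 : {sigma_finite_measure set T2 -> \bar R}).
Local Open Scope ereal_scope.
Implicit Types G : set (T1 * T2).

Let xsectionP G x : xsection G x = [set y | G (x, y)].
Proof. by apply/seteqP; split => y; rewrite /xsection/= inE. Qed.

Let ysectionP G y : ysection G y = [set x | G (x, y)].
Proof. by apply/seteqP; split => x; rewrite /ysection/= inE. Qed.

Lemma measurable_set_section1 G x : measurable G -> measurable [set y | G (x, y)].
Proof. by move=> mG; rewrite -xsectionP; exact: measurable_xsection. Qed.

Lemma measurable_measure_section1 G :
  measurable G -> measurable_fun setT (fun x => m2 [set y | G (x, y)]).
Proof.
move=> mG; have := measurable_fun_xsection m2 mG.
by congr measurable_fun; apply/funext => x /=; rewrite xsectionP.
Qed.

Lemma measurable_measure_section2 G :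
  measurable G -> measurable_fun setT (fun y => m1 [set x | G (x, y)]).
Proof.
move=> mG; have := measurable_fun_ysection m1 mG.
by congr measurable_fun; apply/funext => x /=; rewrite ysectionP.
Qed.

Lemma tonelli_set G : measurable G ->
  \int[m1]_x m2 [set y | G (x, y)] = \int[m2]_y m1 [set x | G (x, y)].
Proof.
move=> mG; have := indic_fubini_tonelli m1 m2 mG.
rewrite (indic_fubini_tonelli_FE m2 mG) (indic_fubini_tonelli_GE m1 mG).
under eq_integral do rewrite /= xsectionP.
by under [in X in _ = X -> _]eq_integral do rewrite /= ysectionP.
Qed.

End TonelliSets.

Section LayerCake.
Context {R : realType} d {T : measurableType d}.
Variable mu : {sigma_finite_measure set T -> \bar R}.
Local Open Scope ereal_scope.

Lemma measurable_superlevel (u : T -> \bar R) (s : \bar R) : measurable_fun setT u ->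
  measurable [set x | s < u x].
Proof. by move=> mu_; rewrite -[X in measurable X]setTI; exact: emeasurable_fun_o_infty. Qed.

Let superlevel (u : T -> \bar R) : set (T * measurableTypeR R) :=
  [set p | (0 < (p.2 : R) < 1)%R /\ (p.2 : R)%:E < u p.1].

Let measurable_supergraph u : measurable_fun setT u -> measurable (superlevel u).
Proof.
move=> mu_.
rewrite (_ : superlevel u = (setT `*` `]0%R, 1%R[%classic) `&`
    [set p | (p.2 : R)%:E < u p.1]); last first.
  by apply/seteqP; split => -[x s] /=; rewrite in_itv/=; [move=> [? ?]|move=> [[_ ?] ?]].
apply: measurableI; first by apply: measurableX => //; exact: measurable_itv.
rewrite -[X in measurable X]setTI; apply: measurable_lte => //.
  by apply/measurable_EFinP; exact: measurable_snd.
by apply: measurableT_comp => //; exact: measurable_fst.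
Qed.

Lemma measurable_superlevel_measure (u : T -> \bar R) : measurable_fun setT u ->
  measurable_fun (`]0%R, 1%R[%classic : set (measurableTypeR R))
    (fun s => mu [set x | (s : R)%:E < u x]).
Proof.
move=> mu_; have mG := measurable_measure_section2 mu (measurable_supergraph mu_).
apply: eq_measurable_fun (measurable_funTS mG) => s /[!inE] /=.
rewrite in_itv/= => s01; congr (mu _).
by apply/seteqP; split => x /=; [case|split].
Qed.

Let mine1_fin (y : \bar R) : 0 <= y -> mine y 1 \is a fin_num.
Proof.
move=> y0; rewrite ge0_fin_numE ?le_min ?y0 ?lee_fin ?ler01//.
by rewrite (@le_lt_trans _ _ 1) ?ltry// ge_min lexx orbT.
Qed.

(** Tonelli on the region under the graph. Keeping [s] in []0, 1[] truncates [u] at 1, which costs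
    nothing for a kernel bounded by 1 and, after rescaling, is the truncation that the
    Prekopa-Leindler inequality needs. *)
Lemma layer_cake01 (u : T -> \bar R) : measurable_fun setT u -> (forall x, 0 <= u x) ->
  \int[lebesgue_measure]_(s in `]0%R, 1%R[) mu [set x | s%:E < u x] =
  \int[mu]_x mine (u x) 1.
Proof.
move=> mu_ u0.
transitivity (\int[lebesgue_measure]_s mu [set x | superlevel u (x, s)]).
  rewrite integral_mkcond; apply: eq_integral => s _.
  rewrite patchE; case: ifPn => s01.
    congr (mu _); apply/seteqP; split => x /=; last by case.
    by split => //; move: s01; rewrite inE/= in_itv.
  rewrite (_ : [set x | _] = set0) ?measure0//.
  by apply/seteqP; split => // x [/= s01']; move: s01; rewrite notin_setE/= in_itv.
rewrite -tonelli_set; last exact: measurable_supergraph.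
apply: eq_integral => x _.
transitivity (lebesgue_measure `]0%R, (fine (mine (u x) 1))[%classic).
  congr (lebesgue_measure _); apply/seteqP; split => s /=; rewrite ?in_itv/=.
    move=> [/andP[s0 s1] su]; rewrite s0/= -lte_fin fineK ?mine1_fin//.
    by rewrite lt_min su lte_fin.
  move=> /andP[s0]; rewrite -lte_fin fineK ?mine1_fin//.
  by rewrite lt_min lte_fin => /andP[su s1]; split => //=; rewrite s0.
have fin := mine1_fin (u0 x).
rewrite lebesgue_measure_itv/= -[in RHS](fineK fin) lte_fin.
case: ifPn => [_|]; first by rewrite sube0.
rewrite -leNgt => le0; congr EFin; apply/eqP; rewrite eq_le le0 andbT.
by rewrite fine_ge0// le_min u0 lee_fin ler01.
Qed.

End LayerCake.

Section PrekopaLeindler.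
Context {R : realType}.
Local Open Scope ereal_scope.
Local Notation mu := (@lebesgue_measure R).
Implicit Types A B C : set (measurableTypeR R).

Let le_measure_mu A B : measurable A -> measurable B -> A `<=` B -> mu A <= mu B.
Proof. by move=> mA mB AB; apply: le_measure; rewrite ?inE. Qed.

(** Take [a] near the supremum of [A] and [b] near the infimum of [B]. The midpoints of [A] with [b]
    and of [B] with [a] all lie in [C], and the two families lie essentially on either side of
    [(a + b) / 2], so their measures add. *)
Let brunn_minkowski_bounded A B C (k : measurableTypeR R) : measurable A -> measurable B ->
  measurable C -> A !=set0 -> B !=set0 ->
  A `<=` `[(- k)%R, k]%classic -> B `<=` `[(- k)%R, k]%classic ->
  (forall x y, A x -> B y -> C ((x + y) / 2)%R) -> mu A + mu B <= 2%:E * mu C.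
Proof.
move=> mA mB mC A0 B0 Ak Bk ABC.
have [Cy|] := eqVneq (mu C) +oo.
  by rewrite Cy gt0_muley ?leey// lte_fin.
rewrite -ltey => Cy.
have supA : has_sup A.
  by split => //; exists k => x /Ak /=; rewrite in_itv/= => /andP[].
have infB : has_inf B.
  by split => //; exists (- k)%R => x /Bk /=; rewrite in_itv/= => /andP[].
apply/lee_addgt0Pr => e e0; have e20 : (0 < e / 2)%R by rewrite divr_gt0.
have [a Aa supa] := sup_adherent e20 supA.
have [b Bb infb] := inf_adherent e20 infB.
(* The truncations make the two families disjoint and cost at most [e / 2] each, by the choice of
   [a] and [b]. *)
pose A' := A `&` `]-oo, a[%classic; pose B' := B `&` `[b, +oo[%classic.
have mA' : measurable A' by apply: measurableI => //; exact: measurable_itv.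
have mB' : measurable B' by apply: measurableI => //; exact: measurable_itv.
have muI (u : R) : mu `[u, (u + e / 2)%R]%classic = (e / 2)%:E.
  rewrite lebesgue_measure_itv/= lte_fin ltrDl e20 -EFinB; congr EFin; lra.
have muA : mu A <= mu A' + (e / 2)%:E.
  apply: (@le_trans _ _ (mu (A' `|` `[a, (a + e / 2)%R]%classic))).
    apply: le_measure_mu => //; first by apply: measurableU => //; exact: measurable_itv.
    move=> x Ax; have [xa|ax] := ltP x a; first by left; split => //=; rewrite in_itv.
    right; rewrite /= in_itv/= ax/=.
    have := sup_upper_bound supA Ax; move: supa; lra.
  by rewrite -(muI a); apply: measureU2 => //; exact: measurable_itv.
have muB : mu B <= mu B' + (e / 2)%:E.
  apply: (@le_trans _ _ (mu (B' `|` `[(b - e / 2)%R, b]%classic))).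
    apply: le_measure_mu => //; first by apply: measurableU => //; exact: measurable_itv.
    move=> x Bx; have [bx|xb] := leP b x; first by left; split => //=; rewrite in_itv/= bx.
    right; rewrite /= in_itv/= (ltW xb) andbT.
    have := inf_lbound infB.2 Bx; move: infb; lra.
  by rewrite -(muI (b - e / 2)%R) subrK; apply: measureU2 => //; exact: measurable_itv.
pose A2 : set (measurableTypeR R) := [set z | A' (2 * z + - b)%R].
pose B2 : set (measurableTypeR R) := [set z | B' (2 * z + - a)%R].
have n2 : (2 != 0 :> R)%R by rewrite pnatr_eq0.
have half c (X : set (measurableTypeR R)) : measurable X ->
    mu [set z | X (2 * z + c)%R] = (2^-1)%:E * mu X.
  by move=> mX; rewrite lebesgue_measure_affine// normr_nat.
have mA2 : measurable A2 by exact: measurable_affine_preimage.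
have mB2 : measurable B2 by exact: measurable_affine_preimage.
have : mu (A2 `|` B2) <= mu C.
  apply: le_measure_mu => //; first exact: measurableU.
  move=> z [[Az _]|[Bz _]].
    by have := ABC _ _ Az Bb; rewrite subrK mulrC mulKf.
  by have := ABC _ _ Aa Bz; rewrite addrC subrK mulrC mulKf.
have -> : mu (A2 `|` B2) = mu A2 + mu B2.
  apply: measureU => //; apply/seteqP; split => // z [[_ /=]] + [_ /=].
  by rewrite !in_itv/= andbT; lra.
rewrite (half _ _ mA') (half _ _ mB') -ge0_muleDr// => h.
have : mu A' + mu B' <= 2%:E * mu C.
  by rewrite -lee_pdivrMl.
move=> h2; rewrite (le_trans (leeD muA muB))// addeACA -EFinD.
by rewrite (_ : (e / 2 + e / 2 = e)%R) ?leeD2r//; lra.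
Qed.

(** Exhaustion by [[-k, k]], with [k] so large that both truncated sets still contain a chosen
    point. *)
Lemma brunn_minkowski1 A B C : measurable A -> measurable B -> measurable C ->
  A !=set0 -> B !=set0 ->
  (forall x y, A x -> B y -> C ((x + y) / 2)%R) -> mu A + mu B <= 2%:E * mu C.
Proof.
move=> mA mB mC [a Aa] [b Bb] ABC.
pose I (k : nat) : set (measurableTypeR R) := `[(- k%:R)%R, k%:R%R]%classic.
have mI k : measurable (I k) by exact: measurable_itv.
have cvgI (X : set (measurableTypeR R)) : measurable X ->
    mu (X `&` I k) @[k --> \oo] --> mu X.
  move=> mX; have XE : X = \bigcup_k (X `&` I k).
    apply/seteqP; split => [x Xx|x [k _ []]//].
    have [k xk] : exists k : nat, (`|x| <= k%:R)%R.
      by exists (Num.trunc `|x|).+1; rewrite ltW// truncnS_gt.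
    by exists k => //; split => //; rewrite /I/= in_itv/= -ler_norml.
  rewrite [X in _ --> mu X]XE; apply: nondecreasing_cvg_mu.
  - by move=> k; exact: measurableI.
  - by rewrite -XE.
  - move=> k l kl; apply/subsetPset => x [Xx]; rewrite /I/= !in_itv/= -!ler_norml => xk.
    by split => //; rewrite (le_trans xk)// ler_nat.
have cvgAB : mu (A `&` I k) + mu (B `&` I k) @[k --> \oo] --> mu A + mu B.
  by apply: cvgeD; [by apply: ge0_adde_def; rewrite inE|exact: cvgI|exact: cvgI].
rewrite -(cvg_lim _ cvgAB)//; apply: lime_le; first by apply/cvg_ex; eexists; exact: cvgAB.
exists (Num.trunc (Num.max `|a : R| `|b : R|)%R).+1 => // k /= abk.
have {abk} abk : (Num.max `|a| `|b| <= k%:R)%R.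
  by rewrite (le_trans (ltW (truncnS_gt _)))// ler_nat.
move: abk; rewrite ge_max => /andP[ak bk].
apply: (@brunn_minkowski_bounded _ _ _ k%:R) => //.
- exact: measurableI.
- exact: measurableI.
- by exists a; split => //; rewrite /I/= in_itv/= -ler_norml.
- by exists b; split => //; rewrite /I/= in_itv/= -ler_norml.
- by move=> x y [Ax _] [By _]; exact: ABC.
Qed.

End PrekopaLeindler.

Section PrekopaLeindlerFunctions.
Context {R : realType}.
Local Open Scope ereal_scope.
Local Notation mu := (@lebesgue_measure R).

Lemma integral_mine_scale (f : R -> \bar R) (a : R) : (0 < a)%R ->
  measurable_fun setT f -> (forall x, 0 <= f x) ->
  \int[mu]_(s in `]0%R, 1%R[) mu [set x | (a * s)%:E < f x] =
  (a^-1)%:E * \int[mu]_x mine (f x) a%:E.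
Proof.
move=> a0 mf f0; have mcst : measurable_fun setT (cst a%:E : R -> \bar R) by exact: measurable_cst.
rewrite -ge0_integralZl//; last 3 first.
- exact: measurable_mine.
- by move=> x _; rewrite le_min f0 lee_fin ltW.
- by rewrite lee_fin invr_ge0 ltW.
have mg : measurable_fun setT (fun x => (a^-1)%:E * f x) by exact: measurable_funeM.
transitivity (\int[mu]_(s in `]0%R, 1%R[) mu [set x | s%:E < (a^-1)%:E * f x]).
  apply: eq_integral => s _; congr (mu _); apply/seteqP.
  by split => x /=; rewrite lte_pdivlMl// EFinM.
rewrite (layer_cake01 mu mg); last first.
  by move=> x; rewrite mule_ge0// lee_fin invr_ge0 ltW.
apply: eq_integral => x _.
have := f0 x; case: (f x) => [r r0|_|//].
  rewrite -!EFin_min -EFinM; congr EFin.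
  by rewrite minr_pMr ?invr_ge0 ?ltW// mulVf// gt_eqF.
by rewrite gt0_muley ?lte_fin ?invr_gt0// !minye -EFinM mulVf// gt_eqF.
Qed.

(** For [s < 1] the levels [a * s] and [b * s] lie below the suprema, so both superlevel sets are
    nonempty, and their midpoints lie where [h > m * s], with [m] the geometric mean of [a] and [b].
    Brunn-Minkowski is then integrated over [s]. *)
Let prekopa_leindler_trunc (f g h : R -> \bar R) (a b : R) :
  measurable_fun setT f -> measurable_fun setT g -> measurable_fun setT h ->
  (forall x, 0 <= f x) -> (forall x, 0 <= g x) -> (forall x, 0 <= h x) ->
  (0 < a)%R -> (0 < b)%R ->
  a%:E <= ereal_sup (range f) -> b%:E <= ereal_sup (range g) ->
  (forall x y, f x * g y <= h ((x + y) / 2)%R ^+ 2) ->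
  (\int[mu]_x mine (f x) a%:E) * (\int[mu]_x mine (g x) b%:E) <=
  (\int[mu]_x h x) ^+ 2.
Proof.
move=> mf mg mh f0 g0 h0 a0 b0 af bg fgh.
pose m : R := Num.sqrt (a * b).
have m0 : (0 < m)%R by rewrite sqrtr_gt0 mulr_gt0.
have ih0 : 0 <= \int[mu]_x h x by exact: integral_ge0.
have [->|] := eqVneq (\int[mu]_x h x) +oo; first by rewrite expe2 mulyy leey.
rewrite -ltey => hy.
have level s : (0 < s < 1)%R ->
    mu [set x | (a * s)%:E < f x] + mu [set x | (b * s)%:E < g x] <=
    2%:E * mu [set x | (m * s)%:E < h x].
  move=> /andP[s0 s1]; apply: brunn_minkowski1.
  - exact: measurable_superlevel.
  - exact: measurable_superlevel.
  - exact: measurable_superlevel.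
  - have : (a * s)%:E < ereal_sup (range f) by rewrite (lt_le_trans _ af)// lte_fin gtr_pMr.
    by move=> /ereal_sup_gt[_ [x _ <-] xs]; exists x.
  - have : (b * s)%:E < ereal_sup (range g) by rewrite (lt_le_trans _ bg)// lte_fin gtr_pMr.
    by move=> /ereal_sup_gt[_ [x _ <-] xs]; exists x.
  - move=> x y /= fx gy; rewrite ltNge; apply/negP => hms.
    have : (a * s)%:E * (b * s)%:E < ((m * s) ^+ 2)%:E.
      apply: (@lt_le_trans _ _ (f x * g y)).
        by apply: lte_pmul => //; rewrite lee_fin ltW// mulr_gt0.
      rewrite (le_trans (fgh x y))// EFin_expe lee_expe//.
    rewrite -EFinM lte_fin exprMn /m sqr_sqrtr ?mulr_ge0 ?ltW//.
    by rewrite (_ : (_ * _ * _ = a * b * s ^+ 2)%R) ?ltxx//; ring.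
have mlev (u : R -> \bar R) c : measurable_fun setT u -> (0 < c)%R ->
    measurable_fun (`]0%R, 1%R[%classic : set (measurableTypeR R))
      (fun s => mu [set x | (c * s)%:E < u x]).
  move=> mu_ c0.
  have := measurable_superlevel_measure mu (measurable_funeM (c^-1)%:E mu_).
  apply: eq_measurable_fun => s _; congr (mu _); apply/seteqP.
  by split => x /=; rewrite lte_pdivlMl// EFinM.
have : \int[mu]_(s in `]0%R, 1%R[) (mu [set x | (a * s)%:E < f x] + mu [set x | (b * s)%:E < g x]) <=
    \int[mu]_(s in `]0%R, 1%R[) (2%:E * mu [set x | (m * s)%:E < h x]).
  apply: ge0_le_integral => //.
  - by move=> s _; rewrite adde_ge0.
  - by apply: emeasurable_funD; exact: mlev.
  - by apply: measurable_funeM; exact: mlev.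
rewrite ge0_integralD//; [|exact: mlev|exact: mlev].
rewrite ge0_integralZl//; last exact: mlev.
rewrite !integral_mine_scale//.
set F := \int[mu]_x mine (f x) _; set G := \int[mu]_x mine (g x) _.
set H := \int[mu]_x mine (h x) _.
have F0 : 0 <= F by apply: integral_ge0 => x _; rewrite le_min f0 lee_fin ltW.
have G0 : 0 <= G by apply: integral_ge0 => x _; rewrite le_min g0 lee_fin ltW.
have Hh : H <= \int[mu]_x h x.
  apply: ge0_le_integral => //.
  - by move=> x _; rewrite le_min h0 lee_fin ltW.
  - exact: measurable_mine.
  - by move=> x _; rewrite ge_min lexx.
have H0 : 0 <= H by apply: integral_ge0 => x _; rewrite le_min h0 lee_fin ltW.
have Hfin : H \is a fin_num by rewrite ge0_fin_numE// (le_lt_trans Hh).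
have hfin : \int[mu]_x h x \is a fin_num by rewrite ge0_fin_numE.
have ai0 : (0 < a^-1)%R by rewrite invr_gt0.
have bi0 : (0 < b^-1)%R by rewrite invr_gt0.
move=> FGH.
have {}FGH : (a^-1)%:E * F + (b^-1)%:E * G <= (2 * (m^-1 * fine H))%:E.
  by rewrite (le_trans FGH)// -(fineK Hfin) -!EFinM.
have Ffin : F \is a fin_num.
  rewrite ge0_fin_numE//; apply: (@le_lt_trans _ _ (a%:E * (2 * (m^-1 * fine H))%:E)).
    rewrite -lee_pdivrMl//; apply: le_trans FGH.
    by rewrite leeDl// mule_ge0// lee_fin ltW.
  by rewrite -EFinM ltry.
have Gfin : G \is a fin_num.
  rewrite ge0_fin_numE//; apply: (@le_lt_trans _ _ (b%:E * (2 * (m^-1 * fine H))%:E)).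
    rewrite -lee_pdivrMl//; apply: le_trans FGH.
    by rewrite leeDr// mule_ge0// lee_fin ltW.
  by rewrite -EFinM ltry.
apply: (@le_trans _ _ (H ^+ 2)); last by rewrite lee_expe.
move: FGH; rewrite -(fineK Ffin) -(fineK Gfin) -(fineK Hfin) -!EFinM -EFinD -EFin_expe !lee_fin.
have := fine_ge0 F0; have := fine_ge0 G0; have := fine_ge0 H0.
rewrite /=; move: (fine F) (fine G) (fine H) => x y z z0 y0 x0 xyz.
have mm : (m ^+ 2 = a * b)%R by rewrite sqr_sqrtr// mulr_ge0 ?ltW.
have xE : (x = a * (a^-1 * x))%R by rewrite mulVKf// gt_eqF.
have yE : (y = b * (b^-1 * y))%R by rewrite mulVKf// gt_eqF.
have zE : (z = m * (m^-1 * z))%R by rewrite mulVKf// gt_eqF.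
have p0 : (0 <= a^-1 * x)%R by rewrite mulr_ge0// ltW.
have q0 : (0 <= b^-1 * y)%R by rewrite mulr_ge0// ltW.
rewrite xE yE zE exprMn mm.
(* For the integrals normalized by their heights the hypothesis is p + q <= 2 r, and p q <= r^2
   follows from the inequality of arithmetic and geometric means. *)
move: (a^-1 * x)%R (b^-1 * y)%R (m^-1 * z)%R p0 q0 xyz => p q r p0 q0 pqr.
rewrite (_ : (a * p * (b * q) = a * b * (p * q))%R); last by ring.
rewrite ler_pM2l ?mulr_gt0//.
have := sqr_ge0 (p - q)%R.
have : ((p + q) ^+ 2 <= (2 * r) ^+ 2)%R.
  by rewrite ler_sqr ?nnegrE ?addr_ge0// (le_trans _ pqr)// addr_ge0.
nra.
Qed.

Lemma prekopa_leindler1 (f g h : R -> \bar R) :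
  measurable_fun setT f -> measurable_fun setT g -> measurable_fun setT h ->
  (forall x, 0 <= f x) -> (forall x, 0 <= g x) -> (forall x, 0 <= h x) ->
  (forall x y, f x * g y <= h ((x + y) / 2)%R ^+ 2) ->
  (\int[mu]_x f x) * (\int[mu]_x g x) <= (\int[mu]_x h x) ^+ 2.
Proof.
move=> mf mg mh f0 g0 h0 fgh.
have ih0 : 0 <= (\int[mu]_x h x) ^+ 2 by apply: expe_ge0; exact: integral_ge0.
have trunc (u : R -> \bar R) : measurable_fun setT u -> (forall x, 0 <= u x) ->
    \int[mu]_x mine (u x) k.+1%:R%:E @[k --> \oo] --> \int[mu]_x u x.
  move=> mu_ u0.
  have -> : \int[mu]_x u x = \int[mu]_x limn (fun k => mine (u x) k.+1%:R%:E).
    apply: eq_integral => x _; apply/esym/cvg_lim => //.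
    have := u0 x; case: (u x) => [r r0| _|//].
      apply: cvg_near_cst; exists (Num.trunc r) => // k /= rk.
      by apply/min_idPl; rewrite lee_fin (le_trans (ltW (truncnS_gt r)))// ler_nat ltnS.
    rewrite (_ : (fun k => _) = (fun k => k.+1%:R%:E)); last first.
      by apply/funext => k; rewrite minye.
    by apply/cvgeryP; rewrite (cvg_shiftS (fun k => k%:R : R)%R); exact: cvgr_idn.
  apply: cvg_monotone_convergence => //.
  - by move=> k; exact: measurable_mine.
  - by move=> k x _; rewrite le_min u0 lee_fin ler0n.
  - by move=> x _ k l kl; rewrite le_min ge_min lexx/= ge_min lee_fin ler_nat ltnS kl orbT.
(* The zero cases are split off because a limit of products may fail to exist when one factor tends
   to 0 and the other to infinity. *)
have [->|F0] := eqVneq (\int[mu]_x f x) 0; first by rewrite mul0e.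
have [->|G0] := eqVneq (\int[mu]_x g x) 0; first by rewrite mule0.
have sup_gt0 (u : R -> \bar R) : (forall x, 0 <= u x) -> \int[mu]_x u x != 0 ->
    0 < ereal_sup (range u).
  move=> u0; apply: contraNT; rewrite -leNgt => supu.
  apply/eqP/integral0_eq => x _; apply/eqP; rewrite eq_le u0 andbT.
  by rewrite (le_trans _ supu)//; apply: ereal_sup_ubound; exists x.
have key k : (\int[mu]_x mine (f x) k.+1%:R%:E) * (\int[mu]_x mine (g x) k.+1%:R%:E) <=
    (\int[mu]_x h x) ^+ 2.
  have tsup (u : R -> \bar R) : (forall x, 0 <= u x) -> \int[mu]_x u x != 0 ->
      exists2 a : R, (0 < a)%R & a%:E <= ereal_sup (range u) /\
        forall x, mine (u x) k.+1%:R%:E = mine (u x) a%:E.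
    (* This height is finite, positive and at most the supremum of [u], and truncating there is the
       same as truncating at [k.+1]. *)
    move=> u0 un0; pose c := mine (ereal_sup (range u)) k.+1%:R%:E.
    have c0 : 0 < c by rewrite lt_min sup_gt0// lte_fin ltr0n.
    have cfin : c \is a fin_num.
      rewrite ge0_fin_numE ?(ltW c0)// (@le_lt_trans _ _ k.+1%:R%:E) ?ltry//.
      by rewrite ge_min lexx orbT.
    exists (fine c); first by rewrite fine_gt0// c0 ltey_eq cfin.
    rewrite fineK//; split; first by rewrite ge_min lexx.
    move=> x; rewrite /c minA [mine (u x) (ereal_sup _)](_ : _ = u x)//.
    by apply/min_idPl/ereal_sup_ubound; exists x.
  have [a a0 [af aE]] := tsup f f0 F0.
  have [b b0 [bg bE]] := tsup g g0 G0.
  under eq_integral do rewrite aE.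
  under [X in _ * X <= _]eq_integral do rewrite bE.
  exact: prekopa_leindler_trunc.
have cvgFG : (\int[mu]_x mine (f x) k.+1%:R%:E) * (\int[mu]_x mine (g x) k.+1%:R%:E)
    @[k --> \oo] --> (\int[mu]_x f x) * (\int[mu]_x g x).
  apply: cvgeM; [|exact: trunc|exact: trunc].
  by rewrite mule_defE (negbTE F0) (negbTE G0).
rewrite -(cvg_lim _ cvgFG)//; apply: lime_le; first by apply/cvg_ex; eexists; exact: cvgFG.
by apply: nearW => k; exact: key.
Qed.

End PrekopaLeindlerFunctions.

(** * Isodiametric inequality and volume of the ball *)

Section LebesgueRowFacts.
Context {R : realType}.
Local Open Scope ereal_scope.

Definition eball0 {n} (r : R) : set 'rV[R]_n := [set x | (enorm x <= r)%R].

Lemma measurable_eball0 n r : measurable (@eball0 n r).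
Proof.
apply: closed_measurable_row; rewrite (_ : eball0 r = [set x | (enorm (x - 0) <= r)%R]).
  exact: closed_eball.
by apply/seteqP; split => x /=; rewrite subr0.
Qed.

Lemma le_eball0 n r s : (r <= s)%R -> @eball0 n r `<=` eball0 s.
Proof. by move=> rs x /= xr; exact: le_trans rs. Qed.

Lemma le_leb n (A B : set 'rV[R]_n) : measurable A -> measurable B -> A `<=` B ->
  leb n A <= leb n B.
Proof. by move=> mA mB AB; apply: le_measure; rewrite ?inE. Qed.

Lemma leb_opp n (A : set 'rV[R]_n) : measurable A -> leb n [set x | A (- x)%R] = leb n A.
Proof.
move=> mA; have := @lebesgue_row_affine _ n (-1) 0%R A _ mA.
rewrite normrN1 expr1n invr1 mul1e => <-; last by rewrite oppr_eq0 oner_eq0.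
by congr (leb n _); apply/seteqP; split => x /=; rewrite scaleN1r addr0.
Qed.

Lemma leb_shift n (c : 'rV[R]_n) (A : set 'rV[R]_n) : measurable A ->
  leb n [set x | A (x + c)%R] = leb n A.
Proof.
move=> mA; have := @lebesgue_row_affine _ n 1 c A _ mA.
rewrite normr1 expr1n invr1 mul1e => <-; last by rewrite oner_eq0.
by congr (leb n _); apply/seteqP; split => x /=; rewrite scale1r.
Qed.

Definition cube {n} (a : 'rV[R]_n) (s : R) : set 'rV[R]_n :=
  [set x | forall i, (a 0 i <= x 0 i < a 0 i + s)%R].

Lemma measurable_cube n (a : 'rV[R]_n) s : measurable (cube a s).
Proof.
rewrite (_ : cube a s =
    \bigcap_(i in [set: 'I_n]) ((fun x => x 0 i)%R @^-1` `[(a 0 i)%R, (a 0 i + s)%R[%classic)).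
  apply: fin_bigcap_measurable => // i _; rewrite -[X in measurable X]setTI.
  by apply: measurable_coord => //; exact: measurable_itv.
apply/seteqP; split => x /=; first by move=> ax i _; rewrite /= in_itv/= ax.
by move=> ax i; have := ax i Logic.I; rewrite /= in_itv.
Qed.

Lemma leb_cube n (a : 'rV[R]_n) s : (0 <= s)%R -> leb n (cube a s) = (s ^+ n)%:E.
Proof.
move=> s0; elim: n a => [|n ih] a.
  by rewrite expr0 /= diracE mem_set//= => -[].
rewrite /= lebSE.
transitivity (\int[lebesgue_measure]_t
    ((s ^+ n)%:E * (\1_(`[(a 0 0)%R, (a 0 0 + s)%R[%classic : set R) t)%:E)).
  apply: eq_integral => t _; rewrite indicE; case: (boolP (t \in _)) => [|] at_.
    rewrite mule1 -(ih (vtail a)); congr (leb n _).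
    move: at_; rewrite inE/= in_itv/= => at_.
    apply/seteqP; split => v /= h i; first by have := h (lift ord0 i); rewrite vcons_lift mxE.
    rewrite mxE; case: unliftP => [j ->|->] //=.
    by have := h j; rewrite mxE.
  rewrite mule0 (_ : [set v | _] = set0) ?measure0//.
  apply/seteqP; split => // v /= /(_ ord0); rewrite vcons0 => at'.
  by move: at_; rewrite notin_setE/= in_itv/= at'.
rewrite ge0_integralZl//=; last 2 first.
- by apply/measurable_EFinP; exact: measurable_indic.
- by rewrite lee_fin exprn_ge0.
transitivity ((s ^+ n)%:E * lebesgue_measure `[(a 0 0)%R, (a 0 0 + s)%R[%classic).
  by rewrite integral_indic// setIT.
rewrite lebesgue_measure_itv/= lte_fin ltrDl.
move: s0; rewrite le_eqVlt => /predU1P[<-|s0].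
  by rewrite ltxx mule0 exprS mul0r.
by rewrite s0 -EFinB -EFinM exprS mulrC addrC addKr.
Qed.

Lemma leb_eball0_fin n r : leb n (eball0 r) \is a fin_num.
Proof.
have [r0|r0] := ltP r 0%R.
  rewrite (_ : eball0 r = set0) ?measure0//.
  apply/seteqP; split => // x /= xr.
  by have := le_lt_trans xr r0; rewrite ltNge enorm_ge0.
rewrite ge0_fin_numE//.
apply: (@le_lt_trans _ _ (leb n (cube (\row_i (- r)%R) (r + r + 1)%R))).
  apply: le_leb; [exact: measurable_eball0|exact: measurable_cube|].
  move=> x /= xr i; rewrite mxE.
  have := le_trans (coord_le_enorm x i) xr; rewrite ler_norml => /andP[? ?].
  by apply/andP; split; lra.
by rewrite leb_cube ?ltry// !addr_ge0.
Qed.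

Lemma leb_eball0_scale n r : (0 < r)%R ->
  leb n (eball0 r) = (r ^+ n)%:E * leb n (eball0 1).
Proof.
move=> r0; have := @lebesgue_row_affine _ n r^-1 0%R (eball0 1) _ (@measurable_eball0 n 1).
rewrite gtr0_norm ?invr_gt0// exprVn invrK => <-; last by rewrite invr_eq0 gt_eqF.
congr (leb n _); apply/seteqP; split => x; rewrite /eball0/=;
  by rewrite addr0 enormZ gtr0_norm ?invr_gt0// ler_pdivrMl// mulr1.
Qed.

Lemma leb_eball0_gt0 n r : (0 < r)%R -> 0 < leb n (eball0 r).
Proof.
(* A point of this cube has squared norm at most [n * s ^+ 2 <= r ^+ 2]; the denominator [n.+1] also
   covers [n = 0]. *)
move=> r0; pose s : R := (r / n.+1%:R)%R.
have s0 : (0 < s)%R by rewrite divr_gt0.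
apply: (@lt_le_trans _ _ (leb n (cube 0%R s))).
  by rewrite leb_cube ?(ltW s0)// lte_fin exprn_gt0.
apply: le_leb; [exact: measurable_cube|exact: measurable_eball0|].
move=> x /= xs; rewrite /eball0/= enorm_le ?(ltW r0)//.
apply: le_trans (dotp_le_coord (s := s) _) _.
  by move=> i; have := xs i; rewrite !mxE add0r => /andP[x0 xsi]; rewrite ger0_norm// ltW.
rewrite /s expr_div_n mulrCA ler_piMr ?sqr_ge0//.
rewrite ler_pdivrMr ?exprn_gt0// mul1r -natrX ler_nat.
by rewrite (leq_trans (leqnSn n))// leq_pmulr.
Qed.

Lemma ge0_integral_leb n (f : 'rV[R]_n.+1 -> \bar R) :
  measurable_fun setT f -> (forall x, 0 <= f x) ->
  \int[leb n.+1]_x f x = \int[lebesgue_measure]_a \int[leb n]_v f (vcons a v).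
Proof. exact: ge0_integral_lebS. Qed.

Lemma integral_indic_leb n (A : set 'rV[R]_n) : measurable A ->
  \int[leb n]_x (\1_A x)%:E = leb n A.
Proof. by move=> mA; rewrite integral_indic// setIT. Qed.

Lemma integral_leb0 (f : 'rV[R]_0 -> \bar R) : measurable_fun setT f ->
  \int[leb 0]_x f x = f 0%R.
Proof. by move=> mf; rewrite /= integral_dirac// /dirac indicT mul1e. Qed.

(** The inequality tensorizes: for first coordinates [a] and [b] the induction hypothesis applies to
    the sections, and its conclusion is the hypothesis of the one-dimensional case for the integrals
    of the sections. *)
Lemma prekopa_leindler n (f g h : 'rV[R]_n -> \bar R) :
  measurable_fun setT f -> measurable_fun setT g -> measurable_fun setT h ->
  (forall x, 0 <= f x) -> (forall x, 0 <= g x) -> (forall x, 0 <= h x) ->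
  (forall x y, f x * g y <= h (2^-1 *: (x + y))%R ^+ 2) ->
  (\int[leb n]_x f x) * (\int[leb n]_x g x) <= (\int[leb n]_x h x) ^+ 2.
Proof.
elim: n f g h => [|n ih] f g h mf mg mh f0 g0 h0 fgh.
  rewrite !integral_leb0//.
  by rewrite (le_trans (fgh _ _))// (_ : _ *: _ = 0)%R//; apply/rowP => -[].
have msec a (u : 'rV[R]_n.+1 -> \bar R) : measurable_fun setT u ->
    measurable_fun setT (fun v => u (vcons a v)).
  move=> mu_; apply: (measurableT_comp mu_).
  by apply: (measurable_fun_vcons (v := idfun)) => //; exact: measurable_id.
rewrite (ge0_integral_leb mf f0) (ge0_integral_leb mg g0) (ge0_integral_leb mh h0).
apply: prekopa_leindler1 => [||||||a b].
- exact: measurable_integral_lebS.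
- exact: measurable_integral_lebS.
- exact: measurable_integral_lebS.
- by move=> a; exact: integral_ge0.
- by move=> a; exact: integral_ge0.
- by move=> a; exact: integral_ge0.
apply: ih => // [|||v w]; [exact: msec|exact: msec|exact: msec|].
rewrite (le_trans (fgh _ _))// vconsD vconsZ.
by rewrite (mulrC _ (a + b)%R).
Qed.

(** The covering sets that define the Hausdorff measure are arbitrary, hence the measurable hull in
    the conclusion. *)
Lemma isodiametric n (A : set 'rV[R]_n) (d : R) : (0 <= d)%R -> eucl_diam A <= d%:E ->
  exists2 B, measurable B /\ A `<=` B & leb n B <= leb n (eball0 (d / 2)%R).
Proof.
move=> d0 /eucl_diam_leP Ad.
(* [B] is closed, contains [A] and still has diameter at most [d], so the midpoints of [B] and
   [- B] lie in the ball of radius [d / 2]. *)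
pose A1 := [set w : 'rV[R]_n | forall a, A a -> (enorm (w - a) <= d)%R].
pose B := [set z : 'rV[R]_n | forall w, A1 w -> (enorm (z - w) <= d)%R].
have AA1 : A `<=` A1 by move=> x Ax a Aa; exact: Ad.
have BA1 : B `<=` A1 by move=> z Bz a /AA1; exact: Bz.
have mB : measurable B.
  apply: closed_measurable_row.
  rewrite (_ : B = \bigcap_(w in A1) [set z | (enorm (z - w) <= d)%R]).
    by apply: closed_bigI => w _; exact: closed_eball.
  by apply/seteqP; split.
exists B; first by split=> // x Ax w A1w; rewrite enorm_distC A1w.
have mN : measurable [set x | B (- x)%R].
  rewrite -[X in measurable X]setTI.
  by apply: (measurable_fun_rowN (f := idfun)) => //; exact: measurable_id.
have mball := @measurable_eball0 n (d / 2)%R.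
have : leb n B * leb n B <= leb n (eball0 (d / 2)%R) ^+ 2.
  have := @prekopa_leindler n (EFin \o \1_B) (EFin \o \1_[set x | B (- x)%R])
    (EFin \o \1_(eball0 (d / 2)%R)).
  have I1 (X : set 'rV[R]_n) : measurable X -> \int[leb n]_x (EFin \o \1_X) x = leb n X.
    exact: integral_indic_leb.
  rewrite (I1 _ mB) (I1 _ mN) (I1 _ mball) (leb_opp mB); apply.
  - by apply/measurable_EFinP; exact: measurable_indic.
  - by apply/measurable_EFinP; exact: measurable_indic.
  - by apply/measurable_EFinP; exact: measurable_indic.
  - by move=> x; rewrite lee_fin.
  - by move=> x; rewrite lee_fin.
  - by move=> x; rewrite lee_fin.
  move=> x y /=; rewrite -!EFinM lee_fin !indicE.
  have [|_] := boolP (x \in B); last by rewrite mul0r mulr_ge0.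
  have [|_] := boolP (y \in _); last by rewrite mulr0 mulr_ge0.
  rewrite !inE/= => By Bx; rewrite mem_set ?mulr1//=.
  rewrite /eball0/= enormZ ger0_norm ?invr_ge0// mulrC ler_pM2r ?invr_gt0//.
  by rewrite -[y]opprK Bx//; exact: BA1.
apply: contraTT; rewrite -!ltNge expe2 => lt.
by apply: lte_pmul.
Qed.

Lemma integral_gauss_row n :
  \int[leb n]_x (expR (- dotp x x) : R)%:E = (Num.sqrt pi ^+ n)%:E.
Proof.
have meas k : measurable_fun setT (fun x : 'rV[R]_k => (expR (- dotp x x))%:E).
  apply/measurable_EFinP; apply: (@measurableT_comp _ _ _ _ _ _ expR _ (fun x => - dotp x x)%R).
    exact: measurable_expR.
  by apply: measurable_funN; apply: measurable_fun_dotp; exact: measurable_id.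
elim: n => [|n ih].
  by rewrite integral_leb0// dotp0l oppr0 expR0 expr0.
rewrite ge0_integral_leb//.
transitivity (\int[@lebesgue_measure R]_a ((gauss_fun (a : R))%:E * (Num.sqrt pi ^+ n)%:E)).
  apply: eq_integral => a _; rewrite -ih -ge0_integralZl//; last by rewrite lee_fin expR_ge0.
  by apply: eq_integral => v _; rewrite dotp_vcons opprD expRD EFinM -expr2.
rewrite ge0_integralZr//; last 2 first.
- by apply/measurable_EFinP; exact: measurable_gauss_fun.
- by move=> *; rewrite lee_fin gauss_fun_ge0.
by rewrite integralT_gauss -EFinM exprS.
Qed.

Lemma measurable_expRN : measurable_fun setT (fun u : measurableTypeR R => expR (- (u : R))).
Proof.
apply: (@measurableT_comp _ _ _ _ _ _ expR _ (fun u : measurableTypeR R => - (u : R))%R).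
  exact: measurable_expR.
exact: oppr_measurable.
Qed.

Lemma integral_expRN_itv (a : R) :
  \int[lebesgue_measure]_(u in `[a, +oo[) (expR (- u))%:E = (expR (- a))%:E.
Proof.
rewrite (@ge0_continuous_FTC2y _ _ (fun u => - expR (- u))%R _ 0%R).
- by rewrite -EFinB sub0r opprK.
- by move=> x _; exact: expR_ge0.
- apply: continuous_subspaceT => x; apply: continuous_comp; first exact: continuousN.
  exact: continuous_expR.
- by rewrite -oppr0; apply: cvgN; exact: cvgr_expR.
- by move=> x _; exact: ex_derive.
- apply: cvg_at_right_filter; apply: cvgN; apply: continuous_comp.
    exact: continuousN.
  exact: continuous_expR.
- by move=> x _; rewrite derive1E derive_val; lra.
Qed.

(** Integrate exp(-u) over the pairs with |x|^2 <= u. Integrating over [u] first leaves the Gaussian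
    integral; integrating over [x] first gives [w * u^(n/2)], the volume of a ball, and thus [w]
    times a Gamma integral. *)
Lemma leb_unit_ball n : leb n (eball0 1) = (ball_volume n)%:E.
Proof.
pose w := fine (leb n (eball0 1)).
have wE : leb n (eball0 1) = w%:E by rewrite fineK// leb_eball0_fin.
have w0 : (0 < w)%R by rewrite -lte_fin -wE leb_eball0_gt0.
pose F (p : 'rV[R]_n * measurableTypeR R) : \bar R :=
  if (dotp p.1 p.1 <= p.2)%R then (expR (- p.2))%:E else 0.
have mF : measurable_fun setT F.
  apply: measurable_fun_ifT => //=.
    apply: measurable_fun_ler; last exact: measurable_snd.
    by apply: measurable_fun_dotp; exact: measurable_fst.
  apply/measurable_EFinP; apply: measurableT_comp => //.
  by apply: measurableT_comp => //; exact: measurable_snd.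
have F0 p : 0 <= F p by rewrite /F; case: ifP; rewrite ?lee_fin ?expR_ge0.
have := @fubini_tonelli _ _ _ _ _ (leb n) (@lebesgue_measure R) F mF F0.
have -> : \int[leb n]_x fubini_F lebesgue_measure F x = (Num.sqrt pi ^+ n)%:E.
  rewrite -integral_gauss_row; apply: eq_integral => x _.
  rewrite -integral_expRN_itv integral_mkcond; apply: eq_integral => u _.
  by rewrite patchE mem_setE /F/= in_itv/= andbT; case: ifP.
have -> : \int[lebesgue_measure]_u fubini_G (leb n) F u =
    w%:E * \int[lebesgue_measure]_(u in `]0%R, +oo[) (u `^ (n%:R / 2 + 1 - 1) * expR (- u))%:E.
  rewrite -ge0_integralZl//; last 3 first.
  - apply/measurable_EFinP; apply: measurable_funTS; apply: measurable_funM.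
      exact: measurable_powR.
    exact: measurable_expRN.
  - by move=> u _; rewrite lee_fin mulr_ge0 ?powR_ge0 ?expR_ge0.
  - by rewrite lee_fin ltW.
  rewrite [RHS]integral_mkcond.
  (* The two integrands may differ at [u = 0]: the interval is open there, while for [n = 0] the
     ball of radius 0 has mass 1. *)
  have null : lebesgue_measure [set 0%R : R] = 0 by exact: lebesgue_measure_set1.
  apply: ae_eq_integral => //.
  - exact: measurable_fun_fubini_tonelli_G.
  - apply/(measurable_restrictT _ _).1 => //.
    apply: measurable_funeM.
    apply/measurable_EFinP; apply: measurable_funTS; apply: measurable_funM.
      exact: measurable_powR.
    exact: measurable_expRN.
  exists [set 0%R]; split => // u /= /not_implyP[_].
  apply: contra_notP => u0.
  rewrite patchE mem_setE in_itv/= andbT /fubini_G/F/=.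
  case: ifPn => [u_gt0|]; last first.
    rewrite -leNgt => u_le0; apply: integral0_eq => x _; rewrite leNgt.
    have u_lt0 : (u < 0)%R by rewrite lt_neqAle u_le0 andbT; apply/eqP.
    by rewrite (lt_le_trans u_lt0)// dotp_ge0.
  transitivity (\int[leb n]_x ((expR (- u))%:E * (\1_(eball0 (Num.sqrt u)) x)%:E)).
    apply: eq_integral => x _; rewrite indicE.
    have -> : (x \in eball0 (Num.sqrt u)) = (dotp x x <= u)%R.
      apply/idP/idP; rewrite inE /eball0/=;
        by rewrite enorm_le ?sqrtr_ge0// sqr_sqrtr// ltW.
    by case: ifP; rewrite ?mule1 ?mule0.
  rewrite ge0_integralZl//; last first.
    by apply/measurable_EFinP; apply: measurable_indic; exact: measurable_eball0.
  rewrite integral_indic_leb; last exact: measurable_eball0.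
  rewrite leb_eball0_scale ?sqrtr_gt0// wE -!EFinM; congr EFin.
  rewrite addrK -powR12_sqrt ?ltW// -powR_mulrn ?powR_ge0// -powRrM.
  by rewrite (mulrC 2^-1 _)%R; ring.
set G := \int[_]_(u in _) _ => piG.
have G0 : 0 <= G.
  by apply: integral_ge0 => u _; rewrite lee_fin mulr_ge0 ?powR_ge0 ?expR_ge0.
(* The Gamma integral is finite because its product with [w > 0] is. *)
have Gfin : G \is a fin_num.
  rewrite ge0_fin_numE// ltey; apply/eqP => Gy.
  by move: piG; rewrite Gy gt0_muley ?lte_fin.
rewrite wE; congr EFin; rewrite /ball_volume /Gamma /Rintegral -/G.
move: piG; rewrite -(fineK Gfin) -EFinM => -[piG].
have pi0 : (0 < Num.sqrt pi ^+ n :> R)%R by rewrite exprn_gt0// sqrtr_gt0 pi_gt0.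
have fG0 : (0 < fine G)%R.
  rewrite lt_neqAle fine_ge0// andbT; apply/eqP => G0'.
  by move: pi0; rewrite piG -G0' mulr0 ltxx.
rewrite [(n%:R / 2)%R]mulrC powRrM powR_mulrn ?powR_ge0// powR12_sqrt ?pi_ge0// piG/=.
by rewrite mulfK// gt_eqF.
Qed.

End LebesgueRowFacts.

(** * Hausdorff measure in full dimension *)

Section LebesgueLeHausdorff.
Context {R : realType}.
Local Open Scope ereal_scope.

Lemma leb_eball0 n (r : R) : (0 <= r)%R ->
  leb n (eball0 r) = (ball_volume n * r ^+ n)%:E.
Proof.
rewrite mulrC EFinM -leb_unit_ball.
rewrite le_eqVlt => /predU1P[<-|]; last exact: leb_eball0_scale.
(* For radius 0, a point has mass 1 in dimension 0 and mass 0 otherwise, in agreement with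
   [0 ^+ 0 = 1]. *)
case: n => [|n].
  rewrite expr0 mul1e; congr (leb 0 _); apply/seteqP; split => x; rewrite /eball0/=;
    by rewrite (_ : x = 0%R) ?enorm0 ?ler01//; apply/rowP => -[].
rewrite exprS mul0r mul0e; apply/eqP; rewrite eq_le measure_ge0 andbT.
apply/lee_addgt0Pr => e e0; rewrite add0e.
pose s := Num.min 1%R e.
have s0 : (0 < s)%R by rewrite lt_min ltr01.
apply: (@le_trans _ _ (leb n.+1 (cube 0%R s))).
  apply: le_leb; [exact: measurable_eball0|exact: measurable_cube|] => x /= x0 i.
  have /eqP : x = 0%R by apply/eqP; rewrite -enorm_eq0 eq_le x0 enorm_ge0.
  by move=> /eqP ->; rewrite !mxE lexx add0r.
rewrite leb_cube ?(ltW s0)// lee_fin exprS.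
apply: (@le_trans _ _ s); last by rewrite ge_min lexx orbT.
by rewrite ler_piMr ?(ltW s0)// exprn_ile1 ?(ltW s0)// ge_min lexx.
Qed.

Lemma ball_volume_gt0 n : (0 < ball_volume n :> R)%R.
Proof. by rewrite -lte_fin -leb_unit_ball leb_eball0_gt0. Qed.

(** The weight of a nonempty set is the volume of a ball of the same diameter, so this is the
    isodiametric inequality. *)
Lemma hausdorff_weight_hull n (C : set 'rV[R]_n) (d : R) : eucl_diam C <= d%:E ->
  exists B, [/\ measurable B, C `<=` B & leb n B <= hausdorff_weight n C].
Proof.
move=> Cd; have [->|/set0P C0] := eqVneq C set0.
  by exists set0; split => //; rewrite measure0 hausdorff_weight0.
have diamE : eucl_diam C = (fine (eucl_diam C))%:E.
  by rewrite fineK// ge0_fin_numE ?eucl_diam_ge0// (le_lt_trans Cd)// ltry.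
have d0 : (0 <= fine (eucl_diam C))%R by rewrite fine_ge0// eucl_diam_ge0.
have [|B [mB CB] LB] := @isodiametric R n C _ d0; first by rewrite -diamE.
exists B; split => //; apply: le_trans LB _.
rewrite leb_eball0 ?divr_ge0// /hausdorff_weight ifF; last exact/negbTE/set0P.
by rewrite diamE -EFinM -EFin_expe -EFinM.
Qed.

Lemma leb_le_hausdorff n (A : set 'rV[R]_n) : measurable A -> leb n A <= hausdorff n A.
Proof.
(* The bound on weights does not depend on the scale, so the content at scale 1 is already large
   enough. *)
move=> mA; apply: le_trans (le_content_hausdorff _ _ (@ltr01 R)).
apply: le_ereal_inf_tmp => _ [C [AC Cd] <-].
have [B BP] := choice (fun i => hausdorff_weight_hull (Cd i)).
have mB i : measurable (B i) by have [] := BP i.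
apply: (@le_trans _ _ (\sum_(i <oo) leb n (B i))).
  apply: measure_sigma_subadditive => // x /AC[i _ Cx]; exists i => //.
  by have [_ CB _] := BP i; exact: CB.
by apply: lee_nneseries => // i _; have [] := BP i.
Qed.

End LebesgueLeHausdorff.

Section HausdorffContentOuter.
Context {R : realType} {m : nat} (k : nat) (delta : R).
Local Open Scope ereal_scope.
Local Notation content := (hausdorff_content k delta : set 'rV[R]_m -> \bar R).

HB.instance Definition _ := isOuterMeasure.Build R 'rV[R]_m (hausdorff_content k delta)
  (hausdorff_content0 k delta) (hausdorff_content_ge0 k delta)
  (@le_hausdorff_content R m k delta) (hausdorff_content_sigma_subadditive k delta).

Lemma hausdorff_content_bigsetU (I : Type) (r : seq I) (F : I -> set 'rV[R]_m) :
  content (\big[setU/set0]_(i <- r) F i) <= \sum_(i <- r) content (F i).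
Proof.
elim: r => [|i r ih]; first by rewrite !big_nil hausdorff_content0.
rewrite !big_cons (le_trans (outer_measureU2 (hausdorff_content k delta) _ _))//.
by rewrite leeD2l.
Qed.

End HausdorffContentOuter.

Section CubeSubdivision.
Context {R : realType} {n : nat}.
Local Open Scope ereal_scope.

Lemma cube_subdivision N :
  @cube R n 0%R 1 `<=` \big[setU/set0]_(f <- enum {ffun 'I_n -> 'I_N.+1})
    cube (\row_i ((f i)%:R / N.+1%:R))%R N.+1%:R^-1.
Proof.
have N0 : (0 < N.+1%:R :> R)%R by rewrite ltr0n.
move=> x /= x01.
have xi i : (0 <= x 0 i < 1)%R by have := x01 i; rewrite !mxE add0r.
have tP i : (Num.trunc (N.+1%:R * x 0 i)%R < N.+1)%N.
  have /andP[x0 x1] := xi i.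
  have := @truncn_itv R (N.+1%:R * x 0 i)%R.
  rewrite mulr_ge0 ?ler0n// => /(_ isT)/andP[tle _].
  by rewrite -(ltr_nat R) (le_lt_trans tle)// gtr_pMr.
pose f := [ffun i => Ordinal (tP i)].
rewrite -bigcup_seq; exists f; first by rewrite /= mem_enum.
move=> i; rewrite mxE ffunE/=.
have /andP[x0 x1] := xi i.
have := @truncn_itv R (N.+1%:R * x 0 i)%R.
rewrite mulr_ge0 ?ler0n// => /(_ isT)/andP[tle tlt].
rewrite ler_pdivrMr// (mulrC (x 0%R i)) tle/=.
rewrite -[X in (_ < _ + X)%R]mul1r -mulrDl ltr_pdivlMr// (mulrC (x 0%R i)).
by rewrite natr1.
Qed.

Lemma hausdorff_content_cube_le k (delta b : R) N : (0 <= b)%R ->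
  (forall a, hausdorff_content k delta (@cube R n a N.+1%:R^-1) <= (b / N.+1%:R ^+ n)%:E) ->
  hausdorff_content k delta (@cube R n 0%R 1) <= b%:E.
Proof.
move=> b0 Hb; apply: le_trans (le_hausdorff_content k delta (cube_subdivision N)) _.
apply: le_trans (hausdorff_content_bigsetU _ _ _ _) _.
apply: (@le_trans _ _ (\sum_(f <- enum {ffun 'I_n -> 'I_N.+1}) (b / N.+1%:R ^+ n)%:E)).
  by apply: lee_sum => f _; exact: Hb.
rewrite sumEFin lee_fin big_const_seq count_predT -cardE card_ffun !card_ord.
rewrite iter_addr_0 -[X in (X <= _)%R]mulr_natr natrX divfK//.
Qed.

End CubeSubdivision.

Lemma integral_section_cst (R : realType) d1 d2 (T1 : measurableType d1)
    (T2 : measurableType d2) (mu : {measure set T1 -> \bar R})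
    (nu : {measure set T2 -> \bar R}) (X : set T1) (F : T1 -> set T2) (c : \bar R) :
  measurable X -> (forall x, X x -> nu (F x) = c) ->
  (\int[mu]_x nu [set y | X x /\ F x y] = c * mu X)%E.
Proof.
move=> mX Fc; rewrite -integral_cst// [RHS]integral_mkcond.
apply: eq_integral => x _; rewrite patchE; case: ifPn => [|] xX.
  rewrite -(Fc x); last by move: xX; rewrite inE.
  by congr (nu _); apply/seteqP; split => y /=; [case|split => //; move: xX; rewrite inE].
rewrite (_ : [set y | _] = set0) ?measure0//.
by apply/seteqP; split => // y [/mem_set xX' _]; move: xX; rewrite xX'.
Qed.

Section HausdorffLebesgue.
Context {R : realType} {n : nat}.
Local Open Scope ereal_scope.
Local Notation H := (hausdorff n : set 'rV[R]_n -> \bar R).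
Local Notation Q := (@cube R n 0%R 1).

Lemma exists_inv_le (e : R) : (0 < e)%R -> exists N : nat, (N.+1%:R^-1 <= e)%R.
Proof.
move=> e0; have [N _ /(_ N (leqnn N)) NP] := near_infty_natSinv_lt (PosNum e0).
by exists N; rewrite ltW.
Qed.

Lemma hausdorff_unit_cube_fin : H Q < +oo.
Proof.
(* A bound, independent of [N], for the total weight of the [N.+1 ^ n] subcubes of side
   [N.+1%:R^-1]. *)
pose b : R := (ball_volume n * (Num.sqrt n%:R * 2^-1) ^+ n)%R.
have b0 : (0 <= b)%R.
  by rewrite mulr_ge0 ?ball_volume_ge0// exprn_ge0// mulr_ge0 ?sqrtr_ge0.
apply: (@le_lt_trans _ _ b%:E); last exact: ltry.
apply: hausdorff_leP => d d0.
have [N Nd] : exists N : nat, (Num.sqrt n%:R * N.+1%:R^-1 <= d)%R.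
  (* The summand 1 keeps the divisor positive when [n = 0]. *)
  have [N Nd] := @exists_inv_le (d / (Num.sqrt n%:R + 1))%R ltac:(by rewrite divr_gt0// ltr_wpDl ?sqrtr_ge0).
  exists N; rewrite (le_trans (ler_wpM2l (sqrtr_ge0 _) Nd))//.
  rewrite mulrA ler_pdivrMr ?ltr_wpDl ?sqrtr_ge0// mulrC ler_pM2l//.
  by rewrite lerDl.
apply: (@hausdorff_content_cube_le _ _ _ _ _ N) => // a.
have diamQ : eucl_diam (cube a N.+1%:R^-1) <= (Num.sqrt n%:R * N.+1%:R^-1)%:E.
  apply/eucl_diam_leP => x y xQ yQ.
  apply: enorm_le_coord; first by rewrite invr_ge0.
  move=> i; have /andP[x1 x2] := xQ i; have /andP[y1 y2] := yQ i.
  rewrite !mxE ler_norml; move: x1 x2 y1 y2.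
  move: (a 0%R i) (x 0%R i) (y 0%R i) (N.+1%:R^-1)%R => u v w z *.
  by apply/andP; split; lra.
apply: le_trans (hausdorff_content_weight _ _) _.
  by rewrite (le_trans diamQ)// lee_fin.
rewrite /hausdorff_weight; case: ifPn => [_|/set0P Q0].
  by rewrite lee_fin divr_ge0// exprn_ge0.
apply: (@le_trans _ _ ((ball_volume n)%:E * ((Num.sqrt n%:R / N.+1%:R * 2^-1)%R ^+ n)%:E)).
  rewrite lee_wpmul2l ?lee_fin ?ball_volume_ge0// EFin_expe lee_expe//.
    by rewrite mule_ge0// ?eucl_diam_ge0// lee_fin.
  by rewrite EFinM lee_wpmul2r// lee_fin.
rewrite -EFinM lee_fin (_ : (b / _ = ball_volume n * (Num.sqrt n%:R / N.+1%:R * 2^-1) ^+ n)%R)//.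
by rewrite /b !expr_div_n -!mulrA [(_^-1 * 2 ^- n)%R]mulrC.
Qed.

Lemma hausdorff_shift (c : 'rV[R]_n) (A : set 'rV[R]_n) k :
  hausdorff k [set x | A (x + c)%R] = hausdorff k A.
Proof.
rewrite -(@hausdorff_isometry _ _ k (fun x => x + c)%R (fun x => x - c)%R [set x | A (x + c)%R]).
- congr (hausdorff k _); apply/seteqP; split; first by move=> _ [x Ax <-].
  by move=> x Ax; exists (x - c)%R => /=; rewrite subrK.
- by move=> x; rewrite addrK.
- by move=> x y; congr enorm; rewrite opprD addrACA subrr addr0.
Qed.

Lemma hausdorff_cube_fin (a : 'rV[R]_n) (s : R) : (0 < s)%R -> H (cube a s) < +oo.
Proof.
move=> s0.
have -> : cube a s = (fun x => s *: x + a)%R @` Q.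
  apply/seteqP; split => [x xas|_ [x xQ <-] i].
    exists (s^-1 *: (x - a))%R; last by rewrite scalerA divff ?gt_eqF// scale1r subrK.
    move=> i; have /andP[x1 x2] := xas i; rewrite !mxE add0r; apply/andP; split.
      by rewrite mulr_ge0 ?invr_ge0 ?(ltW s0)// subr_ge0.
    by rewrite mulrC ltr_pdivrMr// mul1r ltrBlDl.
  have := xQ i; rewrite !mxE add0r => /andP[x1 x2]; apply/andP; split.
    by rewrite lerDr mulr_ge0 ?(ltW s0).
  by rewrite addrC ltrD2l gtr_pMr.
apply: le_lt_trans (hausdorff_lipschitz n s0 _) _.
  move=> x y _ _; rewrite opprD addrACA subrr addr0 -scalerBr enormZ.
  by rewrite gtr0_norm.
by rewrite lte_mul_pinfty//= ?lee_fin ?exprn_ge0 ?(ltW s0)// hausdorff_unit_cube_fin.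
Qed.

Lemma hausdorff_sigma_finite : sigma_finite setT H.
Proof.
exists (fun k : nat => cube (\row_i (- k.+1%:R)) (k.+1%:R + k.+1%:R))%R.
  apply/seteqP; split => // x _; exists (Num.trunc (enorm x)) => // i.
  rewrite mxE addrA addNr add0r.
  by have := le_lt_trans (coord_le_enorm x i) (truncnS_gt (enorm x)); rewrite ltr_norml => /andP[/ltW -> ->].
move=> k; split; first exact: measurable_cube.
by apply: hausdorff_cube_fin; rewrite addr_gt0.
Qed.

HB.instance Definition _ := Measure_isSigmaFinite.Build _ 'rV[R]_n R (hausdorff n)
  hausdorff_sigma_finite.

(* Uniqueness of translation invariant measures: integrate the indicator of
   [A x /\ B (x + y)] for the product of the two measures. *)
Lemma hausdorff_leb_proportional (A B : set 'rV[R]_n) : measurable A -> measurable B ->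
  H A * leb n B = H B * leb n A.
Proof.
move=> mA mB.
pose G1 : set ('rV[R]_n * 'rV[R]_n) := [set p | A p.1 /\ B (p.1 + p.2)%R].
pose G2 : set ('rV[R]_n * 'rV[R]_n) := [set p | B p.1 /\ A (p.1 - p.2)%R].
have mG1 : measurable G1.
  rewrite (_ : G1 = (fst @^-1` A) `&` ((fun p => p.1 + p.2)%R @^-1` B))//.
  apply: measurableI; rewrite -[X in measurable X]setTI; first exact: measurable_fst.
  by apply: measurable_fun_rowD.
have mG2 : measurable G2.
  rewrite (_ : G2 = (fst @^-1` B) `&` ((fun p => p.1 - p.2)%R @^-1` A))//.
  apply: measurableI; rewrite -[X in measurable X]setTI; first exact: measurable_fst.
  by apply: measurable_fun_rowB.
(* For fixed [y], the sections of [G1] and [G2] are translates of each other by [y], and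
   [hausdorff n] is translation invariant. *)
have HG : \int[hausdorff n]_x leb n [set y | G1 (x, y)] =
    \int[hausdorff n]_x leb n [set y | G2 (x, y)].
  rewrite (tonelli_set _ _ mG1) (tonelli_set _ _ mG2); apply: eq_integral => y _.
  rewrite -[LHS]/(hausdorff n _) -[RHS]/(hausdorff n _).
  rewrite -(hausdorff_shift (- y)); congr (hausdorff n _).
  by apply/seteqP; split => x; rewrite /G1 /G2 /= ?subrK => -[].
rewrite muleC -(@integral_section_cst R _ _ _ _ (hausdorff n) (leb n) A (fun x y => B (x + y)%R) _ mA).
  rewrite HG muleC; apply: (@integral_section_cst R _ _ _ _ (hausdorff n) (leb n) B (fun x y => A (x - y)%R)) => // x _.
  have := @lebesgue_row_affine _ n (-1) x A _ mA.
  rewrite normrN1 expr1n invr1 mul1e => <-; last by rewrite oppr_eq0 oner_eq0.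
  by congr (leb n _); apply/seteqP; split => y /=; rewrite scaleN1r addrC.
move=> x _; rewrite -(leb_shift x mB); congr (leb n _).
by apply/seteqP; split => y /=; rewrite addrC.
Qed.

(** The concentric ball of radius [s / 4] stays clear of the open faces. It fills a fixed proportion
    of the cube, and the diameter bound makes its weight at most its volume. *)
Lemma ball_in_cube (a : 'rV[R]_n) (s : R) : (0 < s)%R -> exists B,
  [/\ measurable B, B `<=` cube a s,
      leb n B = (ball_volume n * 4^-1 ^+ n * s ^+ n)%:E & eucl_diam B <= (s / 2)%:E].
Proof.
move=> s0.
pose B := [set x : 'rV[R]_n | (enorm (x - (a + const_mx (s / 2))) <= s / 4)%R].
exists B; split.
- by apply: closed_measurable_row; exact: closed_eball.
- move=> x xB i; have := le_trans (coord_le_enorm _ i) xB.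
  by rewrite !mxE ler_norml => /andP[? ?]; apply/andP; split; lra.
- rewrite (_ : B = [set x | eball0 (s / 4) (x + - (a + const_mx (s / 2)))%R])//.
  rewrite leb_shift ?leb_eball0 ?divr_ge0 ?(ltW s0)//; last exact: measurable_eball0.
  by rewrite exprMn mulrA mulrAC.
- apply/eucl_diam_leP => x y xB yB.
  rewrite (le_trans (enorm_triangle x (a + const_mx (s / 2))%R y))//.
  by rewrite (enorm_distC _ y) (le_trans (lerD xB yB))//; lra.
Qed.

Theorem hausdorff_leb (A : set 'rV[R]_n) : measurable A -> H A = leb n A.
Proof.
move=> mA; have mQ := measurable_cube (0%R : 'rV[R]_n) 1.
have LQ : leb n Q = 1 by rewrite leb_cube// expr1n.
have Hprop (B : set 'rV[R]_n) : measurable B -> H B = H Q * leb n B.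
  by move=> mB; rewrite -(hausdorff_leb_proportional mB mQ) LQ mule1.
suff HQ : H Q = 1 by rewrite Hprop// HQ mul1e.
pose c := fine (H Q).
have cE : H Q = c%:E by rewrite fineK// ge0_fin_numE ?hausdorff_ge0// hausdorff_unit_cube_fin.
apply/eqP; rewrite eq_le; apply/andP; split; last by rewrite -LQ leb_le_hausdorff.
pose t : R := (ball_volume n * 4^-1 ^+ n)%R.
have t0 : (0 < t)%R by rewrite mulr_gt0 ?ball_volume_gt0// exprn_gt0.
have c0 : (0 <= c)%R by rewrite fine_ge0// hausdorff_ge0.
have t1 : (t <= 1)%R.
  have [B [mB BQ LB _]] := ball_in_cube 0 (@ltr01 R).
  by rewrite -lee_fin -[t]mulr1 -{1}(expr1n R n) -LB -LQ le_leb.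
(* [H <= c * leb] is only needed outside of a ball, whose content is at most its volume. *)
have cube_bound (a : 'rV[R]_n) (s d : R) : (0 < s)%R -> (s <= d)%R ->
    hausdorff_content n d (cube a s) <= ((t + c - c * t) * s ^+ n)%:E.
  move=> s0 sd; have [B [mB BQ LB diamB]] := ball_in_cube a s0.
  rewrite -[cube a s](setDUK BQ).
  apply: le_trans (outer_measureU2 (hausdorff_content n d) _ _) _.
  apply: (@le_trans _ _ ((t * s ^+ n)%:E + (c * (s ^+ n - t * s ^+ n))%:E)); last first.
    by rewrite -EFinD lee_fin; move: (s ^+ n)%R => u; suff -> : (t * u + c * (u - t * u) = (t + c - c * t) * u)%R by []; ring.
  apply: leeD.
    apply: le_trans (hausdorff_content_weight _ _) _.
      by rewrite (le_trans diamB)// lee_fin (le_trans _ sd)// ler_pdivrMr// ler_pMr// ler1n.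
    rewrite /hausdorff_weight; case: ifPn => [_|/set0P B0].
      by rewrite lee_fin mulr_ge0 ?(ltW t0)// exprn_ge0// ltW.
    rewrite /t -mulrA [leRHS]EFinM lee_wpmul2l ?lee_fin ?ball_volume_ge0//.
    rewrite -exprMn EFin_expe lee_expe//.
      by rewrite mule_ge0// ?eucl_diam_ge0// lee_fin.
    rewrite (_ : (4^-1 * s = s / 2 * 2^-1)%R); last by field.
    by rewrite [leRHS]EFinM lee_wpmul2r// lee_fin.
  apply: le_trans (le_content_hausdorff _ _ (lt_le_trans s0 sd)) _.
  rewrite Hprop; last by apply: measurableD => //; exact: measurable_cube.
  rewrite cE measureD//; last 2 first.
  - exact: measurable_cube.
  - by rewrite [ltLHS](leb_cube a (ltW s0)) ltry.
  rewrite setIC setIidl// [X in _ * (X - _)](leb_cube a (ltW s0)).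
  by rewrite [X in _ * (_ - X)]LB -EFinB -EFinM.
(* The gain on every subcube of a fine subdivision adds up to [c <= t + c - c * t] for the mass [c]
   of the unit cube, that is [0 <= t * (1 - c)] with [t > 0]. *)
have : H Q <= (t + c - c * t)%:E.
  apply: hausdorff_leP => d d0; have [N Nd] := exists_inv_le d0.
  apply: (@hausdorff_content_cube_le _ _ _ _ _ N) => [|a].
    rewrite -addrA -[X in (X - _)%R]mulr1 -mulrBr.
    by rewrite addr_ge0 ?(ltW t0)// mulr_ge0// subr_ge0.
  by rewrite -exprVn cube_bound// invr_gt0.
rewrite cE !lee_fin -subr_ge0 (_ : (_ - _ = t * (1 - c))%R); last by ring.
by rewrite pmulr_rge0// subr_ge0.
Qed.

End HausdorffLebesgue.

(** * Spherical caps *)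

Section Reflection.
Context {R : realType} {m : nat}.
Implicit Types x y z w : 'rV[R]_m.

(* The identity when [w = 0], since [0 ^-1 = 0]. *)
Definition refl w y := y - (2 * dotp y w / dotp w w) *: w.

Lemma dotp_refl w y z : dotp (refl w y) (refl w z) = dotp y z.
Proof.
rewrite /refl; have [->|w0] := eqVneq w 0; first by rewrite !scaler0 !subr0.
have ww0 : dotp w w != 0 by rewrite dotp_eq0.
rewrite dotpBl !dotpBr !dotpZl !dotpZr (dotpC w z).
by field.
Qed.

Lemma reflK w : involutive (refl w).
Proof.
move=> y; rewrite {1}/refl.
have -> : 2 * dotp (refl w y) w / dotp w w = - (2 * dotp y w / dotp w w).
  rewrite dotpBl dotpZl; have [->|w0] := eqVneq w 0.
    by rewrite dotp0l invr0 !mulr0 oppr0.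
  have ww0 : dotp w w != 0 by rewrite dotp_eq0.
  by field.
by rewrite scaleNr opprK subrK.
Qed.

Lemma dotp_refl_swap w y z : dotp (refl w y) z = dotp y (refl w z).
Proof. by rewrite -{1}(reflK w z) dotp_refl. Qed.

Lemma reflB w y z : refl w y - refl w z = refl w (y - z).
Proof.
rewrite /refl dotpBl mulrBr mulrBl scalerBl !opprB -!addrA; congr (_ + _).
by rewrite [LHS]addrC -addrA [RHS]addrCA.
Qed.

Lemma enorm_refl w y z : enorm (refl w y - refl w z) = enorm (y - z).
Proof. by rewrite reflB /enorm dotp_refl. Qed.

(** This is the reflection in the hyperplane orthogonal to [x - y]. Such reflections carry any point
    of the sphere to any other and supply the rotational symmetry for caps and cones. *)
Lemma refl_swap x y : dotp x x = dotp y y -> refl (x - y) y = x.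
Proof.
move=> xy; rewrite /refl; have [->|xy0] := eqVneq x y; first by rewrite subrr scaler0 subr0.
have w0 : dotp (x - y) (x - y) != 0 by rewrite dotp_eq0 subr_eq0.
have -> : 2 * dotp y (x - y) / dotp (x - y) (x - y) = -1.
  apply: (mulIf w0); rewrite divfK// dotpBr !dotpBl !dotpBr xy (dotpC x y).
  by ring.
by rewrite scaleN1r opprK addrC subrK.
Qed.

Lemma hausdorff_refl k w (A : set 'rV[R]_m) : hausdorff k [set y | A (refl w y)] = hausdorff k A.
Proof.
rewrite -(@hausdorff_isometry _ _ k (refl w) (refl w) A); last 2 first.
- exact: reflK.
- exact: enorm_refl.
congr (hausdorff k _); apply/seteqP; split => [y Ay|_ [y Ay <-]].
  by exists (refl w y) => //; rewrite reflK.
by rewrite /= reflK.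
Qed.

End Reflection.

Section Cap.
Context {R : realType} {n : nat}.
Implicit Types (x y : 'rV[R]_n.+1) (c : R).
Local Open Scope ereal_scope.
Local Notation S := (sphere R n).

Lemma measurable_sphere : measurable S.
Proof.
rewrite (_ : S = (fun x => dotp x x) @^-1` [set 1%R])//.
rewrite -[X in measurable X]setTI; apply: measurable_fun_dotp => //.
Qed.

Definition ccap x c : set 'rV[R]_n.+1 := [set y | S y /\ (c <= dotp x y)%R].

Definition pole : 'rV[R]_n.+1 := vcons 1 0.

Lemma sphere_pole : S pole.
Proof. by rewrite /sphere/= dotp_vcons dotp0l addr0 mulr1. Qed.

Lemma dotp_pole y : dotp pole y = y 0%R 0%R.
Proof. by rewrite -(vcons_vtail y) dotp_vcons dotp0l addr0 mul1r vcons0. Qed.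

Lemma hausdorff_ccap_pole k x c : S x -> hausdorff k (ccap x c) = hausdorff k (ccap pole c).
Proof.
move=> Sx; rewrite -(hausdorff_refl k (x - pole)%R (ccap pole c)).
congr (hausdorff k _); apply/seteqP; split => y /=;
  rewrite /ccap /sphere/= dotp_refl -dotp_refl_swap refl_swap//; by rewrite Sx sphere_pole.
Qed.

Let graph (u : 'rV[R]_n) : 'rV[R]_n.+1 := vcons (Num.sqrt (1 - dotp u u)) u.

(** As [c > 0], the cap lies in the upper hemisphere, where the first coordinate is the nonnegative
    root. *)
Lemma ccap_graph c : (0 < c <= 1)%R ->
  ccap pole c = graph @` eball0 (Num.sqrt (1 - c ^+ 2)).
Proof.
move=> /andP[c0 c1].
have cc1 : (0 <= 1 - c ^+ 2)%R by rewrite subr_ge0 expr_le1// ltW.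
apply/seteqP; split => [y [Sy]|_ [u + <-]]; rewrite /eball0/=.
  rewrite dotp_pole => cy; have := Sy; rewrite /sphere/= dotp_vtail => yE.
  have uE : (1 - dotp (vtail y) (vtail y) = y 0 0 ^+ 2)%R by rewrite -yE addrK.
  exists (vtail y).
    rewrite enorm_le ?sqrtr_ge0// sqr_sqrtr// lerBrDr addrC -lerBrDr uE.
    by rewrite lerXn2r ?nnegrE ?(ltW c0)// (le_trans (ltW c0)).
  by rewrite /graph uE sqrtr_sqr ger0_norm ?vcons_vtail// (le_trans (ltW c0)).
rewrite enorm_le ?sqrtr_ge0// sqr_sqrtr// => u1.
have uc : (c ^+ 2 <= 1 - dotp u u)%R by rewrite lerBrDr addrC -lerBrDr.
have u0 : (0 <= 1 - dotp u u)%R by rewrite (le_trans _ uc)// sqr_ge0.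
split; first by rewrite /sphere/= dotp_vcons -expr2 sqr_sqrtr// subrK.
rewrite dotp_pole vcons0 -[leLHS]ger0_norm ?(ltW c0)// -sqrtr_sqr.
by rewrite ler_wsqrtr.
Qed.

(** Let [a], [b] be the heights, D = |u - v|^2 and U = |u + v|^2. Cauchy-Schwarz for |u|^2 - |v|^2
    gives (a - b)^2 (a + b)^2 <= D U, and the sphere equations give U + (a + b)^2 <= 4. Hence ((a -
    b)^2 + D) (a + b)^2 <= 4 D, while a + b >= 2 c. *)
Lemma graph_lipschitz c (u v : 'rV[R]_n) : (0 < c <= 1)%R ->
  eball0 (Num.sqrt (1 - c ^+ 2)) u -> eball0 (Num.sqrt (1 - c ^+ 2)) v ->
  (enorm (graph u - graph v) <= c^-1 * enorm (u - v))%R.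
Proof.
move=> c01 uc vc; have /andP[c0 c1] := c01.
have : ccap pole c (graph u) by rewrite ccap_graph//; exists u.
have : ccap pole c (graph v) by rewrite ccap_graph//; exists v.
rewrite /graph /ccap/= !dotp_pole !vcons0 /sphere/= !dotp_vcons -!expr2.
move: (Num.sqrt (1 - dotp v v)) (Num.sqrt (1 - dotp u u)) => b a [vb cb] [ua ca].
rewrite enorm_le ?mulr_ge0 ?invr_ge0 ?(ltW c0) ?enorm_ge0//.
rewrite vconsB dotp_vcons exprMn sqr_enorm exprVn -expr2 mulrC ler_pdivlMr ?exprn_gt0//.
have uE : dotp u u = (1 - a ^+ 2)%R by rewrite -ua addrC addKr.
have vE : dotp v v = (1 - b ^+ 2)%R by rewrite -vb addrC addKr.
have CS := dotp_CauchySchwarz (u - v) (u + v).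
have E1 : (dotp (u - v) (u + v) = (b - a) * (a + b))%R.
  rewrite dotpBl !dotpDr (dotpC v u).
  by rewrite uE vE; ring.
have E2 : (dotp (u - v) (u - v) + dotp (u + v) (u + v) = 4 - (2 * a ^+ 2 + 2 * b ^+ 2))%R.
  rewrite dotpBl !dotpBr dotpDl !dotpDr (dotpC v u).
  by rewrite uE vE; ring.
move: CS E2; rewrite E1.
have := dotp_ge0 (u - v); have := dotp_ge0 (u + v).
move: (dotp (u - v) (u - v)) (dotp (u + v) (u + v)) => D U U0 D0 CS E2.
have sc : (4 * c ^+ 2 <= (a + b) ^+ 2)%R by nra.
have key : (((a - b) ^+ 2 + D) * (a + b) ^+ 2 <= 4 * D)%R.
  have Us : (U + (a + b) ^+ 2 <= 4)%R.
    have := sqr_ge0 (a - b)%R; move: E2; rewrite !expr2 => E2 ?; lra.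
  have := ler_wpM2l D0 Us; move: CS; nra.
have := ler_wpM2l (addr_ge0 (sqr_ge0 (a - b)) D0) sc.
move: key; move: (((a - b) ^+ 2 + D))%R => w; move: ((a + b) ^+ 2)%R (c ^+ 2)%R => p q; nra.
Qed.

(** Forgetting the first coordinate is 1-Lipschitz and maps the cap at the pole onto a disc of
    radius sqrt(1 - c^2). *)
Lemma hausdorff_ccap_ge x c : S x -> (0 < c <= 1)%R ->
  (ball_volume n * Num.sqrt (1 - c ^+ 2) ^+ n)%:E <= hausdorff n (ccap x c).
Proof.
move=> Sx c01; rewrite hausdorff_ccap_pole// -leb_eball0 ?sqrtr_ge0//.
rewrite -hausdorff_leb; last exact: measurable_eball0.
rewrite ccap_graph//.
apply: (@le_trans _ _ (hausdorff n (vtail @` (graph @` eball0 (Num.sqrt (1 - c ^+ 2)))))).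
  by apply: le_hausdorff => u uc; exists (graph u); [exists u|rewrite vtail_vcons].
rewrite -[leRHS]mul1e -[X in X%:E * _](expr1n R n).
apply: hausdorff_lipschitz => // _ _ [u _ <-] [v _ <-]; rewrite mul1r.
rewrite !vtail_vcons vconsB enorm_le ?enorm_ge0// sqr_enorm dotp_vcons.
by rewrite lerDr -expr2 sqr_ge0.
Qed.

(** The cap at the pole is the image of the same disc under [graph], which has Lipschitz constant
    [c^-1] there. *)
Lemma hausdorff_ccap_le x c : S x -> (0 < c <= 1)%R ->
  hausdorff n (ccap x c) <= (ball_volume n * Num.sqrt (1 - c ^+ 2) ^+ n * c ^- n)%:E.
Proof.
move=> Sx c01; have /andP[c0 c1] := c01.
rewrite hausdorff_ccap_pole// ccap_graph// mulrC EFinM -leb_eball0 ?sqrtr_ge0//.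
rewrite -hausdorff_leb; last exact: measurable_eball0.
rewrite -exprVn; apply: hausdorff_lipschitz; first by rewrite invr_gt0.
by move=> u v uc vc; exact: graph_lipschitz.
Qed.

Lemma hausdorff_sphere_fin : hausdorff n S < +oo.
Proof.
(* A unit vector has a coordinate of absolute value at least 1 / sqrt(n + 1), which is [2 * c], so
   it lies in the cap around some [e i] or [- e i]. *)
pose c : R := ((2 * Num.sqrt n.+1%:R)^-1)%R.
have n0 : (0 < n.+1%:R :> R)%R by rewrite ltr0n.
have c01 : (0 < c <= 1)%R.
  rewrite invr_gt0 mulr_gt0 ?sqrtr_gt0//= invf_le1 ?mulr_gt0 ?sqrtr_gt0//.
  by rewrite mulr_ege1 ?ler1n// -[leLHS]sqrtr1 ler_wsqrtr// ler1n.
pose e (i : 'I_n.+1) : 'rV[R]_n.+1 := delta_mx 0%R i.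
have dotpe i y : dotp (e i) y = y 0%R i.
  rewrite /dotp (bigD1 i)//= big1 ?addr0 ?mxE ?eqxx ?mul1r// => j ji.
  by rewrite mxE (negbTE ji) andbF mul0r.
have Se i : S (e i) by rewrite /sphere/= dotpe mxE !eqxx.
have SNe i : S (- e i)%R by rewrite /sphere/= dotpNl dotpNr opprK; exact: Se.
have cap_fin x : S x -> hausdorff n (ccap x c) < +oo.
  by move=> Sx; apply: le_lt_trans (hausdorff_ccap_le Sx c01) _; exact: ltry.
have U_fin A B : hausdorff n A < +oo -> hausdorff n B < +oo -> hausdorff n (A `|` B) < +oo.
  move=> fA fB; apply: le_lt_trans (outer_measureU2 (hausdorff n) A B) _.
  by rewrite lte_add_pinfty.
apply: (@le_lt_trans _ _ (hausdorff n
    (\big[setU/set0]_(i < n.+1) (ccap (e i) c `|` ccap (- e i)%R c)))).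
  apply: le_hausdorff => y Sy; apply: contrapT => yU.
  have : (dotp y y <= n.+1%:R * c ^+ 2)%R.
    apply: dotp_le_coord => i; rewrite leNgt; apply/negP => yi; apply: yU.
    rewrite -bigcup_seq; exists i; first by rewrite /= mem_index_enum.
    rewrite /ccap/= dotpNl dotpe.
    by move: yi; rewrite ltNge ler_norml negb_and -!ltNge => /orP[]/ltW ?; [right|left]; split => //; rewrite lerNr.
  rewrite Sy /c exprVn exprMn sqr_sqrtr ?ler0n// leNgt => /negP; apply.
  by rewrite ltr_pdivrMr ?mulr_gt0 ?exprn_gt0// mul1r ltr_pMl// expr2 -natrM ltr1n.
elim/big_ind : _ => [|A B|i _]; [by rewrite hausdorff0 ltry|exact: U_fin|].
by apply: U_fin; exact: cap_fin.
Qed.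

End Cap.

(** * Area of the sphere *)

Lemma integral_powR01 (R : realType) (b : R) : 0 <= b ->
  (\int[lebesgue_measure]_(s in `]0%R, 1%R[) (s `^ b)%:E = ((b + 1)^-1)%:E)%E.
Proof.
move=> b0.
have pow_cont (a x : R) : 0 < x -> {for x, continuous (fun s : R => s `^ a)}.
  move=> x0; apply: differentiable_continuous; apply/derivable1_diffP.
  by apply: derivable_powR; rewrite in_itv/= x0.
have mpow : measurable_fun (`]0, 1[%classic : set (measurableTypeR R)) (fun s : R => (s `^ b)%:E).
  apply/measurable_EFinP; apply: open_continuous_measurable_fun => //.
  by move=> x; rewrite inE/= in_itv/= => /andP[x0 _]; exact: pow_cont.
rewrite -(integral_itv_bndoo true false)//.
have cvg1 a : s `^ a @[s --> 1^'-] --> (1 : R) `^ a.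
  by apply: cvg_at_left_filter; exact: pow_cont.
have cvg0 a : 0 <= a -> s `^ a @[s --> 0^'+] --> (0 : R) `^ a.
  rewrite le_eqVlt => /predU1P[<-|a0].
    by under eq_fun do rewrite powRr0; rewrite powRr0; exact: cvg_cst.
  by rewrite powR0 ?gt_eqF//; exact: powR_cvg0.
rewrite (@continuous_FTC2 _ _ (fun s => (b + 1)^-1 * s `^ (b + 1)))//.
- rewrite powR1 powR0 ?gt_eqF ?ltr_wpDl// mulr0 sube0 mulr1//.
- apply/continuous_within_itvP => //; split; [|exact: cvg0|exact: cvg1].
  by move=> x; rewrite in_itv/= => /andP[x0 _]; exact: pow_cont.
- split => [x||].
  + rewrite in_itv/= => /andP[x0 _]; apply: derivableM => //.
    by apply: derivable_powR; rewrite in_itv/= x0.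
  + by apply: cvgM; [exact: cvg_cst|apply: cvg0; rewrite addr_ge0].
  + by apply: cvgM; [exact: cvg_cst|exact: cvg1].
- move=> x; rewrite in_itv/= => /andP[x0 _].
  have dpow : derivable (fun s : R => s `^ (b + 1)) x 1.
    by apply: derivable_powR; rewrite in_itv/= x0.
  rewrite derive1E deriveM//= derive_cst scaler0 addr0 -derive1E.
  rewrite powR_derive1 ?in_itv/= ?x0// addrK /GRing.scale/= mulrA mulVf ?mul1r//.
  by rewrite gt_eqF ?ltr_wpDl.
Qed.

Lemma ler_expM_lt1 (R : realType) (a b : R) k :
  (forall c, 0 < c < 1 -> c ^+ k * a <= b) -> a <= b.
Proof.
move=> ab.
have cc : c ^+ k * a @[c --> 1^'-] --> (1 : R) ^+ k * a.
  by apply: cvg_at_left_filter; apply: cvgM; [exact: exprn_continuous|exact: cvg_cst].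
rewrite -[a]mul1r -(expr1n R k).
apply: (closed_cvg (fun x => x <= b) _ _ _ cc); first exact: closed_le.
near=> c; apply: ab; apply/andP; split; last by near: c; exact: nbhs_left_lt.
by near: c; exact: nbhs_left_gt.
Unshelve. all: by end_near. Qed.

Section SphereMeasure.
Context {R : realType} {n : nat}.
Local Open Scope ereal_scope.
Local Notation S := (sphere R n).

(** On the whole space [hausdorff n] is not sigma-finite. Its restriction to the sphere is finite,
    as product measures and Tonelli require. *)
Definition sphere_measure : {finite_measure set 'rV[R]_n.+1 -> \bar R} :=
  mfrestr (@measurable_sphere R n) (@hausdorff_sphere_fin R n).

Lemma sphere_measureE A : A `<=` S -> sphere_measure A = hausdorff n A.
Proof. by move=> AS; rewrite /sphere_measure/= /mfrestr /mrestr setIidl. Qed.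

Lemma sphere_measureI A : sphere_measure A = hausdorff n (A `&` S).
Proof. by []. Qed.

Lemma sphere_measure_refl w (A : set 'rV[R]_n.+1) :
  sphere_measure [set y | A (refl w y)] = sphere_measure A.
Proof.
rewrite !sphere_measureI -(hausdorff_refl n w (A `&` S)); congr (hausdorff n _).
by apply/seteqP; split => y [Ay Sy]; split => //; move: Sy; rewrite /sphere/= dotp_refl.
Qed.

End SphereMeasure.

Section SphereArea.
Context {R : realType} {m : nat}.
Local Open Scope ereal_scope.
Local Notation S := (sphere R m).
Local Notation area := (@sphere_measure R m).

(** For a unit vector [y], a solid cone with apex 0, axis [y] and half-angle of cosine [c]. The base
    at height 1 is flat, so that the slices are balls with radius proportional to the height. *)
Definition cone (y : 'rV[R]_m.+1) (c : R) : set 'rV[R]_m.+1 :=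
  [set x | (0 < dotp x y <= 1)%R /\ (c * enorm x <= dotp x y)%R].

Let coneG (c : R) : set ('rV[R]_m.+1 * 'rV[R]_m.+1) := [set p | S p.2 /\ cone p.2 c p.1].

Let capG (b c : R) : set ('rV[R]_m.+1 * 'rV[R]_m.+1) :=
  [set p | (0 < enorm p.1 <= b)%R /\ S p.2 /\ (c * enorm p.1 <= dotp p.1 p.2)%R].

Let measurable_aperture c :
  measurable [set p : 'rV[R]_m.+1 * 'rV[R]_m.+1 | (c * enorm p.1 <= dotp p.1 p.2)%R].
Proof.
rewrite [X in measurable X](_ : _ =
    (fun p => dotp p.1 p.2 - c * enorm p.1)%R @^-1` `[0%R, +oo[%classic); last first.
  by apply/seteqP; split => p; rewrite /= in_itv/= andbT subr_ge0.
rewrite -[X in measurable X]setTI.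
apply: measurable_funB => //; first exact: measurable_fun_dotp.
by apply: measurable_funM => //; apply: measurable_fun_enorm.
Qed.

Let measurable_S2 : measurable [set p : 'rV[R]_m.+1 * 'rV[R]_m.+1 | S p.2].
Proof.
rewrite -[X in measurable X]setTI.
exact: (@measurable_snd _ _ _ _ measurableT _ measurable_sphere).
Qed.

Let measurable_coneG c : measurable (coneG c).
Proof.
have -> : coneG c = [set p | S p.2] `&` ((fun p => dotp p.1 p.2) @^-1` `]0%R, 1%R]%classic `&`
    [set p | (c * enorm p.1 <= dotp p.1 p.2)%R]).
  by apply/seteqP; split => p; rewrite /coneG /cone /= in_itv/= dotpC.
apply: measurableI; first exact: measurable_S2.
apply: measurableI; last exact: measurable_aperture.
by rewrite -[X in measurable X]setTI; apply: measurable_fun_dotp.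
Qed.

Let measurable_capG b c : measurable (capG b c).
Proof.
have -> : capG b c = (fun p => enorm p.1) @^-1` `]0%R, b]%classic `&` ([set p | S p.2] `&`
    [set p | (c * enorm p.1 <= dotp p.1 p.2)%R]).
  by apply/seteqP; split => p; rewrite /capG /= in_itv.
apply: measurableI.
  by rewrite -[X in measurable X]setTI; apply: measurable_fun_enorm.
by apply: measurableI; [exact: measurable_S2|exact: measurable_aperture].
Qed.

Lemma measurable_cone (y : 'rV[R]_m.+1) c : measurable (cone y c).
Proof.
have md : measurable_fun setT (fun x : 'rV[R]_m.+1 => dotp x y) by exact: measurable_fun_dotp.
have -> : cone y c = (fun x => dotp x y) @^-1` `]0%R, 1%R]%classic `&`
    (fun x => dotp x y - c * enorm x)%R @^-1` `[0%R, +oo[%classic.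
  by apply/seteqP; split => x; rewrite /cone /= !in_itv/= andbT subr_ge0.
apply: measurableI; rewrite -[X in measurable X]setTI; first exact: md.
apply: measurable_funB => //; apply: measurable_funM => //.
by apply: measurable_fun_enorm.
Qed.

(** Reflect the axis to the pole. The slice at height [a] is a ball of radius [k * a], where [k] is
    the tangent of the half-angle, and integrating [a ^ m] gives the factor [1 / m.+1]. *)
Lemma leb_cone (y : 'rV[R]_m.+1) c : (0 < c < 1)%R -> S y ->
  leb m.+1 (cone y c) =
    (ball_volume m * Num.sqrt (1 - c ^+ 2) ^+ m * c ^- m / m.+1%:R)%:E.
Proof.
move=> /andP[c0 c1] Sy.
rewrite -hausdorff_leb; last exact: measurable_cone.
rewrite -(hausdorff_refl m.+1 (y - pole)%R).
have -> : [set x | cone y c (refl (y - pole)%R x)] = cone pole c.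
  apply/seteqP; split => x; rewrite /cone/= dotp_refl_swap;
    have -> : refl (y - pole)%R y = pole by
      rewrite -{2}(@refl_swap _ _ y pole) ?reflK// Sy sphere_pole.
  - by rewrite /enorm dotp_refl.
  - by rewrite /enorm dotp_refl.
rewrite hausdorff_leb; last exact: measurable_cone.
have -> : leb m.+1 (cone pole c) = lebS (leb m) (cone pole c) by [].
rewrite lebSE.
pose k : R := (Num.sqrt (1 - c ^+ 2) / c)%R.
have k0 : (0 <= k)%R by rewrite divr_ge0 ?sqrtr_ge0// ltW.
have kE : (1 + k ^+ 2 = c ^- 2)%R.
  have cc : (0 <= 1 - c ^+ 2)%R by rewrite subr_ge0 expr_le1// ltW.
  by rewrite expr_div_n sqr_sqrtr// mulrBl mul1r divff ?expf_eq0 ?gt_eqF// addrC subrK.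
transitivity (\int[lebesgue_measure]_(a in `]0%R, 1%R])
    ((ball_volume m * k ^+ m)%:E * (a `^ m%:R)%:E)).
  rewrite [RHS]integral_mkcond; apply: eq_integral => a _.
  rewrite patchE; case: ifPn; rewrite ?inE ?notin_setE /= in_itv/= => a01.
    have /andP[a0 a1] := a01.
    rewrite powR_mulrn ?(ltW a0)// -EFinM -mulrA -exprMn.
    rewrite -leb_eball0; last by rewrite mulr_ge0 ?(ltW a0).
    have capE v : (c * enorm (vcons a v) <= a)%R = (enorm v <= k * a)%R.
      rewrite mulrC -ler_pdivlMr// [LHS]enorm_le ?divr_ge0 ?(ltW a0) ?(ltW c0)// dotp_vcons.
      rewrite expr_div_n -kE mulrDr mulr1 -expr2 lerD2l [RHS]enorm_le ?mulr_ge0 ?(ltW a0)//.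
        by rewrite [in RHS]exprMn [in RHS]mulrC.
      by rewrite invr_ge0 ltW.
    congr (leb m _); apply/seteqP; split => v;
      rewrite /cone /eball0/= (dotpC (vcons a v)) dotp_pole vcons0 capE//.
    by case.
  rewrite (_ : [set v | _] = set0) ?measure0//.
  by apply/seteqP; split => // v; rewrite /cone/= (dotpC (vcons a v)) dotp_pole vcons0 => -[].
rewrite -integral_itv_bndo_bndc; last first.
  apply: measurable_funTS; apply: emeasurable_funM => //.
  by apply/measurable_EFinP; exact: measurable_powR.
rewrite ge0_integralZl_EFin//; last 3 first.
- by move=> a _; rewrite lee_fin powR_ge0.
- by apply: measurable_funTS; apply/measurable_EFinP; exact: measurable_powR.
- by rewrite mulr_ge0 ?ball_volume_ge0// exprn_ge0.
rewrite integral_powR01 ?ler0n// -EFinM natr1 /k expr_div_n.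
by rewrite !mulrA.
Qed.

Let area_section_cone c : (0 < c < 1)%R ->
  \int[leb m.+1]_x area [set y | coneG c (x, y)] =
  (ball_volume m * Num.sqrt (1 - c ^+ 2) ^+ m * c ^- m / m.+1%:R)%:E * hausdorff m S.
Proof.
move=> c01; rewrite (tonelli_set _ _ (measurable_coneG c)).
rewrite (@integral_section_cst R _ _ _ _ area (leb m.+1) S (fun y => cone y c) _
  measurable_sphere (fun y Sy => leb_cone c01 Sy)).
by congr (_ * _); exact: sphere_measureE.
Qed.

Let area_section_cap b c : (0 < b)%R -> (0 < c < 1)%R ->
  \int[leb m.+1]_x area [set y | capG b c (x, y)] =
  hausdorff m (@ccap R m pole c) * (ball_volume m.+1 * b ^+ m.+1)%:E.
Proof.
move=> b0 c01.
(* The origin is left out because its section is the whole sphere and not a cap. *)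
pose X : set 'rV[R]_m.+1 := [set x | (0 < enorm x <= b)%R].
have XE : X = eball0 b `\` eball0 0.
  apply/seteqP; split => x; rewrite /X /eball0/=.
    by move=> /andP[x0 ->]; split => //; rewrite leNgt x0.
  by case=> -> /negP; rewrite -ltNge => ->.
have mX : measurable X by rewrite XE; apply: measurableD; exact: measurable_eball0.
rewrite (@integral_section_cst R _ _ _ _ (leb m.+1) area X
  (fun x => [set y | S y /\ (c * enorm x <= dotp x y)%R]) (hausdorff m (@ccap R m pole c)) mX).
  congr (_ * _); rewrite XE measureD ?measurable_eball0//; last 3 first.
  - exact: measurable_eball0.
  - exact: measurable_eball0.
  - by rewrite [ltLHS](leb_eball0 _ (ltW b0)) ltry.
  rewrite [X in X - _](leb_eball0 _ (ltW b0)) setIidr; last exact: le_eball0 (ltW b0).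
  by rewrite [X in _ - X](leb_eball0 _ (lexx 0%R)) expr0n mulr0 sube0.
move=> x /andP[x0 _].
transitivity (hausdorff m [set y | S y /\ (c * enorm x <= dotp x y)%R]).
  by apply: sphere_measureE => y [].
have Sx : S ((enorm x)^-1 *: x)%R.
  rewrite /sphere/= dotpZl dotpZr -sqr_enorm; move: (enorm x) x0 => u u0.
  by field; rewrite gt_eqF.
rewrite -(hausdorff_ccap_pole m c Sx); congr (hausdorff m _).
by apply/seteqP; split => y; rewrite /ccap/= dotpZl ler_pdivlMl// mulrC.
Qed.

Let le_area (G1 G2 : set ('rV[R]_m.+1 * 'rV[R]_m.+1)) : measurable G1 -> measurable G2 ->
  (forall x y, G1 (x, y) -> G2 (x, y)) ->
  \int[leb m.+1]_x area [set y | G1 (x, y)] <= \int[leb m.+1]_x area [set y | G2 (x, y)].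
Proof.
move=> mG1 mG2 G12; apply: ge0_le_integral => //.
- exact: measurable_measure_section1.
- exact: measurable_measure_section1.
- move=> x _; apply: le_measure; rewrite ?inE; [exact: measurable_set_section1..|].
  by move=> y; exact: G12.
Qed.

Lemma enorm_sphere (y : 'rV[R]_m.+1) : S y -> enorm y = 1%R.
Proof. by rewrite /sphere/= /enorm => ->; rewrite sqrtr1. Qed.

(* Integrate over the ball the area of [{y | x . y >= c |x|}], a cap of aperture [c] around
   [x / |x|]; Tonelli turns this into the area of the sphere times the volume of a cone, and
   the powers of [1 - c ^+ 2] cancel as [c] tends to 1. *)
Theorem sphere_area : hausdorff m S = (m.+1%:R * ball_volume m.+1)%:E.
Proof.
have [s sE] : exists s, hausdorff m S = s%:E.
  exists (fine (hausdorff m S)); rewrite fineK// ge0_fin_numE ?hausdorff_ge0//.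
  exact: hausdorff_sphere_fin.
have key c : (0 < c < 1)%R ->
    (c ^+ m * (m.+1%:R * ball_volume m.+1) <= s)%R /\
    (c ^+ m.+1 * s <= m.+1%:R * ball_volume m.+1)%R.
  move=> c01; have /andP[c0 c1] := c01.
  have c01' : (0 < c <= 1)%R by rewrite c0 ltW.
  have capE := hausdorff_ccap_le (@sphere_pole R m) c01'.
  have capge := hausdorff_ccap_ge (@sphere_pole R m) c01'.
  have [M ME] : exists M, hausdorff m (@ccap R m pole c) = M%:E.
    exists (fine (hausdorff m (@ccap R m pole c))); rewrite fineK// ge0_fin_numE ?hausdorff_ge0//.
    by apply: le_lt_trans capE _; rewrite ltry.
  move: capE capge; rewrite ME !lee_fin => capE capge.
  have coneE := area_section_cone c01; move: coneE capE capge.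
  have : (0 < ball_volume m * Num.sqrt (1 - c ^+ 2) ^+ m)%R.
    by rewrite mulr_gt0 ?ball_volume_gt0// exprn_gt0// sqrtr_gt0 subr_gt0 expr_lt1// ltW.
  move: (ball_volume m * _)%R => P P0 coneE capE capge.
  (* A point of the unit ball has height at most 1 over any [y], and a point of the cone has norm at
     most [c^-1]. These two inclusions give [lo] and [hi]; since [M] lies between [P] and
     [P * c ^- m], the factor [P] then cancels. *)
  have lo : (M * ball_volume m.+1 <= P * c ^- m / m.+1%:R * s)%R.
    rewrite -lee_fin EFinM [leRHS]EFinM -sE -coneE -ME.
    have := area_section_cap ltr01 c01; rewrite expr1n mulr1 => <-.
    apply: le_area => [||x y [/andP[x0 x1] [Sy cxy]]]; [exact: measurable_capG|exact: measurable_coneG|].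
    have xy := dotp_le_enorm x y; rewrite (enorm_sphere Sy) mulr1 in xy.
    split => //; split => //; rewrite (le_trans xy x1) andbT.
    by rewrite (lt_le_trans _ cxy)// mulr_gt0.
  have hi : (P * c ^- m / m.+1%:R * s <= M * (ball_volume m.+1 * c^-1 ^+ m.+1))%R.
    have ci0 : (0 < c^-1)%R by rewrite invr_gt0.
    rewrite -lee_fin EFinM [leRHS]EFinM -sE -coneE -ME -[leRHS](area_section_cap ci0 c01).
    apply: le_area => [||x y [Sy [/andP[xy0 xy1] cxy]]]; [exact: measurable_coneG|exact: measurable_capG|].
    split; last by split.
    rewrite -[X in (_ <= X)%R]mul1r ler_pdivlMr// mulrC (le_trans cxy xy1) andbT.
    rewrite lt_neqAle enorm_ge0 andbT eq_sym enorm_eq0; apply/eqP => x0.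
    by move: xy0; rewrite x0 dotp0l ltxx.
  have cm0 : (0 < c ^+ m)%R by rewrite exprn_gt0.
  have cm10 : (0 < c ^+ m.+1)%R by rewrite exprn_gt0.
  have m0 : (0 < m.+1%:R :> R)%R by [].
  have w0 := ball_volume_ge0 m.+1 (R := R).
  have {}hi : (P * c ^- m / m.+1%:R * s <= M * (ball_volume m.+1 * c ^- m.+1))%R.
    by rewrite -(exprVn c m.+1).
  move: lo hi capge capE (ball_volume_ge0 m.+1 (R := R)).
  move: (ball_volume m.+1) (c ^+ m)%R (c ^+ m.+1)%R cm0 cm10 (m.+1%:R : R)%R m0 => w u v u0 v0 N N0.
  move=> lo hi Mge Mle w0'; split.
    have := le_trans (ler_wpM2r w0' Mge) lo.
    rewrite (_ : P / u / N * s = P * (s / (u * N)))%R; last by field; rewrite !gt_eqF.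
    rewrite ler_pM2l// ler_pdivlMr ?mulr_gt0// (_ : w * (u * N) = u * (N * w))%R//; ring.
  have := le_trans hi (ler_wpM2r (mulr_ge0 w0' (ltW (_ : 0 < v^-1)%R)) Mle).
  rewrite (_ : P / u / N * s = P / u * (s / N))%R; last by field; rewrite !gt_eqF.
  rewrite invr_gt0 => /(_ v0); rewrite ler_pM2l ?divr_gt0// ler_pdivrMr// mulrAC ler_pdivlMr//.
  by rewrite mulrC (mulrC w).
apply/eqP; rewrite sE eqe eq_le; apply/andP; split.
  by apply: (@ler_expM_lt1 _ _ _ m.+1) => c /key[].
by apply: (@ler_expM_lt1 _ _ _ m) => c /key[].
Qed.

End SphereArea.

(** * Asymptotics of the kernel *)

Section Angle.
Context {R : realType}.
Implicit Types s v : R.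

(* [acos s / pi] on [[-1, 1]]; clamping makes it monotone, hence measurable, on all of [R]. *)
Definition angle s : R := acos (Num.max (-1) (Num.min 1 s)) / pi.

Lemma clamp_itv s : -1 <= Num.max (-1) (Num.min 1 s) <= 1.
Proof. by rewrite le_max lexx/= ge_max ge_min lexx/=; lra. Qed.

Lemma clamp_id s : -1 <= s <= 1 -> Num.max (-1) (Num.min 1 s) = s.
Proof. by move=> /andP[s0 s1]; rewrite (min_idPr s1) (max_idPr s0). Qed.

Lemma angle_ge0 s : 0 <= angle s.
Proof. by rewrite divr_ge0 ?pi_ge0// acos_ge0// clamp_itv. Qed.

Lemma angle_le1 s : angle s <= 1.
Proof. by rewrite ler_pdivrMr ?pi_gt0// mul1r acos_lepi// clamp_itv. Qed.

(** Through this equivalence superlevel sets of the kernel become caps. It fails at [v = 1] for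
    [s < -1], where clamping gives angle 1. *)
Lemma lt_angle v s : 0 <= v < 1 -> (v < angle s) = (s < cos (pi * v)).
Proof.
move=> /andP[v0 v1].
have pv : pi * v \in `[0, pi].
  by rewrite in_itv/= mulr_ge0 ?pi_ge0//= ger_pMr ?pi_gt0// ltW.
have cv : -1 < cos (pi * v).
  rewrite -cospi ltr_cos ?in_itv/= ?lexx ?pi_ge0//.
  by rewrite gtr_pMr ?pi_gt0.
rewrite ltr_pdivlMr ?pi_gt0// (mulrC v) -[LHS]ltr_cos//; last first.
  by rewrite in_itv/= acos_ge0 ?acos_lepi// clamp_itv.
rewrite acosK ?in_itv/= ?clamp_itv// gt_max cv/= gt_min.
by rewrite ltNge cos_le1.
Qed.

Lemma nonincreasing_angle : {homo angle : s t / s <= t >-> t <= s}.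
Proof.
move=> s t st; rewrite leNgt; apply/negP => ast.
have a01 : 0 <= angle s < 1 by rewrite angle_ge0 (lt_le_trans ast)// angle_le1.
move: (ast); rewrite lt_angle// => tc.
have := le_lt_trans st tc; rewrite -lt_angle// ltxx//.
Qed.

Lemma measurable_angle : measurable_fun setT angle.
Proof. by apply: nonincreasing_measurable => // s t; exact: nonincreasing_angle. Qed.

Lemma angleN s : angle (- s) = 1 - angle s.
Proof.
rewrite /angle (_ : Num.max _ _ = - Num.max (-1) (Num.min 1 s)).
  by rewrite acosN ?clamp_itv// mulrBl divff// gt_eqF ?pi_gt0.
by rewrite oppr_max oppr_min opprK minC; case: (leP s 1) => ?; case: (leP (-1) s) => ?;
   rewrite /Num.min /Num.max; do ?case: ifPn; lra.
Qed.

End Angle.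

Section Sinc.
Context {R : realType}.

Lemma cvg_sinc : sin x / x @[x --> (0 : R)^'+] --> (1 : R).
Proof.
have [dsin dE] := is_derive_sin (0 : R).
have H : h^-1 *: ((sin \o shift 0) (h *: 1) - sin 0) @[h --> (0 : R)^'] --> cos (0 : R).
  by rewrite -dE; exact: dsin.
rewrite -[X in _ --> X](@cos0 R); apply: cvg_trans (cvg_dnbhs_at_right H).
apply: near_eq_cvg; near=> h.
by rewrite /= sin0 subr0 addr0 [h *: 1]mulr1 [LHS]mulrC.
Unshelve. all: by end_near. Qed.

(** For a cap of angle [a], the disc below it has radius [sin a] and the graph over it has Lipschitz
    constant [(cos a)^-1]; these are the factors to be compared with [a ^+ n]. *)
Lemma sinc_near n (e : R) : 0 < e -> exists d : R, [/\ 0 < d, d < pi / 2 &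
  forall a, 0 < a < d -> (1 - e) * a ^+ n <= sin a ^+ n /\
    sin a ^+ n * (cos a) ^- n <= (1 + e) * a ^+ n].
Proof.
move=> e0; have pi20 : 0 < pi / 2 :> R by rewrite divr_gt0 ?pi_gt0.
have lo_cvg : ((sin x / x) ^+ n) @[x --> (0:R)^'+] --> (1 ^+ n : R).
  apply: (@cvg_comp _ _ _ _ (fun x => x ^+ n)); last exact: exprn_continuous.
  exact: cvg_sinc.
have hi_cvg : ((sin x / x * (cos x)^-1) ^+ n) @[x --> (0:R)^'+] --> ((1 * (cos 0)^-1) ^+ n : R).
  apply: (@cvg_comp _ _ _ _ (fun x => x ^+ n)); last exact: exprn_continuous.
  apply: cvgM; first exact: cvg_sinc.
  apply: cvgV; first by rewrite cos0 oner_neq0.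
  by apply: cvg_at_right_filter; exact: continuous_cos.
rewrite cos0 invr1 mulr1 expr1n in hi_cvg; rewrite expr1n in lo_cvg.
have : \forall a \near (0:R)^'+, [/\ a < pi / 2, 1 - e <= (sin a / a) ^+ n &
    (sin a / a * (cos a)^-1) ^+ n <= 1 + e].
  near=> a; split.
  - by near: a; exact: nbhs_right_lt.
  - by near: a; apply: (cvgr_ge _ lo_cvg); rewrite gtrBl.
  - by near: a; apply: (cvgr_le _ hi_cvg); rewrite ltrDl.
move=> [d /= d0 dP].
exists (Num.min d (pi / 2) / 2); have m0 : 0 < Num.min d (pi / 2) by rewrite lt_min d0.
have mle : Num.min d (pi / 2) <= pi / 2 by rewrite ge_min lexx orbT.
have mle' : Num.min d (pi / 2) <= d by rewrite ge_min lexx.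
split; [by rewrite divr_gt0|lra|move=> a /andP[a0 am]].
have [a2 lo hi] : [/\ a < pi / 2, 1 - e <= (sin a / a) ^+ n &
    (sin a / a * (cos a)^-1) ^+ n <= 1 + e].
  by apply: dP => //=; rewrite sub0r normrN gtr0_norm//; lra.
have an0 : 0 < a ^+ n by rewrite exprn_gt0.
split.
  by rewrite -ler_pdivlMr// -expr_div_n.
by move: hi; rewrite exprMn expr_div_n exprVn -ler_pdivrMr// (mulrAC (sin a ^+ n)).
Unshelve. all: by end_near. Qed.

End Sinc.

Section CapMeasure.
Context {R : realType} {n : nat}.
Local Open Scope ereal_scope.
Local Notation S := (sphere R n).
Local Notation area := (@sphere_measure R n).
Implicit Types (x y : 'rV[R]_n.+1).

(** Open, and not cut by the sphere: superlevel sets of the kernel have this form, and [area] sees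
    only the part on the sphere. *)
Definition ocap x (c : R) : set 'rV[R]_n.+1 := [set y | (c < dotp x y)%R].

Lemma area_ocap_pole x c : S x -> area (ocap x c) = area (ocap pole c).
Proof.
move=> Sx; rewrite -(sphere_measure_refl (x - pole)%R (ocap pole c)).
congr (sphere_measure _); apply/seteqP; split => y;
  by rewrite /ocap/= -dotp_refl_swap refl_swap// Sx sphere_pole.
Qed.

Lemma area_fin A : measurable A -> area A \is a fin_num.
Proof. by move=> mA; exact: fin_num_measure. Qed.

Lemma measurable_ocap x c : measurable (ocap x c).
Proof.
rewrite [X in measurable X](_ : _ = (fun y => dotp x y) @^-1` `]c, +oo[%classic); last first.
  by apply/seteqP; split => y /=; rewrite in_itv/= andbT.
by rewrite -[X in measurable X]setTI; apply: measurable_fun_dotp.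
Qed.

Let area_le_ccap c : area (ocap pole c) <= hausdorff n (@ccap R n pole c).
Proof. by apply: le_hausdorff => y [/ltW cy Sy]; split. Qed.

Let ccap_le_area c d : (c < d)%R -> hausdorff n (@ccap R n pole d) <= area (ocap pole c).
Proof. by move=> cd; apply: le_hausdorff => y [Sy dy]; split => //; exact: lt_le_trans dy. Qed.

Let sqrt_sin (a : R) : (0 <= a <= pi)%R -> Num.sqrt (1 - cos a ^+ 2) = sin a.
Proof. by move=> a0; rewrite -sin2cos2 sqrtr_sqr ger0_norm// sin_ge0_pi. Qed.

(** The cap bounds are sharp for small [a] only. The term [B * a ^+ n.+1] makes them valid on all of
    []0, pi[], and its extra power of [a] turns into a factor of order 1/t after integration. *)
Lemma area_ocap_near (e : R) : (0 < e < 1)%R -> exists B : R, (0 <= B)%R /\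
  forall a, (0 < a < pi)%R ->
    ((1 - e) * ball_volume n * a ^+ n)%:E <= area (ocap pole (cos a)) + (B * a ^+ n.+1)%:E /\
    area (ocap pole (cos a)) <= ((1 + e) * ball_volume n * a ^+ n + B * a ^+ n.+1)%:E.
Proof.
move=> /andP[e0 e1].
have [d [d0 dpi dP]] := sinc_near n e0.
have w0 := ball_volume_ge0 (R := R) n.
pose s := fine (area setT).
have sE : area setT = s%:E by rewrite fineK// area_fin.
have s0 : (0 <= s)%R by rewrite fine_ge0.
have B0 : (0 <= s / d ^+ n.+1 + ball_volume n / d)%R.
  by rewrite addr_ge0// divr_ge0// ?exprn_ge0// ltW.
(* For [a >= d], the first summand times [a ^+ n.+1] dominates the total area, and the second
   dominates [ball_volume n * a ^+ n]. *)
exists (s / d ^+ n.+1 + ball_volume n / d)%R; split => //.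
move=> a /andP[a0 api]; have [ad|da] := ltP a d; last first.
  move: (ball_volume n) w0 B0 => w w0 B0.
  have B1 : (w * a ^+ n <= w / d * a ^+ n.+1)%R.
    rewrite exprS mulrA ler_wpM2r ?exprn_ge0 ?(ltW a0)//.
    by rewrite -mulrA ler_peMr// mulrC ler_pdivlMr ?mul1r.
  have B2 : (s <= s / d ^+ n.+1 * a ^+ n.+1)%R.
    rewrite -mulrA ler_peMr// mulrC ler_pdivlMr ?exprn_gt0// mul1r.
    by rewrite lerXn2r ?nnegrE ?(ltW d0) ?(ltW a0).
  have an0 : (0 <= w * a ^+ n)%R by rewrite mulr_ge0 ?exprn_ge0 ?(ltW a0).
  split.
    rewrite -[leLHS]add0e leeD// lee_fin -(mulrA (1 - e)%R) (mulrDl (s / _)%R).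
    apply: (@le_trans _ _ (w * a ^+ n)%R).
      by rewrite ler_piMl// gerBl ltW.
    by rewrite (le_trans B1)// lerDr (le_trans s0).
  apply: (@le_trans _ _ s%:E); first by rewrite -sE le_measure ?inE//; exact: measurable_ocap.
  rewrite lee_fin (mulrDl (s / _)%R) (le_trans B2)// addrCA lerDl addr_ge0//.
    by rewrite -mulrA mulr_ge0// addr_ge0 ?(ltW e0).
  by rewrite (le_trans an0).
have ad2 : (a < pi / 2)%R := lt_trans ad dpi.
have c01 b : (0 < b <= a)%R -> (0 < cos b <= 1)%R.
  move=> /andP[b0 ba]; rewrite cos_le1 andbT cos_gt0_pihalf//.
  by rewrite (le_lt_trans ba ad2) andbT (lt_trans _ b0)// oppr_lt0 divr_gt0 ?pi_gt0.
have [dP1 dP2] := dP a ltac:(by rewrite a0 ad).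
have aa : (0 < a <= a)%R by rewrite a0 lexx.
have apos k : (0 <= a ^+ k)%R by rewrite exprn_ge0// ltW.
have ppos : (0 < d ^+ n.+1)%R by rewrite exprn_gt0.
split.
  apply: (@le_trans _ _ (area (ocap pole (cos a)))); last first.
    by rewrite leeDl// lee_fin mulr_ge0.
  have [V VE] : exists V, area (ocap pole (cos a)) = V%:E.
    by exists (fine (area (ocap pole (cos a)))); rewrite fineK// area_fin//; exact: measurable_ocap.
  (* The open cap contains the closed caps of angle [q * a] with [q < 1]; then [q] tends to 1. *)
  rewrite VE lee_fin; apply: (@ler_expM_lt1 _ _ _ n) => q /andP[q0 q1].
  have qa : (0 < q * a <= a)%R by rewrite mulr_gt0//= ger_pMl// ltW.
  have qaa : (q * a < a)%R by rewrite gtr_pMl.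
  have qpi : (0 <= q * a <= pi)%R.
    by rewrite mulr_ge0 ?(ltW q0) ?(ltW a0)//= (le_trans (ltW qaa))// ltW.
  rewrite -lee_fin -VE; apply: le_trans (@ccap_le_area _ (cos (q * a)%R) _); last first.
    by rewrite ltr_cos ?qaa// in_itv/= ?qpi ?(ltW a0) ?(ltW api).
  apply: le_trans (hausdorff_ccap_ge sphere_pole (c01 _ qa)).
  rewrite sqrt_sin// lee_fin.
  have [dQ _] := dP (q * a)%R ltac:(by rewrite mulr_gt0// (lt_trans qaa)).
  rewrite (_ : q ^+ n * _ = ball_volume n * ((1 - e) * (q * a) ^+ n))%R; last first.
    by rewrite exprMn; ring.
  by rewrite ler_wpM2l.
apply: le_trans (area_le_ccap _) _.
apply: le_trans (hausdorff_ccap_le sphere_pole (c01 _ aa)) _.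
rewrite sqrt_sin ?(ltW a0) ?(ltW api)// lee_fin.
apply: (@le_trans _ _ ((1 + e) * ball_volume n * a ^+ n)%R).
  by rewrite -[leLHS]mulrA (mulrC (1 + e)%R) -[leRHS]mulrA ler_wpM2l.
by rewrite lerDl mulr_ge0.
Qed.

End CapMeasure.

Section BetaIntegral.
Context {R : realType} (t : R) (t0 : 0 < t).
Local Open Scope ereal_scope.
Local Notation mu := (@lebesgue_measure R).

(** This is [t] times Euler's beta function at (t + a, k + 1), as the substitution s = p^t in
    [integral_beta] shows. *)
Definition beta_value (k a : nat) : R := (t * (k`!)%:R / \prod_(i < k.+1) (t + a%:R + i%:R))%R.

Let tai (a i : nat) : (0 < t + a%:R + i%:R)%R.
Proof. by rewrite -addrA -natrD ltr_wpDr. Qed.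

Lemma beta_valueS k a : (beta_value k.+1 a = beta_value k a - beta_value k a.+1)%R.
Proof.
rewrite /beta_value.
have P0 : (0 < \prod_(i < k) (t + a%:R + i.+1%:R))%R by apply: prodr_gt0 => i _; exact: tai.
have -> : (\prod_(i < k.+2) (t + a%:R + i%:R) = (t + a%:R) *
    ((\prod_(i < k) (t + a%:R + i.+1%:R)) * (t + a%:R + k.+1%:R)))%R.
  by rewrite big_ord_recl /= addr0 big_ord_recr.
have -> : (\prod_(i < k.+1) (t + a%:R + i%:R) = (t + a%:R) *
    \prod_(i < k) (t + a%:R + i.+1%:R))%R by rewrite big_ord_recl /= addr0.
have -> : (\prod_(i < k.+1) (t + a.+1%:R + i%:R) =
    (\prod_(i < k) (t + a%:R + i.+1%:R)) * (t + a%:R + k.+1%:R))%R.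
  by rewrite big_ord_recr/=; congr (_ * _)%R; [apply: eq_bigr => i _|];
    rewrite -!addrA -!natrD addSnnS.
rewrite factS natrM; move: (\prod_(i < k) _)%R P0 => P P0.
have ta : (0 < t + a%:R)%R by rewrite ltr_wpDr.
have tak := tai a k.+1; rewrite -natr1 in tak *.
by field; rewrite !gt_eqF.
Qed.

Let p (s : R) : R := s `^ t^-1.

Let p01 s : (0 < s < 1)%R -> (0 <= p s <= 1)%R.
Proof.
move=> /andP[s0 s1]; rewrite powR_ge0/= -(powRr0 s) ger_powR ?s0 ?(ltW s1)//.
by rewrite invr_ge0 ltW.
Qed.

Let measurable_p : measurable_fun setT p.
Proof. exact: measurable_powR. Qed.

Let measurable_pq k a : measurable_fun setT (fun s => (p s ^+ a * (1 - p s) ^+ k)%:E).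
Proof.
apply/measurable_EFinP; apply: measurable_funM; apply: measurable_funX; first exact: measurable_p.
by apply: measurable_funB => //; exact: measurable_p.
Qed.

(* Induction on [k], as (1 - p)^(k+1) + p (1 - p)^k = (1 - p)^k for p = s^(1/t). *)
Lemma integral_beta k a :
  \int[mu]_(s in `]0%R, 1%R[) ((s `^ t^-1) ^+ a * (1 - s `^ t^-1) ^+ k)%:E = (beta_value k a)%:E.
Proof.
elim: k a => [|k ih] a.
  transitivity (\int[mu]_(s in `]0%R, 1%R[) (s `^ (a%:R / t))%:E).
    by apply: eq_integral => s _; rewrite expr0 mulr1 mulrC powRrM powR_mulrn ?powR_ge0.
  rewrite integral_powR01 ?divr_ge0 ?(ltW t0)// /beta_value big_ord1 fact0 mulr1 addr0.
  by congr EFin; field; rewrite !gt_eqF ?ltr_wpDr// ?ltr_wpDl.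
have sum : \int[mu]_(s in `]0%R, 1%R[) (p s ^+ a * (1 - p s) ^+ k.+1)%:E +
    (beta_value k a.+1)%:E = (beta_value k a)%:E.
  rewrite -!ih -ge0_integralD//; last 4 first.
  - move=> s; rewrite /= in_itv/= => /p01/andP[p0 p1].
    by rewrite lee_fin mulr_ge0 ?exprn_ge0// subr_ge0.
  - by apply: measurable_funTS; exact: measurable_pq.
  - move=> s; rewrite /= in_itv/= => /p01/andP[p0 p1].
    by rewrite lee_fin mulr_ge0 ?exprn_ge0// subr_ge0.
  - by apply: measurable_funTS; exact: measurable_pq.
  apply: eq_integral => s _; rewrite -EFinD; congr EFin.
  by rewrite /p !exprS; ring.
rewrite beta_valueS EFinB -sum.
by rewrite addeK.
Qed.

End BetaIntegral.

Section KernelIntegral.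
Context {R : realType} {n : nat}.
Local Open Scope ereal_scope.
Local Notation S := (sphere R n).
Local Notation area := (@sphere_measure R n).
Implicit Types (x y : 'rV[R]_n.+1) (t e : R).

(** The exponent here stands for [t - n] in the theorem. The formula makes sense off the sphere too,
    so that measurability holds on the whole space. *)
Definition kern t x y : R := angle (dotp x y) `^ t.

Lemma kern_ge0 t x y : (0 <= kern t x y)%R.
Proof. exact: powR_ge0. Qed.

Lemma kern_le1 t x y : (0 <= t)%R -> (kern t x y <= 1)%R.
Proof.
move=> t0; rewrite (le_trans (ge0_ler_powR t0 _ _ (angle_le1 _)))//.
- by rewrite nnegrE angle_ge0.
- by rewrite nnegrE.
- by rewrite powR1.
Qed.

Lemma kernC t x y : kern t x y = kern t y x.
Proof. by rewrite /kern dotpC. Qed.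

Lemma kernNN t x y : kern t (- x) (- y) = kern t x y.
Proof. by rewrite /kern dotpNl dotpNr opprK. Qed.

Lemma measurable_fun_kern d (T : measurableType d) (f g : T -> 'rV[R]_n.+1) t :
  measurable_fun setT f -> measurable_fun setT g ->
  measurable_fun setT (fun u => (kern t (f u) (g u))%:E).
Proof.
move=> mf mg; apply/measurable_EFinP.
rewrite /kern.
apply: (@measurableT_comp _ _ _ _ _ _ (fun s : R => s `^ t)%R _ (fun u => angle (dotp (f u) (g u)))).
  exact: measurable_powR.
apply: (@measurableT_comp _ _ _ _ _ _ (@angle R) _ (fun u => dotp (f u) (g u))).
  exact: measurable_angle.
by apply: measurable_fun_dotp.
Qed.

(** The kernel exceeds [s] when the angle between [x] and [y] exceeds [pi * s^(1/t)], that is when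
    [y] is within [pi * (1 - s^(1/t))] of [- x]. By symmetry the area of this cap does not depend on
    [x]. *)
Lemma area_superlevel_kern t x (s : R) : (0 < t)%R -> S x -> (0 < s < 1)%R ->
  area [set y | s%:E < (kern t x y)%:E] = area (ocap pole (cos (pi * (1 - s `^ t^-1)))%R).
Proof.
move=> t0 Sx /andP[s0 s1].
have SNx : S (- x)%R by rewrite /sphere/= dotpNl dotpNr opprK.
transitivity (area (ocap (- x)%R (cos (pi * (1 - s `^ t^-1)))%R)); last exact: area_ocap_pole.
congr (sphere_measure _).
have p0 : (0 < s `^ t^-1)%R by rewrite powR_gt0.
have ti0 : (0 < t^-1)%R by rewrite invr_gt0.
have p1 : (s `^ t^-1 < 1)%R.
  by have := gt0_ltr_powR ti0 _ _ s1; rewrite powR1; apply; rewrite nnegrE ?ltW.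
have eqv y : (s%:E < (kern t x y)%:E) = (cos (pi * (1 - s `^ t^-1)) < dotp (- x) y)%R.
  rewrite lte_fin dotpNl mulrBr mulr1 cosB cospi sinpi mul0r addr0 mulN1r ltrN2.
  rewrite -lt_angle ?(ltW p0)// /kern.
  have sE : s = ((s `^ t^-1) `^ t)%R by rewrite -powRrM mulVf ?gt_eqF// powRr1// ltW.
  rewrite {1}sE; move: (s `^ t^-1)%R p0 => p p0.
  apply/idP/idP => h; last by rewrite gt0_ltr_powR// nnegrE ?angle_ge0// ltW.
  rewrite ltNge; apply/negP => ap; move: h; rewrite ltNge ge0_ler_powR//.
  - exact: ltW.
  - by rewrite nnegrE angle_ge0.
  - by rewrite nnegrE ltW.
by apply/seteqP; split => y /=; rewrite /ocap/= eqv.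
Qed.

Let cap_angle t (s : R) : R := (pi * (1 - s `^ t^-1))%R.

Let cap_angle_itv t s : (0 < t)%R -> (0 < s < 1)%R -> (0 < cap_angle t s < pi)%R.
Proof.
move=> t0 /andP[s0 s1].
have ti0 : (0 < t^-1)%R by rewrite invr_gt0.
have p0 : (0 < s `^ t^-1)%R by rewrite powR_gt0.
have p1 : (s `^ t^-1 < 1)%R.
  by have := gt0_ltr_powR ti0 _ _ s1; rewrite powR1; apply; rewrite nnegrE ?ltW.
by rewrite mulr_gt0 ?pi_gt0 ?subr_gt0//= gtr_pMr ?pi_gt0// gtrBl.
Qed.

Let measurable_pow c k t :
  measurable_fun setT (fun s : R => (c * cap_angle t s ^+ k)%:E).
Proof.
apply/measurable_EFinP; apply: measurable_funM => //; apply: measurable_funX.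
apply: measurable_funM => //; apply: measurable_funB => //.
Qed.

Let pow_ge0 c k t s : (0 <= c)%R -> (0 < t)%R -> `]0%R, 1%R[%classic s ->
  (0 <= c * cap_angle t s ^+ k)%R.
Proof.
move=> c0 t0; rewrite /= in_itv/= => s01.
by have /andP[w0 _] := cap_angle_itv t0 s01; rewrite mulr_ge0// exprn_ge0// ltW.
Qed.

Let integral_pow c k t : (0 <= c)%R -> (0 < t)%R ->
  \int[lebesgue_measure]_(s in `]0%R, 1%R[) (c * cap_angle t s ^+ k)%:E =
  (c * pi ^+ k * beta_value t k 0)%:E.
Proof.
move=> c0 t0; rewrite [RHS]EFinM -integral_beta// -ge0_integralZl_EFin//.
- by apply: eq_integral => s _; rewrite expr0 mul1r /cap_angle exprMn -EFinM mulrA.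
- move=> s s01; rewrite expr0 mul1r lee_fin.
  have := @pow_ge0 1%R k t s ler01 t0 s01; rewrite mul1r /cap_angle exprMn.
  by rewrite pmulr_rge0// exprn_gt0// pi_gt0.
- apply: measurable_funTS; apply/measurable_EFinP.
  apply: measurable_funM; apply: measurable_funX; first exact: measurable_powR.
  by apply: measurable_funB => //; exact: measurable_powR.
- by rewrite mulr_ge0// exprn_ge0// pi_ge0.
Qed.

(** The layer cake formula leaves an integral of cap areas, and powers of the cap angle
    [pi * (1 - s^(1/t))] integrate to beta values. Neither [B] nor the bounds depend on [x]. *)
Lemma integral_kern_bounds e : (0 < e < 1)%R -> exists B : R, (0 <= B)%R /\
  forall t x, (0 < t)%R -> S x ->
    ((1 - e) * ball_volume n * pi ^+ n * beta_value t n 0)%:E <=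
      \int[area]_y (kern t x y)%:E + (B * pi ^+ n.+1 * beta_value t n.+1 0)%:E /\
    \int[area]_y (kern t x y)%:E <=
      ((1 + e) * ball_volume n * pi ^+ n * beta_value t n 0 +
       B * pi ^+ n.+1 * beta_value t n.+1 0)%:E.
Proof.
move=> e01; have /andP[e0 e1] := e01; have [B [B0 BP]] := @area_ocap_near R n e e01.
exists B; split => // t x t0 Sx.
have w0 := ball_volume_ge0 (R := R) n.
have mk : measurable_fun setT (fun y => (kern t x y)%:E) by exact: measurable_fun_kern.
have IE : \int[area]_y (kern t x y)%:E =
    \int[lebesgue_measure]_(s in `]0%R, 1%R[) area [set y | s%:E < (kern t x y)%:E].
  rewrite (layer_cake01 area mk); last by move=> y; rewrite lee_fin kern_ge0.
  by apply: eq_integral => y _; rewrite -EFin_min min_l// kern_le1// ltW.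
have mI : measurable_fun (`]0%R, 1%R[%classic : set (measurableTypeR R))
    (fun s => area [set y | (s : R)%:E < (kern t x y)%:E]).
  exact: measurable_superlevel_measure.
have e10 : (0 <= (1 - e) * ball_volume n)%R by rewrite mulr_ge0// subr_ge0 ltW.
have e20 : (0 <= (1 + e) * ball_volume n)%R by rewrite mulr_ge0// addr_ge0// ltW.
have mpow c k : measurable_fun (`]0%R, 1%R[%classic : set (measurableTypeR R))
    (fun s : R => (c * cap_angle t s ^+ k)%:E).
  exact: measurable_funTS (measurable_pow c k t).
have capE s : `]0%R, 1%R[%classic s ->
    area [set y | s%:E < (kern t x y)%:E] = area (ocap pole (cos (cap_angle t s))).
  by rewrite /= in_itv/=; exact: area_superlevel_kern.
have capP s : `]0%R, 1%R[%classic s -> _ := fun s01 => BP (cap_angle t s) (cap_angle_itv t0 s01).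
rewrite IE EFinD -(integral_pow n e10 t0) -(integral_pow n e20 t0) -(integral_pow n.+1 B0 t0).
split.
  rewrite -ge0_integralD//.
  - apply: ge0_le_integral => //.
    + by move=> s s01; rewrite lee_fin pow_ge0.
    + apply: emeasurable_funD => //.
    + by move=> s s01; rewrite capE//; have [] := capP s s01.
  - by move=> s s01; rewrite lee_fin pow_ge0.
rewrite -ge0_integralD//.
- apply: ge0_le_integral => //.
  + apply: emeasurable_funD => //.
  + by move=> s s01; rewrite capE//; have [_] := capP s s01.
- by move=> s s01; rewrite lee_fin pow_ge0.
- by move=> s s01; rewrite lee_fin pow_ge0.
Qed.

Lemma beta_valueSr k t : (0 < t)%R ->
  (beta_value t k.+1 0 = beta_value t k 0 * (k.+1%:R / (t + k.+1%:R)))%R.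
Proof.
move=> t0; rewrite /beta_value [in LHS]big_ord_recr/= addr0 factS natrM.
rewrite invfM; move: (\prod_(i < k.+1) _)^-1%R (t + k.+1%:R)^-1%R => P Q; ring.
Qed.

(** The shift [c] will be [n]: the kernel has exponent [t - n], while the normalization is a power
    of [t]. *)
Lemma beta_value_cvg (c : R) k :
  (t ^+ k * beta_value (t - c) k 0 @[t --> +oo] --> (k`!%:R : R))%R.
Proof.
elim: k => [|k ih].
  apply: (@cvg_trans _ (1%R @[_ --> +oo%R])); last exact: cvg_cst.
  apply: near_eq_cvg; near=> t.
  rewrite expr0 mul1r /beta_value big_ord1 fact0 mulr1 !addr0 divff// subr_eq0 gt_eqF//.
  by near: t; apply: nbhs_pinfty_gt; rewrite num_real.
have lim1 : (k.+1%:R * (t / (t - c + k.+1%:R)) @[t --> +oo] --> (k.+1%:R * 1 : R))%R.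
  apply: cvgM; first exact: cvg_cst.
  apply/cvgrPdist_le => e e0; near=> t.
  have tc : (`|k.+1%:R - c| / e + c + 1 <= t)%R.
    by near: t; apply: nbhs_pinfty_ge; rewrite num_real.
  have q0 : (0 <= `|k.+1%:R - c| / e)%R by rewrite divr_ge0// ltW.
  have t0 : (0 < t - c + k.+1%:R)%R.
    by rewrite ltr_wpDr// subr_gt0 (lt_le_trans _ tc)// -addrA ltr_wpDl// ltrDl.
  rewrite (_ : (1 - _ = (k.+1%:R - c) / (t - c + k.+1%:R))%R); last first.
    have t0' : (t - c + k.+1%:R != 0)%R by rewrite gt_eqF.
    by move: (k.+1%:R : R)%R t0' => u t0'; field.
  rewrite normrM normfV (gtr0_norm t0) ler_pdivrMr// mulrC -ler_pdivrMr//.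
  have := ler0n R k.+1; lra.
have lim2 := cvgM ih lim1; rewrite mulr1 in lim2.
rewrite factS natrM mulrC.
apply: (@cvg_trans _ ((t ^+ k * beta_value (t - c) k 0 *
    (k.+1%:R * (t / (t - c + k.+1%:R))))%R @[t --> +oo%R])); last exact: lim2.
apply: near_eq_cvg; near=> t.
rewrite /= beta_valueSr; last first.
  by rewrite subr_gt0; near: t; apply: nbhs_pinfty_gt; rewrite num_real.
rewrite exprS; move: (t ^+ k)%R (beta_value _ _ _) => P Q; ring.
Unshelve. all: by end_near. Qed.

Lemma kern_limit e : (0 < e)%R ->
  \forall t \near +oo%R, forall x, S x ->
    (ball_volume n * pi ^+ n * n`!%:R - e)%:E <=
      (t ^+ n)%:E * \int[area]_y (kern (t - n%:R) x y)%:E /\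
    (t ^+ n)%:E * \int[area]_y (kern (t - n%:R) x y)%:E <=
    (ball_volume n * pi ^+ n * n`!%:R + e)%:E.
Proof.
move=> e0; pose C : R := (ball_volume n * pi ^+ n * n`!%:R)%R.
have C0 : (0 <= C)%R by rewrite mulr_ge0// mulr_ge0 ?ball_volume_ge0// exprn_ge0// pi_ge0.
(* The relative error [h] of the cap bounds is to move the limit [C] by less than [e]. *)
have [h h01 hC] : exists2 h : R, (0 < h < 1)%R & (h * C < e)%R.
  have q0 : (0 < e / (C + e))%R by rewrite divr_gt0// ltr_wpDl.
  exists (Num.min 2^-1 (e / (C + e)))%R.
    by rewrite lt_min gt_min q0 invr_gt0 ltr0n invf_lt1 ?ltr1n.
  apply: (@le_lt_trans _ _ (e / (C + e) * C)%R).
    by rewrite ler_wpM2r// ge_min lexx orbT.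
  by rewrite mulrAC ltr_pdivrMr ?ltr_wpDl// mulrDr ltrDl mulr_gt0.
have [B [B0 BP]] := integral_kern_bounds h01.
have Xlim := @beta_value_cvg n%:R n.
(* The extra power of the angle leaves a factor [t^-1] after normalization. *)
have Ylim : (t ^+ n * beta_value (t - n%:R) n.+1 0 @[t --> +oo] --> (0 : R))%R.
  have tV : (t^-1 @[t --> +oo] --> (0 : R))%R.
    apply/(gtr0_cvgV0 (f := id)); last exact: cvg_id.
    by apply: nbhs_pinfty_gt; rewrite num_real.
  have YV := cvgM tV (@beta_value_cvg n%:R n.+1); rewrite mul0r in YV.
  apply: (@cvg_trans _ ((t^-1 * (t ^+ n.+1 * beta_value (t - n%:R) n.+1 0))%R @[t --> +oo%R]));
    last exact: YV.
  apply: near_eq_cvg; near=> t.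
  have t0 : (0 < t)%R by near: t; apply: nbhs_pinfty_gt; rewrite num_real.
  by rewrite exprS !mulrA mulVf ?gt_eqF// mul1r.
have lolim : ((1 - h) * ball_volume n * pi ^+ n * (t ^+ n * beta_value (t - n%:R) n 0) -
    B * pi ^+ n.+1 * (t ^+ n * beta_value (t - n%:R) n.+1 0)
    @[t --> +oo] --> ((1 - h) * ball_volume n * pi ^+ n * n`!%:R - B * pi ^+ n.+1 * 0 : R))%R.
  apply: cvgB; apply: cvgM => //; exact: cvg_cst.
have hilim : ((1 + h) * ball_volume n * pi ^+ n * (t ^+ n * beta_value (t - n%:R) n 0) +
    B * pi ^+ n.+1 * (t ^+ n * beta_value (t - n%:R) n.+1 0)
    @[t --> +oo] --> ((1 + h) * ball_volume n * pi ^+ n * n`!%:R + B * pi ^+ n.+1 * 0 : R))%R.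
  apply: cvgD; apply: cvgM => //; exact: cvg_cst.
have Ch : ((1 - h) * ball_volume n * pi ^+ n * n`!%:R - B * pi ^+ n.+1 * 0 = C - h * C)%R.
  rewrite mulr0 subr0 /C; move: (ball_volume n) (pi ^+ n)%R => w p; ring.
have Ch' : ((1 + h) * ball_volume n * pi ^+ n * n`!%:R + B * pi ^+ n.+1 * 0 = C + h * C)%R.
  rewrite mulr0 addr0 /C; move: (ball_volume n) (pi ^+ n)%R => w p; ring.
rewrite Ch in lolim; rewrite Ch' in hilim.
near=> t => x Sx.
have t0 : (0 < t - n%:R)%R.
  by rewrite subr_gt0; near: t; apply: nbhs_pinfty_gt; rewrite num_real.
have tn0 : (0 <= t ^+ n)%R.
  by rewrite exprn_ge0// (le_trans (ler0n R n))// -subr_ge0 ltW.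
have [lo hi] := BP _ x t0 Sx.
have Ige0 : 0 <= \int[area]_y (kern (t - n%:R) x y)%:E.
  by apply: integral_ge0 => y _; rewrite lee_fin kern_ge0.
have [r rE] : exists r, \int[area]_y (kern (t - n%:R) x y)%:E = r%:E.
  exists (fine (\int[area]_y (kern (t - n%:R) x y)%:E)); rewrite fineK// ge0_fin_numE//.
  by apply: le_lt_trans hi _; rewrite ltry.
move: lo hi; rewrite rE -EFinD -EFinM !lee_fin => lo hi.
have lo' : (C - e <= (1 - h) * ball_volume n * pi ^+ n * (t ^+ n * beta_value (t - n%:R) n 0) -
    B * pi ^+ n.+1 * (t ^+ n * beta_value (t - n%:R) n.+1 0))%R.
  by near: t; apply: (cvgr_ge _ lolim); rewrite ltrD2l ltrN2.
have hi' : ((1 + h) * ball_volume n * pi ^+ n * (t ^+ n * beta_value (t - n%:R) n 0) +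
    B * pi ^+ n.+1 * (t ^+ n * beta_value (t - n%:R) n.+1 0) <= C + e)%R.
  by near: t; apply: (cvgr_le _ hilim); rewrite ltrD2l.
move: {lo hi} (ler_wpM2l tn0 lo) (ler_wpM2l tn0 hi) lo' hi'; rewrite -/C.
move: (ball_volume n) (beta_value (t - n%:R) n 0) (beta_value (t - n%:R) n.+1 0).
move: (pi ^+ n)%R (pi ^+ n.+1)%R (t ^+ n)%R => p p' T w b b' lo hi lo' hi'.
split; [apply: (le_trans lo')|apply: le_trans hi'].
  lra.
lra.
Unshelve. all: by end_near. Qed.

End KernelIntegral.

(** * Energy near antipodal pairs *)

Section AntipodalEnergy.
Context {R : realType} {n : nat}.
Local Open Scope ereal_scope.
Local Notation V := ('rV[R]_n.+1).
Local Notation S := (sphere R n).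
Local Notation area := (@sphere_measure R n).
Local Notation lambda := (@sphere_measure R n \x @sphere_measure R n).
Implicit Types (A B X : set V) (G : set (V * V)) (t e : R).

Definition antikern t (p : V * V) : \bar R := (kern (t - n%:R) p.1 (- p.2)%R)%:E.

(* The second variable is reflected, so that the mass concentrates on the diagonal as [t] grows. *)
Definition energy t G : \bar R := (t ^+ n)%:E * \int[lambda]_(p in G) antikern t p.

Lemma antikern_ge0 t p : 0 <= antikern t p.
Proof. by rewrite lee_fin kern_ge0. Qed.

Lemma antikernC t x y : antikern t (x, y) = antikern t (y, x).
Proof. by rewrite /antikern/= -kernNN opprK kernC. Qed.

Lemma measurable_antikern t : measurable_fun setT (antikern t).
Proof. by apply: measurable_fun_kern => //; apply: measurable_fun_rowN. Qed.

Let measurable_antikernD t G : measurable_fun G (antikern t).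
Proof. exact: measurable_funTS (measurable_antikern t). Qed.

Lemma energy_ge0 t G : (0 <= t)%R -> 0 <= energy t G.
Proof.
move=> t0; rewrite mule_ge0 ?lee_fin ?exprn_ge0//.
by apply: integral_ge0 => p _; exact: antikern_ge0.
Qed.

Lemma le_energy t G1 G2 : (0 <= t)%R -> measurable G1 -> measurable G2 -> G1 `<=` G2 ->
  energy t G1 <= energy t G2.
Proof.
move=> t0 mG1 mG2 G12; rewrite lee_wpmul2l ?lee_fin ?exprn_ge0//.
by apply: ge0_subset_integral => // p _; exact: antikern_ge0.
Qed.

Lemma energyU t G1 G2 : (0 <= t)%R -> measurable G1 -> measurable G2 ->
  energy t (G1 `|` G2) <= energy t G1 + energy t G2.
Proof.
move=> t0 mG1 mG2; have mD : measurable (G2 `\` G1) by exact: measurableD.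
have -> : G1 `|` G2 = G1 `|` (G2 `\` G1) by rewrite setDE setUIr setUv setIT.
rewrite /energy ge0_integral_setU//; last 2 first.
- by move=> p _; exact: antikern_ge0.
- by apply/disj_setPS => p [G1p [_ /(_ G1p)]].
rewrite ge0_muleDr; [|by apply: integral_ge0 => p _; exact: antikern_ge0..].
rewrite leeD2l// lee_wpmul2l ?lee_fin ?exprn_ge0//.
by apply: ge0_subset_integral => //; move=> p _; exact: antikern_ge0.
Qed.

Lemma energy_iter t A B : measurable A -> measurable B ->
  energy t (A `*` B) =
    (t ^+ n)%:E * \int[area]_(x in A) \int[area]_(y in B) antikern t (x, y).
Proof.
move=> mA mB; congr (_ * _); rewrite integral_mkcond fubini_tonelli1; last 2 first.
- by apply/(measurable_restrictT _ _).1 => //; exact: measurableX.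
- by move=> p; rewrite patchE; case: ifP => // _; exact: antikern_ge0.
rewrite [RHS]integral_mkcond; apply: eq_integral => x _; rewrite /fubini_F patchE.
case: ifPn => xA.
  rewrite [RHS]integral_mkcond; apply: eq_integral => y _; rewrite !patchE in_setX xA//.
by apply: integral0_eq => y _; rewrite patchE in_setX (negbTE xA).
Qed.

Lemma energyC t A B : measurable A -> measurable B -> energy t (A `*` B) = energy t (B `*` A).
Proof.
move=> mA mB; congr (_ * _); rewrite [LHS]integral_mkcond [RHS]integral_mkcond.
have m (C D : set V) : measurable C -> measurable D ->
    measurable_fun setT (antikern t \_ (C `*` D)).
  by move=> mC mD; apply/(measurable_restrictT _ _).1 => //; exact: measurableX.
have pos (C D : set V) p : 0 <= (antikern t \_ (C `*` D)) p.
  by rewrite patchE; case: ifP => // _; exact: antikern_ge0.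
apply: etrans (fubini_tonelli1 (m1 := area) (m2 := area) _ (m A B mA mB) (pos A B)) _.
apply: etrans _ (esym (fubini_tonelli2 (m1 := area) (m2 := area) _ (m B A mB mA) (pos B A))).
apply: eq_integral => x _; apply: eq_integral => y _; rewrite !patchE !in_setX andbC.
by case: ifP => // _; exact: antikernC.
Qed.

Lemma energy_le_measure t G : (n%:R <= t)%R -> measurable G -> energy t G <= (t ^+ n)%:E * lambda G.
Proof.
move=> nt mG; have t0 : (0 <= t)%R := le_trans (ler0n _ _) nt.
rewrite lee_wpmul2l ?lee_fin ?exprn_ge0// -[leRHS]mul1e -integral_cst//.
apply: ge0_le_integral => //; first by move=> p _; exact: antikern_ge0.
by move=> p _; rewrite lee_fin kern_le1// subr_ge0.
Qed.

Let measurable_nS : measurable (~` S).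
Proof. by apply: measurableC; exact: measurable_sphere. Qed.

Lemma sphere_measure_setC : area (~` S) = 0.
Proof. by rewrite sphere_measureI setICl hausdorff0. Qed.

Lemma energy_off_sphere t X : (n%:R <= t)%R -> measurable X ->
  energy t ((~` S) `*` X) = 0.
Proof.
move=> nt mX; have t0 : (0 <= t)%R := le_trans (ler0n _ _) nt.
apply/eqP; rewrite eq_le energy_ge0// andbT.
apply: le_trans (energy_le_measure nt _) _; first exact: measurableX.
by rewrite product_measure1E// [X in _ * (X * _)]sphere_measure_setC mul0e mule0.
Qed.

(** Since [kern_limit] is uniform in [x], it can be integrated over the part of [X] on the sphere,
    with constants independent of [X]. *)
Lemma energy_strip e : (0 < e)%R -> \forall t \near +oo%R, forall X, measurable X ->
  energy t (X `*` setT) <= (ball_volume n * pi ^+ n * n`!%:R + e)%:E * area X /\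
  (ball_volume n * pi ^+ n * n`!%:R - e)%:E * area X <= energy t (X `*` setT).
Proof.
move=> e0; near=> t => X mX.
have nt : (n%:R <= t)%R by near: t; apply: nbhs_pinfty_ge; rewrite num_real.
have t0 : (0 <= t)%R := le_trans (ler0n _ _) nt.
have kP : forall x, S x -> (ball_volume n * pi ^+ n * n`!%:R - e)%:E <=
      (t ^+ n)%:E * \int[area]_y (kern (t - n%:R) x y)%:E /\
    (t ^+ n)%:E * \int[area]_y (kern (t - n%:R) x y)%:E <=
    (ball_volume n * pi ^+ n * n`!%:R + e)%:E.
  by near: t; exact: kern_limit.
have mS := @measurable_sphere R n.
have mXS : measurable (X `&` S) by exact: measurableI.
have Sid : energy t (X `*` setT) = energy t ((X `&` S) `*` setT).
  apply/eqP; rewrite eq_le; apply/andP; split; last first.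
    by apply: le_energy => //; [exact: measurableX..|move=> p [[]]].
  rewrite -[leRHS]adde0 -(@energy_off_sphere t setT nt measurableT).
  apply: le_trans (energyU t0 _ _); [|exact: measurableX..].
  apply: le_energy => //; [exact: measurableX| |].
    by apply: measurableU; exact: measurableX.
  move=> [x y] [Xx _]; have [Sx|Sx] := pselect (S x); [by left|by right].
have areaE : area X = area (X `&` S) by rewrite !sphere_measureI -setIA setIid.
pose Phi x := \int[area]_y antikern t (x, y).
have mPhi : measurable_fun setT Phi.
  exact: (measurable_fun_fubini_tonelli_F (m2 := area) _ (measurable_antikern t) (antikern_ge0 t)).
have Phi0 x : 0 <= Phi x by apply: integral_ge0 => y _; exact: antikern_ge0.
have mtPhi : measurable_fun (X `&` S) (fun x => (t ^+ n)%:E * Phi x).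
  by apply: measurable_funTS; apply: emeasurable_funM.
have E : energy t ((X `&` S) `*` setT) = \int[area]_(x in X `&` S) ((t ^+ n)%:E * Phi x).
  rewrite (energy_iter t mXS measurableT).
  apply/esym/ge0_integralZl_EFin => //; last by rewrite exprn_ge0.
  exact: measurable_funTS.
have PhiP x : S x -> (ball_volume n * pi ^+ n * n`!%:R - e)%:E <= (t ^+ n)%:E * Phi x /\
    (t ^+ n)%:E * Phi x <= (ball_volume n * pi ^+ n * n`!%:R + e)%:E.
  move=> Sx; have SN : S (- x)%R by rewrite /sphere/= dotpNl dotpNr opprK.
  rewrite (_ : Phi x = \int[area]_y (kern (t - n%:R) (- x)%R y)%:E); first exact: kP.
  by apply: eq_integral => y _; rewrite /antikern/= -kernNN opprK.
have C0 : (0 <= ball_volume n * pi ^+ n * n`!%:R + e)%R.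
  by rewrite addr_ge0 ?(ltW e0)// mulr_ge0// mulr_ge0 ?ball_volume_ge0// exprn_ge0// pi_ge0.
have tPhi0 x : 0 <= (t ^+ n)%:E * Phi x by rewrite mule_ge0 ?lee_fin ?exprn_ge0.
rewrite Sid E areaE; split.
  rewrite -integral_cst//; apply: ge0_le_integral => //.
  by move=> x [_ Sx]; have [] := PhiP _ Sx.
(* A negative lower constant makes the bound trivial, as energies are nonnegative. *)
have [Ce|Ce] := leP 0%R (ball_volume n * pi ^+ n * n`!%:R - e)%R.
  rewrite -integral_cst//; apply: ge0_le_integral => //.
  by move=> x [_ Sx]; have [] := PhiP _ Sx.
apply: (@le_trans _ _ 0); last by apply: integral_ge0.
by rewrite mule_le0_ge0// lee_fin ltW.
Unshelve. all: by end_near. Qed.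

Lemma energy_le_area : exists2 M : R, (0 <= M)%R &
  \forall t \near +oo%R, forall X, measurable X -> energy t (X `*` setT) <= M%:E * area X.
Proof.
exists (ball_volume n * pi ^+ n * n`!%:R + 1)%R.
  by rewrite addr_ge0// mulr_ge0// mulr_ge0 ?ball_volume_ge0// exprn_ge0// pi_ge0.
by near=> t => X mX; have [] : _ /\ _ := (near (energy_strip ltr01) t _ X mX).
Unshelve. all: by end_near. Qed.

Definition vanishing G : Prop := forall e, (0 < e)%R -> \forall t \near +oo%R, energy t G <= e%:E.

Lemma vanishingU G1 G2 : measurable G1 -> measurable G2 ->
  vanishing G1 -> vanishing G2 -> vanishing (G1 `|` G2).
Proof.
move=> mG1 mG2 v1 v2 e e0; have e20 : (0 < e / 2)%R by rewrite divr_gt0.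
near=> t; have t0 : (0 <= t)%R by near: t; apply: nbhs_pinfty_ge; rewrite num_real.
apply: le_trans (energyU t0 mG1 mG2) _; rewrite (splitr e) EFinD leeD//.
  by near: t; exact: v1.
by near: t; exact: v2.
Unshelve. all: by end_near. Qed.

Lemma vanishingS G1 G2 : measurable G1 -> measurable G2 -> G1 `<=` G2 ->
  vanishing G2 -> vanishing G1.
Proof.
move=> mG1 mG2 G12 v2 e e0; near=> t.
have t0 : (0 <= t)%R by near: t; apply: nbhs_pinfty_ge; rewrite num_real.
by apply: le_trans (le_energy t0 mG1 mG2 G12) _; near: t; exact: v2.
Unshelve. all: by end_near. Qed.

Definition separated A : Prop := vanishing (A `*` ~` A).

(** Replacing [A] by [B] costs at most the energy of the strip over their difference, which
    [energy_le_area] bounds by [M] times its area; [M] is fixed before [B] is chosen. *)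
Lemma separated_approx A : measurable A ->
  (forall e, (0 < e)%R -> exists B, [/\ measurable B, B `<=` A, area (A `\` B) <= e%:E &
    vanishing (B `*` ~` A)]) -> separated A.
Proof.
move=> mA HA e e0; have [M M0 MP] := energy_le_area.
have e20 : (0 < e / 2)%R by rewrite divr_gt0.
have [B [mB BA AB vB]] := HA (e / 2 / (M + 1))%R ltac:(by rewrite divr_gt0// ltr_wpDl).
near=> t; have t0 : (0 <= t)%R by near: t; apply: nbhs_pinfty_ge; rewrite num_real.
have mAB : measurable (A `\` B) by exact: measurableD.
have mAC : measurable (~` A) by exact: measurableC.
apply: (@le_trans _ _ (energy t ((B `*` ~` A) `|` ((A `\` B) `*` setT)))).
  apply: le_energy => //; first exact: measurableX.
    by apply: measurableU; exact: measurableX.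
  move=> [x y] [Ax Ay]; have [Bx|Bx] := pselect (B x); [by left|by right].
apply: le_trans (energyU t0 _ _) _; [exact: measurableX..|].
rewrite (splitr e) EFinD leeD//; first by near: t; exact: vB.
apply: (@le_trans _ _ (M%:E * area (A `\` B))).
  by move: mAB; move: (A `\` B); near: t; exact: MP.
apply: (@le_trans _ _ (M%:E * (e / 2 / (M + 1))%:E)); first by rewrite lee_wpmul2l ?lee_fin.
rewrite -EFinM lee_fin mulrCA ger_pMr// ler_pdivrMr ?ltr_wpDl// mul1r.
by rewrite lerDl.
Unshelve. all: by end_near. Qed.

Lemma separatedC A : measurable A -> separated A -> separated (~` A).
Proof.
move=> mA sA e e0; near=> t; rewrite setCK energyC//; last exact: measurableC.
by near: t; exact: sA.
Unshelve. all: by end_near. Qed.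

Lemma separatedU A B : measurable A -> measurable B -> separated A -> separated B ->
  separated (A `|` B).
Proof.
move=> mA mB sA sB; have mAC := measurableC mA; have mBC := measurableC mB.
apply: (vanishingS _ _ _ (vanishingU _ _ sA sB)).
- by apply: measurableX; [exact: measurableU|apply: measurableC; exact: measurableU].
- by apply: measurableU; exact: measurableX.
- move=> [x y] /= [[Ax|Bx] nAB]; [left|right]; split => //= h; apply: nAB; [by left|by right].
- exact: measurableX.
- exact: measurableX.
Qed.

Lemma area_exhaustion A (F : nat -> set V) e : (0 < e)%R -> (forall k, measurable (F k)) ->
  measurable A -> {homo F : i j / (i <= j)%N >-> i `<=` j} -> \bigcup_k F k = A ->
  exists k, area (A `\` F k) <= e%:E.
Proof.
move=> e0 mF mA ndF FA.
have mAF k : measurable (A `\` F k) by exact: measurableD.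
have : (area \o (fun k => A `\` F k)) x @[x --> \oo] --> area (\bigcap_k (A `\` F k)).
  apply: nonincreasing_cvg_mu => //.
  - by rewrite ltey_eq fin_num_measure.
  - exact: bigcapT_measurable.
  - by move=> i j ij; apply/subsetPset; apply: setDS; exact: ndF.
have -> : \bigcap_k (A `\` F k) = set0.
  apply/seteqP; split => // x xA; have [Ax _] := xA 0%N I.
  by move: (Ax); rewrite -FA => -[k _ Fx]; have [] := xA k I.
rewrite measure0 => /fine_cvgP[_ /cvgrPdist_le/(_ _ e0)[k _ /(_ k (leqnn k))]] /=.
rewrite sub0r normrN ger0_norm ?fine_ge0// => ke.
by exists k; rewrite -[area _]fineK ?lee_fin// fin_num_measure.
Qed.

(** Finite unions exhaust the countable one in area, and the complement of the whole union is
    smaller than that of a finite part. *)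
Lemma separated_bigcup (F : nat -> set V) : (forall k, measurable (F k)) ->
  (forall k, separated (F k)) -> separated (\bigcup_k F k).
Proof.
move=> mF sF; pose U k := \big[setU/set0]_(i < k) F i.
have mU k : measurable (U k) by apply: bigsetU_measurable.
have mA : measurable (\bigcup_k F k) by exact: bigcupT_measurable.
have UA k : U k `<=` \bigcup_k F k.
  by rewrite /U -bigcup_mkord => x [i _ Fx]; exists i.
apply: separated_approx => // e e0.
have [||k Uk] := @area_exhaustion _ U e e0 mU mA.
- by move=> i j ij; exact: subset_bigsetU.
- apply/seteqP; split; first by move=> x [k _ /UA].
  move=> x [k _ Fx]; exists k.+1 => //; rewrite /U big_ord_recr/=; by right.
exists (U k); split => //.
have sU : separated (U k).
  rewrite /U; elim: k {Uk} => [|k ih]; first rewrite big_ord0.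
    move=> e' e'0; near=> t; rewrite set0X /energy integral_set0 mule0 lee_fin ltW//.
  rewrite big_ord_recr/=; apply: separatedU => //; exact: mU.
apply: vanishingS sU.
- by apply: measurableX => //; exact: measurableC.
- by apply: measurableX => //; exact: measurableC.
- by move=> [x y] [Ux nA]; split => // Uy; apply: nA; exact: UA Uy.
Unshelve. all: by end_near. Qed.

End AntipodalEnergy.

Lemma expr_powR_decay (R : realType) n (q e : R) : 0 < q < 1 -> 0 < e ->
  \forall t \near +oo, t ^+ n * q `^ (t - n%:R) <= e.
Proof.
move=> /andP[q0 q1] e0; pose c := - ln q.
have c0 : 0 < c by rewrite oppr_gt0 ln_lt0// q0.
(* From exp(c t) >= (c t / (n + 1))^(n + 1), the quantity to be bounded is at most [K / t]. *)
pose K := (n.+1%:R / c) ^+ n.+1 * expR (c * n%:R).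
have K0 : 0 < K by rewrite mulr_gt0 ?expR_gt0// exprn_gt0// divr_gt0.
near=> t.
have t0 : 0 < t by near: t; apply: nbhs_pinfty_gt; rewrite num_real.
have tK : K / e <= t by near: t; apply: nbhs_pinfty_ge; rewrite num_real.
have ct0 : 0 < c * t / n.+1%:R by rewrite divr_gt0 ?mulr_gt0.
have expE : (c * t / n.+1%:R) ^+ n.+1 <= expR (c * t).
  have <- : expR (c * t / n.+1%:R) ^+ n.+1 = expR (c * t).
    by rewrite -expRM_natl mulrCA divff ?mulr1.
  rewrite lerXn2r ?nnegrE ?expR_ge0 ?(ltW ct0)//.
  by rewrite (le_trans _ (expR_ge1Dx _))// lerDr.
have -> : q `^ (t - n%:R) = expR (c * n%:R) / expR (c * t).
  rewrite /powR gt_eqF// -expRN -expRD; congr expR; rewrite /c; ring.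
rewrite mulrA ler_pdivrMr ?expR_gt0//; apply: le_trans (ler_wpM2l (ltW e0) expE).
rewrite ler_pdivrMr// in tK.
have -> : e * (c * t / n.+1%:R) ^+ n.+1 = (t * e) * t ^+ n * (n.+1%:R / c) ^- n.+1.
  rewrite !expr_div_n invf_div exprMn [t ^+ n.+1]exprS.
  move: (c ^+ n.+1) (n.+1%:R ^- n.+1) (t ^+ n) => u v w; ring.
have u0 : 0 < (n.+1%:R / c) ^+ n.+1 by rewrite exprn_gt0// divr_gt0.
rewrite ler_pdivlMr//; have := ler_wpM2l (exprn_ge0 n (ltW t0)) tK; rewrite /K.
move: (t ^+ n) (expR (c * n%:R)) ((n.+1%:R / c) ^+ n.+1) => T E u; lra.
Unshelve. all: by end_near. Qed.

Section BorelSeparated.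
Context {R : realType} {n : nat}.
Local Open Scope ereal_scope.
Local Notation V := ('rV[R]_n.+1).
Local Notation S := (sphere R n).
Local Notation area := (@sphere_measure R n).
Local Notation lambda := (@sphere_measure R n \x @sphere_measure R n).
Implicit Types (A B U X : set V) (G : set (V * V)) (t e : R).

Let measurable_nS : measurable (~` S).
Proof. by apply: measurableC; exact: measurable_sphere. Qed.

Lemma angle_lt1 (d : R) : (0 < d)%R -> (angle (- (1 - d)) < 1)%R.
Proof. by move=> d0; rewrite angleN gtrBl lt_angle ?lexx ?ltr01// mulr0 cos0 gtrBl. Qed.

(** Unit vectors at distance at least [d] have inner product at most 1 - d^2 / 2. The reflected
    kernel is then at most q^(t - n) with [q < 1], and this decay beats t^n. *)
Lemma vanishing_gap (d : R) G : (0 < d)%R -> measurable G ->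
  (forall p, G p -> [/\ S p.1, S p.2 & (d <= enorm (p.1 - p.2))%R]) -> vanishing G.
Proof.
move=> d0 mG GP e e0.
(* The maximum with 1/2 keeps [q] positive, as [expr_powR_decay] requires. *)
pose q := Num.max (2^-1)%R (angle (- (1 - d ^+ 2 / 2)))%R.
have q01 : (0 < q < 1)%R.
  rewrite lt_max gt_max invr_gt0 ltr0n/= invf_lt1 ?ltr1n//= angle_lt1//.
  by rewrite divr_gt0// exprn_gt0.
pose L := fine (lambda setT).
have LE : lambda setT = L%:E.
  rewrite fineK// -setXTT product_measure1E// fin_numM//; exact: fin_num_measure.
have L0 : (0 <= L)%R by rewrite fine_ge0.
have e1 : (0 < e / (L + 1))%R by rewrite divr_gt0// ltr_wpDl.
near=> t.
have nt : (n%:R <= t)%R by near: t; apply: nbhs_pinfty_ge; rewrite num_real.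
have t0 : (0 <= t)%R := le_trans (ler0n _ _) nt.
have dec : (t ^+ n * q `^ (t - n%:R) <= e / (L + 1))%R.
  by near: t; exact: expr_powR_decay.
have q0 : (0 <= q `^ (t - n%:R))%R by exact: powR_ge0.
apply: (@le_trans _ _ ((t ^+ n)%:E * ((q `^ (t - n%:R))%R%:E * lambda setT))).
  rewrite lee_wpmul2l ?lee_fin ?exprn_ge0//.
  apply: (@le_trans _ _ ((q `^ (t - n%:R))%R%:E * lambda G)); last first.
    by rewrite lee_wpmul2l// le_measure ?inE.
  rewrite -integral_cst//; apply: ge0_le_integral => //.
  - by move=> p _; exact: antikern_ge0.
  - exact: measurable_funTS (measurable_antikern t).
  - move=> [x y] /GP[/= Sx Sy dxy].
    rewrite lee_fin /kern ge0_ler_powR ?subr_ge0 ?nnegrE ?angle_ge0//.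
      by have /andP[/ltW] := q01.
    rewrite le_max; apply/orP; right; apply: nonincreasing_angle.
    rewrite dotpNr lerN2.
    have : (d ^+ 2 <= dotp (x - y) (x - y))%R.
      by rewrite -sqr_enorm lerXn2r ?nnegrE ?enorm_ge0 ?(ltW d0).
    rewrite dotpBl !dotpBr (dotpC y x); move: Sx Sy; rewrite /sphere/= => -> ->; lra.
rewrite LE -!EFinM lee_fin mulrA; apply: le_trans (ler_wpM2r L0 dec) _.
by rewrite mulrAC ler_pdivrMr ?ltr_wpDl// ler_pM2l// lerDl.
Unshelve. all: by end_near. Qed.

Lemma vanishing_off_sphere G : measurable G -> (forall p, G p -> ~ S p.1 \/ ~ S p.2) -> vanishing G.
Proof.
move=> mG GP e e0; near=> t.
have nt : (n%:R <= t)%R by near: t; apply: nbhs_pinfty_ge; rewrite num_real.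
have t0 : (0 <= t)%R := le_trans (ler0n _ _) nt.
apply: (@le_trans _ _ (energy t (((~` S) `*` setT) `|` (setT `*` (~` S))))).
  apply: le_energy => //; first by apply: measurableU; exact: measurableX.
  by move=> [x y] /GP[] /= h; [left|right].
apply: le_trans (energyU t0 _ _) _; [exact: measurableX..|].
rewrite [X in _ + X]energyC// energy_off_sphere// adde0 lee_fin ltW//.
Unshelve. all: by end_near. Qed.

Lemma separated_open U : open U -> separated U.
Proof.
move=> oU; have mU := open_measurable_row oU.
pose F k : set V := [set x | forall z, ~ U z -> (k.+1%:R^-1 <= enorm (x - z))%R].
have mF k : measurable (F k).
  apply: closed_measurable_row.
  have -> : F k = \bigcap_(z in ~` U) [set x | (k.+1%:R^-1 <= enorm (x - z))%R].
    by apply/seteqP; split => x Fx z; exact: Fx.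
  apply: closed_bigI => z _.
  have cf : continuous (fun x : V => enorm (x - z)).
    by move=> x; apply: continuous_comp; [exact: continuous_subr|exact: continuous_enorm].
  exact: (proj1 (continuous_closedP _) cf _ (closed_ge (y := (k.+1%:R^-1)%R))).
have FU k : F k `<=` U.
  move=> x Fx; apply: contrapT => /Fx; rewrite subrr enorm0 leNgt => /negP; apply.
  by rewrite invr_gt0.
apply: separated_approx => // e e0.
have [||k Fk] := @area_exhaustion R n U F e e0 mF mU.
- move=> i j ij x Fx z Uz; apply: le_trans (Fx z Uz).
  by rewrite lef_pV2 ?posrE// ler_nat.
- apply/seteqP; split => x; first by move=> [k _ /FU].
  move=> Ux; have := oU; rewrite openE => /(_ x Ux)/nbhs_ballP[r /= r0 rU].
  have [k kr] := exists_inv_le r0; exists k => // z nUz.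
  rewrite leNgt; apply/negP => xz; apply: nUz; apply: rU.
  split => // i j /=.
  have := le_lt_trans (coord_le_enorm (x - z) j) (lt_le_trans xz kr).
  by rewrite !mxE /ball/= ord1.
exists (F k); split => //.
have mUC := measurableC mU; have mS := @measurable_sphere R n.
(* The gap estimate concerns unit vectors, so pairs with a point off the sphere, which carry no
   mass, are treated apart. *)
pose G1 : set (V * V) := (F k `&` S) `*` (~` U `&` S).
pose G2 : set (V * V) := (F k `*` ~` U) `\` G1.
have mG1 : measurable G1 by apply: measurableX; exact: measurableI.
have mG2 : measurable G2 by apply: measurableD => //; exact: measurableX.
apply: (@vanishingS _ _ _ (G1 `|` G2)); [exact: measurableX|exact: measurableU| |].
  by rewrite /G2 => p Gp; have [?|?] := pselect (G1 p); [left|right].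
apply: vanishingU => //.
  apply: (@vanishing_gap k.+1%:R^-1) => //.
  by move=> [x y] [[Fx Sx] [Uy Sy]]; split => //; exact: Fx.
apply: vanishing_off_sphere => // -[x y] [[Fx Uy] nG].
have [Sx|] := pselect (S x); last by left.
by right => Sy; apply: nG.
Qed.

Lemma separated_measurable A : measurable A -> separated A.
Proof.
(* Measurability is carried along because the closure properties of separated sets presuppose it. *)
move=> mA; suff : measurable A /\ separated A by case.
have mP : <<s [set: V], @open V >> `<=` [set B | measurable B /\ separated B].
  apply: smallest_sub; last by move=> U oU; split; [exact: open_measurable_row|exact: separated_open].
  split => [|B [mB sB]|F FP].
  - by split => //; apply: separated_open; exact: open0.
  - by rewrite setTD; split; [exact: measurableC|exact: separatedC].
  - split; first by apply: bigcupT_measurable => k; have [] := FP k.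
    by apply: separated_bigcup => k; have [] := FP k.
exact: mP.
Qed.

(** Write X for the intersection of [A] and [B]. Then X x V lies in the union of A x B and B x ~B,
    and A x B lies in the union of X x V and ~B x B. The corrections vanish because [B] is
    separated, and [energy_strip] gives the limit for X x V. *)
Lemma energy_cvg A B : measurable A -> measurable B ->
  energy t (A `*` B) @[t --> +oo%R] -->
    (ball_volume n * pi ^+ n * n`!%:R)%:E * area (A `&` B).
Proof.
move=> mA mB; pose C : R := (ball_volume n * pi ^+ n * n`!%:R)%R.
have mX : measurable (A `&` B) by exact: measurableI.
pose a := fine (area (A `&` B)).
have aE : area (A `&` B) = a%:E by rewrite fineK// fin_num_measure.
have a0 : (0 <= a)%R by rewrite fine_ge0.
have mBC := measurableC mB.
have bounds e : (0 < e)%R -> \forall t \near +oo%R,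
    (C * a - e)%:E <= energy t (A `*` B) <= (C * a + e)%:E.
  move=> e0; have e1 : (0 < e / (a + 1))%R by rewrite divr_gt0// ltr_wpDl.
  have eE : (e / (a + 1) * a + e / (a + 1) = e)%R.
    by field; rewrite gt_eqF ?ltr_wpDl.
  near=> t.
  have t0 : (0 <= t)%R by near: t; apply: nbhs_pinfty_ge; rewrite num_real.
  have [up lo] : energy t ((A `&` B) `*` setT) <= (C + e / (a + 1))%:E * area (A `&` B) /\
      (C - e / (a + 1))%:E * area (A `&` B) <= energy t ((A `&` B) `*` setT).
    by move: mX; move: (A `&` B); near: t; exact: energy_strip.
  have s1 : energy t (B `*` ~` B) <= (e / (a + 1))%:E by near: t; exact: separated_measurable.
  have s2 : energy t (~` B `*` B) <= (e / (a + 1))%:E by rewrite energyC.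
  move: up lo; rewrite aE -!EFinM => up lo; apply/andP; split.
    have : (C * a - e)%:E + (e / (a + 1))%:E <= energy t (A `*` B) + (e / (a + 1))%:E.
      apply: (@le_trans _ _ (energy t ((A `&` B) `*` setT))).
        apply: le_trans lo; rewrite -EFinD lee_fin mulrBl; move: eE; lra.
      apply: (@le_trans _ _ (energy t ((A `*` B) `|` (B `*` ~` B)))).
        apply: le_energy => //; [exact: measurableX| |].
          by apply: measurableU; exact: measurableX.
        move=> [x y] [[Ax Bx] _]; have [By|By] := pselect (B y); [by left|by right].
      apply: le_trans (energyU t0 _ _) _; [exact: measurableX..|].
      by rewrite leeD2l.
    by rewrite leeD2rE.
  apply: (@le_trans _ _ (energy t (((A `&` B) `*` setT) `|` (~` B `*` B)))).
    apply: le_energy => //; [exact: measurableX| |].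
      by apply: measurableU; exact: measurableX.
    move=> [x y] [Ax By]; have [Bx|Bx] := pselect (B x); [by left|by right].
  apply: le_trans (energyU t0 _ _) _; [exact: measurableX..|].
  apply: le_trans (leeD up s2) _.
  rewrite -EFinD lee_fin mulrDl -addrA lerD2l; move: eE; lra.
rewrite aE -EFinM; apply/fine_cvgP; split.
  near=> t; have /andP[lo hi] : (C * a - 1)%:E <= energy t (A `*` B) <= (C * a + 1)%:E.
    by near: t; exact: bounds.
  by rewrite fin_numE -ltNye -ltey (lt_le_trans _ lo) ?ltNyr//= (le_lt_trans hi)// ltry.
apply/cvgrPdist_le => e e0; near=> t.
have /andP[lo hi] : (C * a - e)%:E <= energy t (A `*` B) <= (C * a + e)%:E.
  by near: t; exact: bounds.
have [r rE] : exists r, energy t (A `*` B) = r%:E.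
  exists (fine (energy t (A `*` B))); rewrite fineK//.
  by rewrite fin_numE -ltNye -ltey (lt_le_trans _ lo) ?ltNyr//= (le_lt_trans hi)// ltry.
move: lo hi; rewrite /= rE/= !lee_fin -/C => lo hi; rewrite ler_distlC.
by apply/andP; split; lra.
Unshelve. all: by end_near. Qed.

End BorelSeparated.

(** * The geodesic integral *)

Section GeodesicIntegral.
Context {R : realType} {n : nat}.
Local Open Scope ereal_scope.
Local Notation V := ('rV[R]_n.+1).
Local Notation S := (sphere R n).
Local Notation area := (@sphere_measure R n).
Implicit Types (E G : set V) (x y : V) (t : R).

Lemma ngeodist_angle x y : S x -> S y -> ngeodist x y = angle (dotp x y).
Proof.
move=> Sx Sy; rewrite /ngeodist /geodist /angle clamp_id//.
have := dotp_le_enorm x y; have := dotp_le_enorm (- x)%R y.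
by rewrite enormN !enorm_sphere// mulr1 dotpNl lerNl => -> ->.
Qed.

(** At [x = y] both sides are 0 for [t != n] and 1 for [t = n], by the conventions on [0^-1] and on
    powers of 0. *)
Lemma ngeodist_kern t x y : S x -> S y ->
  (1 / ngeodist x y `^ (n%:R - t))%R = kern (t - n%:R) x y.
Proof. by move=> Sx Sy; rewrite ngeodist_angle// div1r -powRN opprB. Qed.

Lemma sphere_measureN E : measurable E -> area [set (- x)%R | x in E] = area E.
Proof.
move=> mE; rewrite !sphere_measureI -(@hausdorff_isometry _ _ n (fun x => - x)%R (fun x => - x)%R (E `&` S)); last 2 first.
- by move=> x; rewrite opprK.
- by move=> x y; rewrite -opprD enormN.
congr (hausdorff n _); apply/seteqP; split => [_ [[x Ex <-] Sx]|_ [x [Ex Sx] <-]].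
  by exists x => //; split => //; move: Sx; rewrite /sphere/= dotpNl dotpNr opprK.
by split; [exists x|rewrite /sphere/= dotpNl dotpNr opprK].
Qed.

Lemma measurable_rowN E : measurable E -> measurable [set (- x)%R | x in E].
Proof.
move=> mE; have -> : [set (- x)%R | x in E] = (fun x => - x)%R @^-1` E.
  by apply/seteqP; split => [_ [x Ex <-]|x Ex] /=; [rewrite opprK|exists (- x)%R; rewrite ?opprK].
rewrite -[X in measurable X]setTI.
by apply: (measurable_fun_rowN (f := id)) => //.
Qed.

Lemma integral_sphere_measureN G (f : V -> \bar R) : measurable G -> measurable_fun setT f ->
  (forall y, 0 <= f y) ->
  \int[area]_(y in G) f y = \int[area]_(y in [set (- x)%R | x in G]) f (- y)%R.
Proof.
move=> mG mf f0.
have mN : measurable_fun setT (fun x : V => - x)%R by apply: (measurable_fun_rowN (f := id)).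
have -> : [set (- x)%R | x in G] = (fun x => - x)%R @^-1` G.
  by apply/seteqP; split => [_ [x Ex <-]|x Ex] /=; [rewrite opprK|exists (- x)%R; rewrite ?opprK].
transitivity (\int[pushforward area (fun x : V => - x)%R]_(y in G) f y).
  apply: eq_measure_integral => A mA _; rewrite /pushforward.
  rewrite -[LHS](sphere_measureN mA); congr (sphere_measure _).
  by apply/seteqP; split => [_ [x Ex <-]|x Ex] /=; [rewrite opprK|exists (- x)%R; rewrite ?opprK].
by rewrite ge0_integral_pushforward//; exact: measurable_funTS.
Qed.

(** Both domains of integration lie on the sphere, so [hausdorff n] may be replaced by [area];
    substituting [- y] for [y] then produces the reflected kernel. *)
Lemma geodesic_integralE t E : E `<=` S -> measurable E ->
  (t ^+ n)%:E * \int[hausdorff n]_(x in E) \int[hausdorff n]_(y in S `\` E)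
      (1 / (ngeodist x y `^ (n%:R - t)))%:E =
  energy t (E `*` [set (- x)%R | x in S `\` E]).
Proof.
move=> ES mE; have mG : measurable (S `\` E) by apply: measurableD => //; exact: measurable_sphere.
have hE G (f : V -> \bar R) : G `<=` S -> \int[hausdorff n]_(x in G) f x = \int[area]_(x in G) f x.
  move=> GS; apply: eq_measure_integral => A mA AG.
  by apply/esym/sphere_measureE; exact: subset_trans GS.
rewrite (energy_iter t mE (measurable_rowN mG)); congr (_ * _).
apply: etrans (hE E _ ES) _; apply: eq_integral => x xE.
have Sx : S x by apply: ES; move: xE; rewrite inE.
apply: etrans (hE (S `\` E) _ (@subDsetl _ S E)) _.
transitivity (\int[area]_(y in S `\` E) (kern (t - n%:R) x y)%:E).
  by apply: eq_integral => y; rewrite inE => -[Sy _]; rewrite ngeodist_kern.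
apply: integral_sphere_measureN => //; first exact: measurable_fun_kern.
by move=> y; rewrite lee_fin kern_ge0.
Qed.

End GeodesicIntegral.

Local Open Scope ereal_scope.

Theorem corollary5p3 (R : realType) (n : nat) (E : set 'rV[R]_n.+1)
    (n_ge1 : (1 <= n)%N) (E_sphere : E `<=` sphere R n)
    (E_Borel : measurable E) :
  (t ^+ n)%:E *
    \int[hausdorff n]_(x in E) \int[hausdorff n]_(y in sphere R n `\` E)
      (1 / (ngeodist x y `^ (n%:R - t)))%:E
  @[t --> +oo%R] -->
  hausdorff n.-1 (sphere R n.-1) * (pi ^+ n * (n.-1)`!%:R)%:E *
    hausdorff n ([set (- x)%R | x in E] `&` (sphere R n `\` E)).
Proof.
have mG : measurable (sphere R n `\` E) by apply: measurableD => //; exact: measurable_sphere.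
have mNG := measurable_rowN mG.
under eq_fun do rewrite geodesic_integralE//.
(* Here [n >= 1] enters: n! = n (n - 1)!, and [n * ball_volume n] is the area of the sphere of
   dimension [n.-1]. *)
have -> : hausdorff n.-1 (sphere R n.-1) * (pi ^+ n * (n.-1)`!%:R)%:E =
    (ball_volume n * pi ^+ n * n`!%:R)%:E.
  rewrite sphere_area prednK// -EFinM; congr EFin.
  have factE k : (0 < k)%N -> (k`! = k * (k.-1)`!)%N by case: k.
  rewrite (factE n)// natrM.
  move: (ball_volume n) (pi ^+ n)%R => w p; ring.
rewrite -(@sphere_measureE R n); last by move=> x [_ []].
(* The set produced by [energy_cvg] is the antipodal image of the one in the statement. *)
rewrite (_ : sphere_measure _ = sphere_measure (E `&` [set (- x)%R | x in sphere R n `\` E])).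
  exact: energy_cvg.
rewrite -[RHS]sphere_measureN; last exact: measurableI.
congr (sphere_measure _); apply/seteqP; split => [_ [[x Ex <-] GNx]|_ [x [Ex [y Gy yx]] <-]].
  by exists x => //; split => //; exists (- x)%R => //; rewrite opprK.
by split; [exists x|rewrite -yx opprK].
Qed.
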